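(* Let $\kappa\in\mathbb N$, $n\ge2$, $\pi^{n-1}\in\mathfrak m_{n-1}$ and $\pi^n\in\mathcal C(\pi^{n-1})$. Consider the following five properties: (i) $\ell^{\mathfrak G^{(\kappa)}}(\pi^n)=\ell^{\mathfrak G^{(\kappa)}}(\pi^{n-1})$; (ii) $\ell^{\mathcal H}(\pi^n)=\ell^{\mathcal H}(\pi^{n-1})$; (iii) $\pi^n=(\pi^{n-1},1)$, that is, a new species is discovered at $n$; (iv) $\mathcal L^{\mathfrak G^{(\kappa)}}(\pi^n)=\mathcal L^{\mathfrak G^{(\kappa)}}(\pi^{n-1})$; (v) $\mathcal L^{\mathcal H}(\pi^n)=\mathcal L^{\mathcal H}(\pi^{n-1})$. Properties (i), (ii), (iii) are equivalent for every exchangeable random partition. If $P$ is the law PDP$(\alpha,\theta)$ with $0\le\alpha<1$ and $\theta>-\alpha$, then (iii), (iv), (v) are equivalent (so that all five properties are equivalent).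
   Context: $\mathbb N=\{1,2,\dots\}$. $\mathcal S^{\downarrow}=\{s=(s(i):i\in\mathbb N): s(i)\ge s(i+1)\ge 0\ \forall i,\ \sum_i s(i)=1\}$ carries a probability measure $P$. For a nonnegative sequence $s$ with sum $1$, the Shannon entropy is $\mathcal H(s)=-\sum_{i}s(i)\log s(i)$ ($0\log0=0$) and the generalized Gini function is $\mathfrak G^{(\kappa)}(s)=1-\sum_i s(i)^{\kappa+1}$. Exchangeable random partition: let $S\sim P$, and let $(X_l:l\ge1)$ be i.i.d. uniform on $[0,1]$, independent of $S$. To $s\in\mathcal S^{\downarrow}$ one associates disjoint open subintervals of $[0,1]$ whose lengths ranked decreasingly are $s$. Two individuals $X_l,X_m$ are of the same species (class) if they fall in the same interval associated with $S$; species are numbered $1,2,\dots$ in order of first appearance. $k^n$ is the number of species among $X_1,\dots,X_n$, $\pi^n(j)$ is the number of the first $n$ individuals in the $j$-th discovered species, and $\pi^n=(\pi^n(1),\dots,\pi^n(k^n))$. $\mathfrak m_n$ is the set of possible values of $\pi^n$: finite vectors of positive integers with sum $n$; $\mathbf 1^n\in\mathfrak m_n$ is the vector of $n$ ones. $\mathcal C(\pi^{n-1})\subset\mathfrak m_n$ consists of the vectors obtained from $\pi^{n-1}$ by adding $1$ to one coordinate, together with $(\pi^{n-1},1)$. Plug-in quantities: for $\pi^n\in\mathfrak m_n$, $\mathcal H(\pi^n)=-\sum_{j=1}^{k^n}\frac{\pi^n(j)}{n}\log\frac{\pi^n(j)}{n}$, $\mathfrak G^{(\kappa)}(\pi^n)=1-\sum_{j=1}^{k^n}\big(\frac{\pi^n(j)}{n}\big)^{\kappa+1}$,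 and $$\ell^{\mathcal H}(\pi^n)=n\left(\mathcal H(\mathbf 1^n)-\mathcal H(\pi^n)\right),\qquad \ell^{\mathfrak G^{(\kappa)}}(\pi^n)=n^{\kappa+1}\left(\mathfrak G^{(\kappa)}(\mathbf 1^n)-\mathfrak G^{(\kappa)}(\pi^n)\right).$$ PDP$(\alpha,\theta)$ is the law $P$ on $\mathcal S^{\downarrow}$ of the decreasing rearrangement of $(\hat\pi(j):j\in\mathbb N)$, where $\hat\pi(1)=W_1$, $\hat\pi(j)=W_j\prod_{i=1}^{j-1}(1-W_i)$ for $j\ge2$, with independent $W_j\sim\mathrm{Beta}(1-\alpha,\theta+\alpha j)$. In that case $E_{\mathbf P(\cdot\mid\pi^n)}(G)$ denotes the Bayes posterior mean, i.e. the conditional expectation of $G(S)$ given that the abundance vector at step $n$ equals $\pi^n$ (every $\pi^n\in\mathfrak m_n$ has positive probability), and $$\mathcal L^{\mathcal H}(\pi^n)=(\theta+n)\left(E_{\mathbf P(\cdot\mid\mathbf 1^n)}(\mathcal H)-E_{\mathbf P(\cdot\mid\pi^n)}(\mathcal H)\right),$$ $$\mathcal L^{\mathfrak G^{(\kappa)}}(\pi^n)=\Big(\prod_{r=0}^{\kappa}(\theta+n+r)\Big)\left(E_{\mathbf P(\cdot\mid\mathbf 1^n)}(\mathfrak G^{(\kappa)})-E_{\mathbf P(\cdot\mid\pi^n)}(\mathfrak G^{(\kappa)})\right).$$ *)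

(* Defs.v *)
From HB Require Import structures.
From mathcomp Require Import all_boot all_order all_algebra finmap.
From mathcomp Require Import all_classical all_reals all_analysis.

Set Implicit Arguments.
Unset Strict Implicit.
Unset Printing Implicit Defensive.

Import Order.TTheory GRing.Theory Num.Theory.
Import numFieldNormedType.Exports.

Local Open Scope classical_set_scope.
Local Open Scope ring_scope.

(* Sequences (s(i))_{i >= 1}, (X_l)_{l >= 1}, (W_j)_{j >= 1} are indexed from 0:
   the Rocq index i stands for i + 1. *)

Record sdown (R : realType) := SDown {
  sdown_val :> nat -> R ;
  sdown_ge0 : forall i, 0 <= sdown_val i ;
  sdown_noninc : forall i, sdown_val i.+1 <= sdown_val i ;
  sdown_sum1 : (\sum_(0 <= i <oo) (sdown_val i)%:E = 1)%E }.

Section sdown_measurable.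
Context (R : realType).

HB.instance Definition _ := gen_eqMixin (sdown R).
HB.instance Definition _ := gen_choiceMixin (sdown R).

Let point_val (i : nat) : R := (i == 0)%:R.

Let point_ge0 i : 0 <= point_val i.
Proof. exact: ler0n. Qed.

Let point_noninc i : point_val i.+1 <= point_val i.
Proof. exact: ler0n. Qed.

Let point_sum1 : (\sum_(0 <= i <oo) (point_val i)%:E = 1)%E.
Proof.
rewrite (nneseries_split 0 1); last by move=> k _; rewrite lee_fin.
by rewrite add0n big_nat1 eseries0 ?adde0// => -[].
Qed.

HB.instance Definition _ :=
  isPointed.Build (sdown R) (SDown point_ge0 point_noninc point_sum1).

Definition sdown_cylinders : set (set (sdown R)) :=
  [set A | exists i (B : set R),
    measurable B /\ A = [set s : sdown R | B (s i)]].

Definition sdown_display : measure_display.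
Proof. exact: (sigma_display sdown_cylinders). Qed.

HB.instance Definition _ := @isMeasurable.Build sdown_display (sdown R)
  <<s sdown_cylinders >>
  (@sigma_algebra0 _ setT sdown_cylinders)
  (@sigma_algebraC _ sdown_cylinders)
  (@sigma_algebra_bigcup _ setT sdown_cylinders).

End sdown_measurable.

Section functionals.
Context (R : realType).
Local Open Scope ereal_scope.

(* Extended-real valued: the entropy of a sequence may be +oo.
   The convention 0 log 0 = 0 holds since ln 0 = 0. *)
Definition shannon (s : sdown R) : \bar R :=
  - \sum_(0 <= i <oo) (s i * ln (s i))%:E.

Definition gini (kappa : nat) (s : sdown R) : \bar R :=
  1 - \sum_(0 <= i <oo) (s i ^+ kappa.+1)%:E.

End functionals.

Section plug_in.
Context (R : realType).
Implicit Types (p q : seq nat) (kappa n : nat).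

(* The set m_n. *)
Definition abundance_vectors n : set (seq nat) :=
  [set p | all (fun x => 0 < x)%N p /\ sumn p = n].

(* The set C(p). *)
Definition successors p : set (seq nat) :=
  [set q | (exists2 j, (j < size p)%N & q = incr_nth p j) \/ q = rcons p 1%N].

Definition ones n : seq nat := nseq n 1%N.

(* The sample size n is recovered as sumn p. *)
Definition plug_shannon p : R :=
  - \sum_(x <- p) (x%:R / (sumn p)%:R) * ln (x%:R / (sumn p)%:R).

Definition plug_gini kappa p : R :=
  1 - \sum_(x <- p) (x%:R / (sumn p)%:R) ^+ kappa.+1.

Definition ell_shannon p : R :=
  (sumn p)%:R * (plug_shannon (ones (sumn p)) - plug_shannon p).

Definition ell_gini kappa p : R :=
  (sumn p)%:R ^+ kappa.+1 * (plug_gini kappa (ones (sumn p)) - plug_gini kappa p).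

End plug_in.

Section independence.
Context d (Omega : measurableType d) (R : realType) (Pr : probability Omega R).

Definition mutually_independent (X : nat -> Omega -> R) :=
  forall (J : {fset nat}) (B : nat -> set R), (forall j, measurable (B j)) ->
    (Pr (\bigcap_(j in [set` J]) X j @^-1` B j)
     = \prod_(j <- J) Pr (X j @^-1` B j))%E.

Definition sigma_sequence (X : nat -> Omega -> R) : set (set Omega) :=
  <<s [set E | exists l (B : set R), measurable B /\ E = X l @^-1` B] >>.

Definition independent_of d' (T : measurableType d') (S : Omega -> T)
    (X : nat -> Omega -> R) :=
  forall A E, measurable A -> sigma_sequence X E ->
    (Pr (S @^-1` A `&` E) = Pr (S @^-1` A) * Pr E)%E.

End independence.

Definition paint_interval (R : realType) (left : sdown R -> nat -> R)
    (s : sdown R) (i : nat) : set R :=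
  `]left s i, left s i + s i[.

(* An assignment, to each s, of disjoint open subintervals of [0, 1], the i-th
   one having length s i and left endpoint left s i (empty when s i = 0). *)
Record interval_assignment (R : realType) (left : sdown R -> nat -> R) : Prop := {
  assign_measurable : forall i, measurable_fun setT (left ^~ i) ;
  assign_in01 : forall s i, 0 <= left s i /\ left s i + s i <= 1 ;
  assign_disjoint : forall s, trivIset setT (paint_interval left s) }.

Record exch_partition (R : realType) (P : probability (sdown R) R) := {
  ep_display : measure_display ;
  ep_Omega : measurableType ep_display ;
  ep_Pr : probability ep_Omega R ;
  ep_S : {RV ep_Pr >-> sdown R} ;
  ep_X : nat -> {RV ep_Pr >-> R} ;
  ep_left : sdown R -> nat -> R ;
  ep_S_law : forall A, measurable A -> distribution ep_Pr ep_S A = P A ;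
  ep_X_uniform : forall l A, measurable A ->
    distribution ep_Pr (ep_X l) A = uniform_prob (@ltr01 R) A ;
  ep_X_indep : mutually_independent ep_Pr ep_X ;
  ep_SX_indep : independent_of ep_Pr ep_S ep_X ;
  ep_leftP : interval_assignment ep_left }.

Section partition.
Context (R : realType) (P : probability (sdown R) R) (E : exch_partition P).
Implicit Types (w : ep_Omega E) (p : seq nat) (kappa n : nat).

(* Almost surely every individual falls in some interval; the clause l == m only
   makes the relation reflexive on the exceptional null event. *)
Definition same_species w (l m : nat) : bool :=
  (l == m) || `[< exists i,
    paint_interval (@ep_left _ _ E) (ep_S E w) i (ep_X E l w) /\
    paint_interval (@ep_left _ _ E) (ep_S E w) i (ep_X E m w) >].

(* First representatives of the species among the first n individuals, in order
   of appearance. *)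
Definition discoverers n w : seq nat :=
  [seq l <- iota 0 n | ~~ has (same_species w l) (iota 0 l)].

Definition abundance n w : seq nat :=
  [seq count (same_species w l) (iota 0 n) | l <- discoverers n w].

Definition abundance_event p : set (ep_Omega E) :=
  [set w | abundance (sumn p) w = p].

(* E(G(S) | abundance vector = p), as an elementary conditional expectation. *)
Definition posterior_mean p (G : sdown R -> \bar R) : R :=
  fine (\int[ep_Pr E]_(w in abundance_event p) G (ep_S E w))%E
  / fine (ep_Pr E (abundance_event p)).

Definition bayes_ell_shannon (theta : R) p : R :=
  (theta + (sumn p)%:R) *
  (posterior_mean (ones (sumn p)) (@shannon R)
   - posterior_mean p (@shannon R)).

Definition bayes_ell_gini (theta : R) kappa p : R :=
  (\prod_(0 <= r < kappa.+1) (theta + (sumn p)%:R + r%:R)) *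
  (posterior_mean (ones (sumn p)) (gini kappa)
   - posterior_mean p (gini kappa)).

End partition.

Section PDP.
Context (R : realType).

Definition beta_kernel (a b x : R) : R := x `^ (a - 1) * (1 - x) `^ (b - 1).

(* The Beta function for real parameters; the library's beta_fun only covers
   natural ones. *)
Definition real_beta (a b : R) : R :=
  \int[lebesgue_measure]_(x in `]0, 1[) beta_kernel a b x.

Definition beta_distributed d (Omega : measurableType d)
    (Pr : probability Omega R) (W : Omega -> R) (a b : R) :=
  forall A : set R, measurable A ->
    (Pr (W @^-1` A) = \int[lebesgue_measure]_(x in A `&` `]0%R, 1%R[)
                        (beta_kernel a b x / real_beta a b)%:E)%E.

Definition stick_breaking (W : nat -> R) (j : nat) : R :=
  W j * \prod_(i < j) (1 - W i).

(* s lists the terms of a in nonincreasing order: each positive value occurs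
   equally often in both; zero terms of a are irrelevant. *)
Definition decreasing_rearrangement (a : nat -> R) (s : sdown R) :=
  forall x : R, 0 < x -> ([set i | a i = x] #= [set i | s i = x])%card.

Definition is_PDP (alpha theta : R) (P : probability (sdown R) R) : Prop :=
  exists (d : measure_display) (Omega : measurableType d)
    (Pr : probability Omega R) (W : nat -> {RV Pr >-> R})
    (V : {RV Pr >-> sdown R}),
  [/\ mutually_independent Pr W,
      forall j, beta_distributed Pr (W j) (1 - alpha) (theta + alpha * j.+1%:R),
      {ae Pr, forall w,
        decreasing_rearrangement (stick_breaking (fun j => W j w)) (V w)} &
      forall A, measurable A -> P A = distribution Pr V A].

End PDP.

(* Main.v *)
Require Import Defs.
From HB Require Import structures.
From mathcomp Require Import all_boot all_order all_algebra ring lra zify finmap.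
From mathcomp Require Import all_classical all_reals all_analysis.
From mathcomp Require Import measurable_realfun.

(** Each of the four equations compares the values at [pi1] and at [pi0] of a
functional of the form [sum_j phi (pi j)] with [phi 1 = 0] and [phi (x + 1) <> phi x] for
[x >= 1].  Adding a new species adds [phi 1 = 0] to such a functional, and adding
one individual to a species of size [x] adds [phi (x + 1) - phi x <> 0], so the
functional is unchanged exactly when a new species is discovered
([additive_new_species]).  The normalisations by [n] or [theta + n] and the
subtraction of the value at the vector of ones are what makes the remaining
dependence on [n] cancel.  The four functions [phi] are
[x^(kappa + 1) - x], [x ln x], and, with [(y)_k = y (y + 1) ... (y + k - 1)] and
[h x = sum_(i = 1..x) 1 / (i - alpha)],
[(x - alpha)_(kappa + 1) + alpha (1 - alpha)_kappa
 - x ((1 - alpha)_(kappa + 1) + alpha (1 - alpha)_kappa)]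
and [(x - alpha) h x - x].

The work lies in the last two, that is, in computing posterior means.  For a
vector [q] of positive integers, [dsum (psum s) q] is the sum of
[s(i_1)^q_1 ... s(i_k)^q_k] over pairwise distinct indices, written as a
polynomial in the power sums of [s].

- Given [S = s], the abundance vector is [p] with probability
  [N_p * dsum (psum s) (rev p)], where the integer [N_p > 0] does not depend on
  [s] ([prob_paint_abundance]).  The sample is almost surely described by the word
  of the intervals hit, and summing over all words is done letter by letter
  ([word_sum_weight]).  Hence the posterior mean of [G] is the ratio of the
  [P]-integrals of [G * dsum] and of [dsum] ([posterior_meanE]).

- Under PDP(alpha, theta) the integral of [dsum (psum s) q] is Pitman's product
  formula [pitman_moment] ([PDP_dsum]).  Removing the first stick gives a
  recursion from [theta] to [theta + alpha] for the left side ([gem_mean_rec]),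
  which the product satisfies too ([pitman_moment_rec]).  By induction on the
  length of [q] the difference of the two sides is multiplied at each step by a
  factor smaller than 1, and the infinite product of these factors vanishes
  because the harmonic series diverges ([gem_mean_pitman]).  Passing to the
  decreasing rearrangement does not change power sums.  Only integer moments of
  the beta law enter, and these follow from integration by parts
  ([beta_moments]).

- Multiplying [dsum _ q] by a power sum produces again sums over distinct
  indices, so the posterior mean of [sum_i s(i)^(r + 1)] is explicit
  ([integral_psum_dsum]), and by differences so is that of
  [sum_i s(i)^(r + 1) (1 - s(i))^m] ([integral_power_moment]).  The case [m = 0]
  gives the Gini function.  For the entropy,
  [- x ln x = sum_(m >= 1) x (1 - x)^m / m] turns the posterior mean into series
  [log_moment] which play the part of digamma values; raising the size of a
  species by one shifts such a series by a telescoping sum, and this is where the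
  harmonic numbers [h x] come from ([posterior_entropyE]). *)

Set Implicit Arguments.
Unset Strict Implicit.
Unset Printing Implicit Defensive.
Import Order.TTheory GRing.Theory Num.Theory.
Import numFieldNormedType.Exports.
Local Open Scope classical_set_scope.
Local Open Scope ring_scope.

(** * Sums over pairwise distinct indices *)

Definition rising (R : pzRingType) (x : R) (n : nat) : R := \prod_(i < n) (x + i%:R).

(** The index of the factor [a_i^r] coincides with one of the indices of a
distinct-index sum with exponents [q]: these are the exponents that result. *)
Fixpoint bumps (r : nat) (q : seq nat) : seq (seq nat) :=
  if q is x :: t then (x + r :: t)%N :: [seq x :: t' | t' <- bumps r t] else [::].

(** The ways to single out one exponent of [q], the one carried by a chosen
index, with the list of the others. *)
Fixpoint picks (q : seq nat) : seq (nat * seq nat) :=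
  if q is x :: t then (x, t) :: [seq (y.1, x :: y.2) | y <- picks t] else [::].

Lemma size_bumps r q q' : q' \in bumps r q -> size q' = size q.
Proof.
elim: q q' => [|x t IH] q' //=; rewrite in_cons => /orP[/eqP->//|].
by case/mapP => t' /IH <- ->.
Qed.

Lemma sumn_bumps r q q' : q' \in bumps r q -> sumn q' = (r + sumn q)%N.
Proof.
elim: q q' => [|x t IH] q' //=; rewrite in_cons => /orP[/eqP->|] /=; first lia.
by case/mapP => t' /IH E -> /=; lia.
Qed.

Lemma perm_picks q y : y \in picks q -> perm_eq q (y.1 :: y.2).
Proof.
elim: q y => [|x t IH] y //=; rewrite in_cons => /orP[/eqP->//|].
case/mapP => -[a b] /IH /= Hp -> /=.
by rewrite -(perm_cons x) in Hp; rewrite (perm_trans Hp) //; apply/permP => P /=; lia.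
Qed.

Lemma bumps_gt0 r q q' : all (ltn 0%N) q -> q' \in bumps r q -> all (ltn 0%N) q'.
Proof.
elim: q q' => [|x t IH] q' //= /andP[x0 Ht]; rewrite in_cons => /orP[/eqP->|] /=.
  by rewrite Ht andbT; lia.
by case/mapP => t' /(IH _ Ht) E -> /=; rewrite x0.
Qed.

Lemma size_picks q y : y \in picks q -> size q = (size y.2).+1.
Proof. by move/perm_picks/perm_size. Qed.

Lemma picks_gt0 q y : all (ltn 0%N) q -> y \in picks q -> (0 < y.1)%N /\ all (ltn 0%N) y.2.
Proof. by move=> q0 /perm_picks /perm_all E; move: q0; rewrite E /= => /andP. Qed.

Lemma sumn_picks q y : y \in picks q -> sumn q = (y.1 + sumn y.2)%N.
Proof. by move/perm_picks/perm_sumn => ->. Qed.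

Lemma sumn_ge_size q : all (ltn 0%N) q -> (size q <= sumn q)%N.
Proof. by elim: q => //= x t IH /andP[x0 /IH]; lia. Qed.

Section sums.
Variable R : comPzRingType.

Lemma big_bumps_cons (G : seq nat -> R) r x t :
  \sum_(q <- bumps r (x :: t)) G q
  = G (x + r :: t)%N + \sum_(t' <- bumps r t) G (x :: t').
Proof. by rewrite big_cons big_map. Qed.

Lemma big_picks_cons (G : nat -> seq nat -> R) x t :
  \sum_(y <- picks (x :: t)) G y.1 y.2
  = G x t + \sum_(y <- picks t) G y.1 (x :: y.2).
Proof. by rewrite big_cons big_map. Qed.

(** Increasing an exponent and then picking one: either the increased exponent is
the one picked, or the increase happened among the others. *)
Lemma picks_bumps (G : nat -> seq nat -> R) r q :
  \sum_(q' <- bumps r q) \sum_(y <- picks q') G y.1 y.2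
  = \sum_(y <- picks q) (G (y.1 + r)%N y.2 + \sum_(t' <- bumps r y.2) G y.1 t').
Proof.
elim: q G => [|x t IH] G; first by rewrite !big_nil.
rewrite big_bumps_cons (big_picks_cons G).
under [X in _ + X = _]eq_bigr => t' _ do rewrite (big_picks_cons G).
rewrite big_split /= (IH (fun y u => G y (x :: u))).
rewrite (big_picks_cons (fun a b => G (a + r)%N b + \sum_(t' <- bumps r b) G a t')) /=.
under [X in _ = _ + X]eq_bigr => y _ do rewrite big_bumps_cons.
rewrite !big_split /=; ring.
Qed.

Lemma sum_prod_bumps (f : nat -> R) (g : nat -> R) r q :
  {in q, forall x, f (x + r)%N = g x * f x} ->
  \sum_(q' <- bumps r q) \prod_(x <- q') f x
  = (\sum_(x <- q) g x) * \prod_(x <- q) f x.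
Proof.
elim: q => [|x t IH] fg; first by rewrite !big_nil mul0r.
rewrite big_bumps_cons !big_cons fg ?mem_head //.
under [X in _ + X = _]eq_bigr => t' _ do rewrite big_cons.
by rewrite -big_distrr /= IH => [|y yt]; [ring|rewrite fg // in_cons yt orbT].
Qed.

(** Recursion for the sum of [prod_j a_(i_j) ^ q_j] over pairwise distinct
[i_1, ..., i_k] in terms of the power sums [pw r = sum_i a_i ^ r]: from the
product over a free index [i_1], subtract the terms where [i_1] equals one of the
other indices.  Being a polynomial in power sums, it is visibly measurable and
insensitive to the order of the [a_i].  The argument [k] only bounds the
recursion. *)
Fixpoint dsum_rec (pw : nat -> R) (k : nat) (q : seq nat) : R :=
  if k is k'.+1 then
    if q is r :: t then
      pw r * dsum_rec pw k' t - \sum_(t' <- bumps r t) dsum_rec pw k' t'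
    else 1
  else 1.

Definition dsum pw q := dsum_rec pw (size q) q.

Lemma dsum_cons pw r t :
  dsum pw (r :: t) = pw r * dsum pw t - \sum_(t' <- bumps r t) dsum pw t'.
Proof.
rewrite /dsum /=; congr (_ - _); rewrite big_seq [RHS]big_seq.
by apply: eq_bigr => t' /size_bumps ->.
Qed.

(** If the family is a point of size [u] together with a rescaled family of
factor [v], at most one of the distinct indices sits at the point: either none,
and everything is rescaled, or exactly one, carrying one of the exponents. *)
Lemma dsum_shift (u v : nat -> R) (pw pw' : nat -> R) q :
  (forall m n, v (m + n)%N = v m * v n) ->
  (forall m n, u (m + n)%N = u m * u n) ->
  v 0%N = 1 ->
  all (ltn 0%N) q ->
  (forall r, (0 < r)%N -> pw r = u r + v r * pw' r) ->
  dsum pw q = v (sumn q) * dsum pw' q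
    + \sum_(y <- picks q) u y.1 * v (sumn y.2) * dsum pw' y.2.
Proof.
move=> vD uD v0 q0 pwE; have [n] := ubnP (size q); elim: n q q0 => // n IH [|r t] q0 sz.
  by rewrite /dsum /= big_nil v0 addr0 mulr1.
rewrite dsum_cons; case/andP: q0 => r0 t0.
rewrite (IH t) //.
have -> : \sum_(t' <- bumps r t) dsum pw t'
   = \sum_(t' <- bumps r t) (v (sumn t') * dsum pw' t')
     + \sum_(t' <- bumps r t)
          \sum_(y <- picks t') u y.1 * v (sumn y.2) * dsum pw' y.2.
  rewrite -big_split /= big_seq [RHS]big_seq; apply: eq_bigr => t' ht'.
  by rewrite IH // ?(size_bumps ht') //; apply: bumps_gt0 ht'.
rewrite (picks_bumps (fun x s => u x * v (sumn s) * dsum pw' s)).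
rewrite (big_picks_cons (fun x s => u x * v (sumn s) * dsum pw' s)).
rewrite pwE // dsum_cons /= vD.
have -> : \sum_(t' <- bumps r t) v (sumn t') * dsum pw' t'
   = v r * v (sumn t) * \sum_(t' <- bumps r t) dsum pw' t'.
  rewrite big_distrr /= big_seq [RHS]big_seq; apply: eq_bigr => t' /sumn_bumps ->.
  by rewrite vD.
have -> : \sum_(y <- picks t) (u (y.1 + r)%N * v (sumn y.2) * dsum pw' y.2 +
      \sum_(t' <- bumps r y.2) u y.1 * v (sumn t') * dsum pw' t')
  = u r * \sum_(y <- picks t) u y.1 * v (sumn y.2) * dsum pw' y.2
    + v r * \sum_(y <- picks t) u y.1 * v (sumn y.2)
         * \sum_(t' <- bumps r y.2) dsum pw' t'.
  rewrite !big_distrr /= -big_split /=; apply: eq_bigr => y _.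
  rewrite uD [in RHS]big_distrr /= big_distrr /=.
  congr (_ + _); first ring.
  rewrite big_seq [RHS]big_seq; apply: eq_bigr => t' /sumn_bumps ->.
  by rewrite vD; ring.
under [\sum_(y <- picks t) u y.1 * v (sumn (r :: y.2)) * _]eq_bigr => y _.
  rewrite dsum_cons /= vD.
  rewrite (_ : _ * _ = v r * pw' r * (u y.1 * v (sumn y.2) * dsum pw' y.2)
     - v r * (u y.1 * v (sumn y.2) * \sum_(t' <- bumps r y.2) dsum pw' t'));
     last by ring.
  over.
rewrite sumrB -!big_distrr /=.
rewrite -![\sum_(i <- bumps r t) dsum pw' i]/(\sum_(t' <- bumps r t) dsum pw' t').
ring.
Qed.
End sums.

(** * Rising factorials and the product formula *)

Section rising_factorials.
Variable R : realFieldType.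
Lemma rising0 (x : R) : rising x 0 = 1.
Proof. exact: big_ord0. Qed.
Lemma risingS (x : R) n : rising x n.+1 = rising x n * (x + n%:R).
Proof. exact: big_ord_recr. Qed.
Lemma risingSl (x : R) n : rising x n.+1 = x * rising (x + 1) n.
Proof.
rewrite /rising big_ord_recl /= addr0; congr (_ * _); apply: eq_bigr => i _.
by rewrite /bump /= natrD; ring.
Qed.
Lemma rising1 (x : R) : rising x 1 = x.
Proof. by rewrite risingS rising0 addr0 mul1r. Qed.
Lemma rising_gt0 (x : R) n : 0 < x -> 0 < rising x n.
Proof. by move=> x0; apply: prodr_gt0 => i _; rewrite ltr_wpDr. Qed.
Lemma risingD (x : R) m n : rising x (m + n) = rising x m * rising (x + m%:R) n.
Proof.
elim: n => [|n IH]; first by rewrite addn0 rising0 mulr1.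
by rewrite addnS !risingS IH natrD; ring.
Qed.

(** The value of [E (W^r (1 - W)^s)] for [W] with law Beta(a, b); see
[beta_moments]. *)
Definition beta_moment (a b : R) (r s : nat) : R :=
  rising a r * rising b s / rising (a + b) (r + s).

Variables alpha theta : R.
Hypotheses (a0 : 0 <= alpha) (a1 : alpha < 1) (ht : - alpha < theta).

(** The probability, under PDP(alpha, th), that the first [sumn q] individuals form
a prescribed partition with block sizes [q]. *)
Definition pitman_moment (th : R) (q : seq nat) : R :=
  \prod_(i < (size q).-1) (th + alpha * i.+1%:R) / rising (th + 1) (sumn q).-1
  * \prod_(x <- q) rising (1 - alpha) x.-1.

Lemma sum_picks q : \sum_(y <- picks q) (y.1%:R - alpha)
  = (sumn q)%:R - (size q)%:R * alpha :> R.
Proof.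
elim: q => [|x t IH]; first by rewrite big_nil /=; ring.
rewrite (big_picks_cons (fun x _ => x%:R - alpha : R)) IH /= natrD -[(size t).+1%:R]natr1; ring.
Qed.

(** The ratio on the right is the probability that the next individual belongs to a
new species; its product over successive [theta + i * alpha] is what has to vanish in
[gem_mean_pitman]. *)
Lemma pitman_moment_step q : all (ltn 0%N) q -> q != [::] ->
  beta_moment (1 - alpha) (theta + alpha) 0 (sumn q) * pitman_moment (theta + alpha) q
  = pitman_moment theta q
    * ((theta + (size q)%:R * alpha) / (theta + (sumn q)%:R)).
Proof.
move=> q0 qN.
have ab : 1 - alpha + (theta + alpha) = theta + 1 by ring.
have t1 : 0 < theta + 1 by move: a1 ht; lra.
have ta1 : 0 < theta + alpha + 1 by move: ht; lra.
have [k Ek] : exists k, size q = k.+1 by case: (q) qN => // x t _; exists (size t).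
have [n En] : exists n, sumn q = n.+1.
  by exists (sumn q).-1; have := sumn_ge_size q0; lia.
rewrite /beta_moment /pitman_moment En Ek /= ab rising0 mul1r add0n risingSl.
set Pi := \prod_(x <- q) _; set C := \prod_(i < k) (theta + alpha * i.+1%:R).
set C' := \prod_(i < k) _.
have E : (theta + alpha) * C' = C * (theta + alpha * k.+1%:R).
  transitivity (\prod_(i < k.+1) (theta + alpha * i.+1%:R)); last by rewrite big_ord_recr.
  rewrite big_ord_recl /= mulr1.
  congr (_ * _); apply: eq_bigr => i _; rewrite /bump /=.
  by rewrite -[i.+2%:R]natr1 -addrA; congr (_ + _); ring.
have r0 : rising (theta + alpha + 1) n != 0 by rewrite gt_eqF ?rising_gt0.
have r1 : rising (theta + 1) n != 0 by rewrite gt_eqF ?rising_gt0.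
have n0 : theta + n.+1%:R != 0 by rewrite gt_eqF // -natr1 addrCA ltr_wpDl // addrC.
have -> : rising (theta + 1) n.+1 = rising (theta + 1) n * (theta + n.+1%:R).
  by rewrite risingS -natr1; congr (_ * _); ring.
have -> : theta + k.+1%:R * alpha = theta + alpha * k.+1%:R by ring.
move: n0; move: (theta + n.+1%:R) => m n0.
transitivity ((theta + alpha) * C' / (rising (theta + 1) n * m) * Pi).
  by field; rewrite r0 r1 n0.
by rewrite E; field; rewrite r1 n0.
Qed.

(** The recursion obeyed by the moments of a stick-breaking sequence, where the
first stick carries none or one of the exponents.  Each term of the sum is
[(x - alpha) / (theta + n)] times the left side, and the first term is
[(theta + k alpha) / (theta + n)] times it. *)
Lemma pitman_moment_rec q : all (ltn 0%N) q -> q != [::] ->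
  pitman_moment theta q =
  beta_moment (1 - alpha) (theta + alpha) 0 (sumn q) * pitman_moment (theta + alpha) q
  + \sum_(y <- picks q) beta_moment (1 - alpha) (theta + alpha) y.1 (sumn y.2)
      * pitman_moment (theta + alpha) y.2.
Proof.
move=> q0 qN.
have ab : 1 - alpha + (theta + alpha) = theta + 1 by ring.
have t1 : 0 < theta + 1 by move: a1 ht; lra.
have ta1 : 0 < theta + alpha + 1 by move: ht; lra.
have [k Ek] : exists k, size q = k.+1 by case: (q) qN => // x t _; exists (size t).
have [n En] : exists n, sumn q = n.+1.
  by exists (sumn q).-1; have := sumn_ge_size q0; lia.
set Pi := \prod_(x <- q) rising (1 - alpha) x.-1.
set C := \prod_(i < k) (theta + alpha * i.+1%:R).
have -> : \sum_(y <- picks q) beta_moment (1 - alpha) (theta + alpha) y.1 (sumn y.2)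
      * pitman_moment (theta + alpha) y.2
   = \sum_(y <- picks q) (y.1%:R - alpha) * (C / rising (theta + 1) n.+1 * Pi).
  rewrite big_seq [RHS]big_seq; apply: eq_bigr => -[x t] yq /=.
  have /= := sumn_picks yq; rewrite En => Ex.
  have /= [x0 t0] := picks_gt0 q0 yq.
  have /= := size_picks yq; rewrite Ek => -[] Et.
  have -> : Pi = rising (1 - alpha) x.-1 * \prod_(z <- t) rising (1 - alpha) z.-1.
    by rewrite /Pi (perm_big _ (perm_picks yq)) big_cons.
  rewrite /beta_moment /pitman_moment ab -Ex /C Et.
  have -> : rising (1 - alpha) x = rising (1 - alpha) x.-1 * (x%:R - alpha).
    rewrite -{1}(prednK x0) risingS; congr (_ * _).
    by rewrite -{2}(prednK x0) -natr1; ring.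
  have E : rising (theta + alpha) (sumn t)
     * (\prod_(i < (size t).-1) (theta + alpha + alpha * i.+1%:R) / rising (theta + alpha + 1) (sumn t).-1)
     = \prod_(i < size t) (theta + alpha * i.+1%:R).
    case: (t) t0 => [|z s] /=; first by rewrite !rising0 !big_ord0 divr1 mulr1.
    move=> /andP[z0 _].
    rewrite -{1}(prednK (_ : 0 < z + sumn s)%N); last by lia.
    rewrite risingSl big_ord_recl /= mulr1.
    rewrite (eq_bigr (fun i : 'I_(size s) => theta + alpha * (bump 0 i).+1%:R)).
      have : rising (theta + alpha + 1) (z + sumn s).-1 != 0 by rewrite gt_eqF ?rising_gt0.
      by move=> ?; field.
    move=> i _; rewrite /bump /=.
    by rewrite -[i.+2%:R]natr1 -addrA; congr (_ + _); ring.
  rewrite -E; ring.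
rewrite pitman_moment_step // -mulr_suml sum_picks Ek En.
rewrite /pitman_moment Ek En /= -/C -/Pi risingS.
have r0 : rising (theta + 1) n != 0 by rewrite gt_eqF ?rising_gt0.
have n0 : theta + 1 + n%:R != 0 by rewrite gt_eqF // ltr_wpDr.
have -> : theta + n.+1%:R = theta + 1 + n%:R by rewrite -natr1; ring.
by rewrite -[n.+1%:R]natr1; field; rewrite r0 n0.
Qed.

(** The sum on the left is the integral of [psum s r * dsum (psum s) q], after
expansion over the coincidences of the index of the power sum. *)
Lemma pitman_moment_bumps q r : all (ltn 0%N) q -> q != [::] -> (0 < r)%N ->
  pitman_moment theta (r :: q) + \sum_(q' <- bumps r q) pitman_moment theta q'
  = pitman_moment theta q
    * (\sum_(x <- q) rising (x%:R - alpha) r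
       + (theta + (size q)%:R * alpha) * rising (1 - alpha) r.-1)
    / rising (theta + (sumn q)%:R) r.
Proof.
move=> q0 qN r0.
have t1 : 0 < theta + 1 by move: a1 ht; lra.
have [k Ek] : exists k, size q = k.+1 by case: (q) qN => // x t _; exists (size t).
have [n En] : exists n, sumn q = n.+1.
  by exists (sumn q).-1; have := sumn_ge_size q0; lia.
have -> : \sum_(q' <- bumps r q) pitman_moment theta q' =
   \prod_(i < k) (theta + alpha * i.+1%:R) / rising (theta + 1) (r + n)
   * \sum_(q' <- bumps r q) \prod_(x <- q') rising (1 - alpha) x.-1.
  rewrite big_distrr /= big_seq [RHS]big_seq; apply: eq_bigr => q' hq'.
  by rewrite /pitman_moment (size_bumps hq') (sumn_bumps hq') Ek En /= addnS.
have -> : \sum_(q' <- bumps r q) \prod_(x <- q') rising (1 - alpha) x.-1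
  = (\sum_(x <- q) rising (x%:R - alpha) r) * \prod_(x <- q) rising (1 - alpha) x.-1.
  apply: sum_prod_bumps => x xq; have x0 := allP q0 _ xq.
  rewrite -(prednK x0) addSn /= risingD mulrC; congr (rising _ _ * _).
  by rewrite -[in RHS]natr1; ring.
rewrite /pitman_moment /= Ek En addnS /= big_cons big_ord_recr /=.
have -> : rising (theta + 1) (r + n) = rising (theta + 1) n * rising (theta + n.+1%:R) r.
  by rewrite addnC risingD -natr1; congr (_ * rising _ _); ring.
have : rising (theta + 1) n != 0 by rewrite gt_eqF ?rising_gt0.
have : rising (theta + n.+1%:R) r != 0.
  by rewrite gt_eqF ?rising_gt0 // -natr1; have := ler0n R n; move: t1; lra.
by move=> ? ?; field; apply/andP.
Qed.

Lemma pitman_moment_gt0 q : all (ltn 0%N) q -> 0 < pitman_moment theta q.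
Proof.
move=> q0; rewrite /pitman_moment mulr_gt0 ?divr_gt0 //.
- apply: prodr_gt0 => i _; rewrite -natr1 mulrDr mulr1.
  by have := mulr_ge0 a0 (ler0n R i); move: ht; lra.
- by rewrite rising_gt0 //; move: a1 ht; lra.
- rewrite big_seq; apply: prodr_gt0 => x _.
  by rewrite rising_gt0 //; move: a1 ht; lra.
Qed.
End rising_factorials.

(** * Sums over words *)

Definition occurrences (d : seq nat) : seq nat := [seq count_mem x d | x <- undup d].

Lemma occurrences_cons_new i d : i \notin d -> occurrences (i :: d) = 1%N :: occurrences d.
Proof.
move=> /[dup] id; rewrite /occurrences /= => /negbTE -> /=; rewrite eqxx.
rewrite (count_memPn id); congr cons; apply/eq_in_map => x; rewrite mem_undup => xd.
by rewrite (_ : (i == x) = false) //; apply/negbTE; apply: contraNneq id => ->.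
Qed.

Lemma occurrences_cons_old i d : i \in d ->
  occurrences (i :: d) = incr_nth (occurrences d) (index i (undup d)).
Proof.
move=> id; rewrite /occurrences /= id.
have iu : i \in undup d by rewrite mem_undup.
have ltu : (index i (undup d) < size (undup d))%N by rewrite index_mem.
apply: (@eq_from_nth _ 0%N); first by rewrite size_incr_nth !size_map ltu.
move=> j; rewrite size_map => ju.
rewrite nth_incr_nth !(nth_map 0%N) //=; congr (_ + _)%N.
rewrite -(nth_index 0%N iu) /= nth_uniq ?undup_uniq // nth_index //.
Qed.

(** One more individual of an old species: sum of [phi] over the vectors obtained by
raising one entry. *)
Definition phi_incr (phi : seq nat -> nat) (t : seq nat) : nat :=
  (\sum_(j < size t) phi (incr_nth t j))%N.

(** The sum of [phi] over the vectors of block sizes of the partitions of [n]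
individuals into [k] blocks, listed from the last block
discovered to the first. *)
Fixpoint word_count (n : nat) (phi : seq nat -> nat) (k : nat) : nat :=
  match n, k with
  | 0, 0 => phi [::]
  | n'.+1, k'.+1 =>
      (word_count n' (phi_incr phi) k'.+1 + word_count n' (fun t => phi (1%N :: t)) k')%N
  | _, _ => 0%N
  end.

Lemma word_count_gt0 n phi t : all (ltn 0%N) t -> sumn t = n ->
  (0 < phi t)%N -> (0 < word_count n phi (size t))%N.
Proof.
elim: n phi t => [|n IH] phi [|x t] //=.
- by move=> /andP[x0 _] H; exfalso; move: x0 H => /=; lia.
- move=> /andP[x0 t0] sn phi0; rewrite addn_gt0.
  case: x x0 sn phi0 => [//|[|x]] _ sn phi0.
    by rewrite (IH (fun t => phi (1%N :: t)) t) ?orbT //; move: sn => /=; lia.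
  rewrite (IH _ (x.+1 :: t)) //; first by move: sn => /=; lia.
  by rewrite /phi_incr big_ord_recl /= addn_gt0 phi0.
Qed.

Section words.
Variable R : realType.
Local Open Scope ereal_scope.

(** Sum over all words of length [n].  The last letter added is the head of the
list, and the innermost sum runs over it. *)
Fixpoint word_sum (n : nat) (Psi : seq nat -> \bar R) : \bar R :=
  if n is n'.+1 then word_sum n' (fun d => \sum_(0 <= i <oo) Psi (i :: d))
  else Psi [::].

Lemma eq_word_sum n (P1 P2 : seq nat -> \bar R) :
  P1 =1 P2 -> word_sum n P1 = word_sum n P2.
Proof. by move=> /funext ->. Qed.

Lemma word_sum_ge0 n (P : seq nat -> \bar R) : (forall d, 0 <= P d) -> 0 <= word_sum n P.
Proof.
elim: n P => [|n IH] P P0 //=; apply: IH => d; apply: nneseries_ge0 => i _ _; exact: P0.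
Qed.

Lemma word_sumD n (P1 P2 : seq nat -> \bar R) :
  (forall d, 0 <= P1 d) -> (forall d, 0 <= P2 d) ->
  word_sum n (fun d => P1 d + P2 d) = word_sum n P1 + word_sum n P2.
Proof.
elim: n P1 P2 => [|n IH] P1 P2 h1 h2 //=.
rewrite -IH; [|by move=> d; apply: nneseries_ge0|by move=> d; apply: nneseries_ge0].
by apply: eq_word_sum => d; rewrite nneseriesD.
Qed.

Lemma word_sumZ n (c : R) (P : seq nat -> \bar R) :
  (0 <= c)%R -> (forall d, 0 <= P d) ->
  word_sum n (fun d => c%:E * P d) = c%:E * word_sum n P.
Proof.
move=> c0; elim: n P => [|n IH] P P0 //=.
rewrite -IH; last by move=> d; apply: nneseries_ge0.
by apply: eq_word_sum => d; rewrite nneseriesZl.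
Qed.

Lemma word_sum_sum n I (s : seq I) (P : I -> seq nat -> \bar R) :
  (forall i d, 0 <= P i d) ->
  word_sum n (fun d => \sum_(i <- s) P i d) = \sum_(i <- s) word_sum n (P i).
Proof.
move=> P0; elim: s => [|x s IH].
  rewrite big_nil (_ : (fun d => _) = (fun d => 0%R%:E * 0)).
    by rewrite word_sumZ // mul0e.
  by apply/funext => d; rewrite big_nil mul0e.
rewrite big_cons -IH -word_sumD //; last by move=> d; apply: sume_ge0.
by apply: eq_word_sum => d; rewrite big_cons.
Qed.

Lemma nneseries_mem (d : seq nat) (x : nat -> R) : (forall i, 0 <= x i)%R ->
  \sum_(0 <= i <oo) ((i \in d)%:R * x i)%:E = (\sum_(i <- undup d) x i)%:E.
Proof.
move=> x0.
have [N HN] : exists N, forall i, i \in d -> (i < N)%N.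
  by exists (\max_(i <- d) i).+1 => i id; rewrite ltnS; apply: leq_bigmax_seq.
rewrite (nneseries_split 0 N); last by move=> i _; rewrite lee_fin mulr_ge0.
rewrite eseries0 ?adde0; last first.
  move=> i; rewrite add0n => Ni _; case: (boolP (i \in d)) => [/HN|]; first by rewrite ltnNge Ni.
  by rewrite mul0r.
rewrite add0n sumEFin; congr (_%:E).
rewrite (bigID (fun i => i \in d)) /= [X in (_ + X)%R]big1 ?addr0; last first.
  by move=> i /negbTE ->; rewrite mul0r.
rewrite -big_filter; under eq_big_seq => i do [].
rewrite [LHS](perm_big (undup d)) /=.
  by rewrite big_seq [RHS]big_seq; apply: eq_bigr => i; rewrite mem_undup => ->; rewrite mul1r.
apply: uniq_perm; rewrite ?filter_uniq ?iota_uniq ?undup_uniq // => i.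
rewrite mem_filter mem_undup mem_index_iota /=.
by case: (boolP (i \in d)) => //= /HN.
Qed.

Definition psum (a : nat -> R) (r : nat) : R := fine (\sum_(0 <= i <oo) (a i ^+ r)%:E).

Definition subprob (a : nat -> R) :=
  (forall i, 0 <= a i)%R /\ \sum_(0 <= i <oo) (a i)%:E <= 1.

Lemma subprob_le1 a : subprob a -> forall i, (a i <= 1)%R.
Proof.
case=> a0 a1 i; rewrite -lee_fin; apply: le_trans a1.
rewrite (nneseries_split 0 i.+1); last by move=> k _; rewrite lee_fin.
rewrite add0n big_nat_recr //= -[leLHS]add0e -[leLHS]adde0.
rewrite leeD ?leeD2r //; first by apply: sume_ge0 => k _; rewrite lee_fin.
by apply: nneseries_ge0 => k _ _; rewrite lee_fin.
Qed.

Lemma psum_le a r : subprob a -> (0 < r)%N ->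
  \sum_(0 <= i <oo) (a i ^+ r)%:E <= 1.
Proof.
move=> sa r0; case: (sa) => a0; apply: le_trans.
apply: lee_nneseries => i _; rewrite lee_fin ?exprn_ge0 //.
by case: r r0 => // r _; rewrite exprS ler_piMr // exprn_ile1 // subprob_le1.
Qed.

Lemma psumE a r : subprob a -> (0 < r)%N ->
  \sum_(0 <= i <oo) (a i ^+ r)%:E = (psum a r)%:E.
Proof.
move=> sa r0; rewrite /psum fineK // ge0_fin_numE.
  exact: le_lt_trans (psum_le sa r0) (ltry _).
by apply: nneseries_ge0 => i _ _; rewrite lee_fin exprn_ge0 // sa.1.
Qed.

Lemma psum_ge0 a r : subprob a -> (0 < r)%N -> (0 <= psum a r)%R.
Proof.
move=> sa r0; rewrite -lee_fin -psumE //.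
by apply: nneseries_ge0 => i _ _; rewrite lee_fin exprn_ge0 // sa.1.
Qed.

Lemma psum_le1 a r : subprob a -> (0 < r)%N -> (psum a r <= 1)%R.
Proof. by move=> sa r0; rewrite -lee_fin -psumE // psum_le. Qed.

Definition label_weight (a : nat -> R) (e q : seq nat) : R :=
  (\prod_(z <- zip e q) a z.1 ^+ z.2)%R.

Lemma label_weight_bumps a e t r : size e = size t ->
  (\sum_(t' <- bumps r t) label_weight a e t'
   = (\sum_(i <- e) a i ^+ r) * label_weight a e t)%R.
Proof.
elim: t e => [|x t IH] [|i e] // => [_|[] se]; first by rewrite !big_nil mul0r.
rewrite big_bumps_cons /label_weight /= !big_cons /= exprD.
under [X in (_ + X)%R = _]eq_bigr => t' _ do rewrite big_cons /=.
by rewrite -big_distrr /= -!/(label_weight _ _ _) IH //; ring.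
Qed.

Lemma label_weight_ge0 a e q : (forall i, 0 <= a i)%R -> (0 <= label_weight a e q)%R.
Proof. by move=> a0; apply: prodr_ge0 => z _; rewrite exprn_ge0. Qed.

(** Words whose letters occur with multiplicities [occurrences d] get the coefficient
[phi (occurrences d)]; the monomial carries the exponents [q] on the distinct
letters of [d], and words whose number of distinct letters is not [size q] do not
count.  For [q = occurrences d] the monomial is the product of all the letters. *)
Definition word_weight (a : nat -> R) (phi : seq nat -> nat) (q d : seq nat) : R :=
  ((phi (occurrences d) * (size (undup d) == size q))%:R * label_weight a (undup d) q)%R.

Lemma word_weight_ge0 a phi q d : (forall i, 0 <= a i)%R -> (0 <= word_weight a phi q d)%R.
Proof. by move=> a0; rewrite mulr_ge0 ?label_weight_ge0. Qed.

(** A new letter [i] either belongs to [d], and then raises one multiplicity, or is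
new and carries the exponent [r]; allowing it to range over all letters in the
second case adds the terms in which the letter coincides with an old one, which
are the ones on the left. *)
Lemma word_weight_step a phi r t d : subprob a -> (0 < r)%N ->
  \sum_(0 <= i <oo) (word_weight a phi (r :: t) (i :: d))%:E
    + \sum_(t' <- bumps r t) (word_weight a (fun s => phi (1%N :: s)) t' d)%:E
  = (word_weight a (phi_incr phi) (r :: t) d)%:E
    + (psum a r)%:E * (word_weight a (fun s => phi (1%N :: s)) t d)%:E.
Proof.
move=> sa r0; have a0 := sa.1.
set c := word_weight a (fun s => phi (1%N :: s)) t d.
have c0 : (0 <= c)%R by apply: word_weight_ge0.
have -> : \sum_(t' <- bumps r t) (word_weight a (fun s => phi (1%N :: s)) t' d)%:E
    = \sum_(0 <= i <oo) ((i \in d)%:R * (c * a i ^+ r))%:E.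
  rewrite nneseries_mem; last by move=> i; apply: mulr_ge0 => //; apply: exprn_ge0.
  rewrite sumEFin -big_distrr /=; congr (_%:E).
  rewrite big_seq.
  under eq_bigr => t' ht' do rewrite /word_weight (size_bumps ht').
  rewrite -big_seq -big_distrr /= /c /word_weight.
  case: eqP => [e|_]; last by rewrite muln0 !mul0r.
  by rewrite label_weight_bumps // [in RHS]mulrAC mulrA.
have E2 : (word_weight a (phi_incr phi) (r :: t) d)%:E
   = \sum_(0 <= i <oo) ((i \in d)%:R * ((phi (occurrences (i :: d)) * (size (undup d) == size (r :: t)))%:R
        * label_weight a (undup d) (r :: t)))%:E.
  rewrite nneseries_mem; last by move=> i; rewrite mulr_ge0 ?label_weight_ge0.
  rewrite -big_distrl /= /word_weight; congr (_ * _)%:E.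
  rewrite -natr_sum -big_distrl /=; congr ((_ * _)%:R).
  rewrite /phi_incr size_map (big_nth 0%N) big_mkord; apply: eq_bigr => j _.
  rewrite occurrences_cons_old ?index_uniq ?undup_uniq //.
  by rewrite -mem_undup mem_nth.
rewrite E2 -psumE //.
rewrite [X in _ = _ + X]muleC -nneseriesZl; last by move=> i _; rewrite lee_fin exprn_ge0.
have c1 i : (0 <= (i \in d)%:R * (c * a i ^+ r))%R.
  by rewrite mulr_ge0 // mulr_ge0 // exprn_ge0.
have c2 i : (0 <= (i \in d)%:R * ((phi (occurrences (i :: d)) * (size (undup d) == size (r :: t)))%:R
        * label_weight a (undup d) (r :: t)))%R.
  by rewrite !mulr_ge0 ?label_weight_ge0.
have c3 i : 0 <= c%:E * (a i ^+ r)%:E.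
  by rewrite -EFinM lee_fin mulr_ge0 // exprn_ge0.
rewrite -nneseriesD => [|i _ _|i _ _]; rewrite ?lee_fin ?word_weight_ge0 //.
rewrite -nneseriesD => [|i _ _|i _ _]; rewrite // ?lee_fin //.
apply: eq_eseriesr => i _; rewrite -EFinM -!EFinD; congr (_%:E).
rewrite /word_weight; case: (boolP (i \in d)) => [id|id].
  by rewrite /= id !mul1r.
rewrite /= (negbTE id) !mul0r addr0 add0r occurrences_cons_new //= eqSS.
rewrite /c /word_weight /label_weight /= big_cons /=.
by rewrite -!mulrA; congr (_ * _)%R; rewrite mulrC.
Qed.

(** The weighted sum over words splits according to the partition of the positions
into classes of equal letters; each partition with [size q] blocks contributes the
same sum over distinct letters.  The weight [phi] and the exponents [q] are
decoupled so that the induction on [n] goes through. *)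
Lemma word_sum_weight a phi n q : subprob a -> all (ltn 0%N) q ->
  word_sum n (fun d => (word_weight a phi q d)%:E)
  = ((word_count n phi (size q))%:R * dsum (psum a) q)%:E.
Proof.
move=> sa; have a0 := sa.1; elim: n phi q => [|n IH] phi [|r t] q0.
- by rewrite /= /word_weight /label_weight /= big_nil /= muln1.
- by rewrite /= /word_weight /= muln0 !mul0r.
- rewrite [RHS]/= mul0r /= (_ : (fun d => _) = (fun d => 0%R%:E * 0)).
    by rewrite word_sumZ // mul0e.
  apply/funext => d; rewrite mul0e eseries0 // => i _ _.
  rewrite /word_weight (_ : size (undup (i :: d)) == size [::] = false) ?muln0 ?mul0r //.
  by rewrite size_eq0; apply/eqP => /(congr1 (fun s => i \in s)); rewrite mem_undup mem_head.
- case/andP: (q0) => r0 t0.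
  set B := \sum_(t' <- bumps r t) word_sum n (fun d => (word_weight a (fun s => phi (1%N :: s)) t' d)%:E).
  have EB : B = ((word_count n (fun s => phi (1%N :: s)) (size t))%:R
       * \sum_(t' <- bumps r t) dsum (psum a) t')%:E.
    rewrite /B big_distrr /= -sumEFin big_seq [RHS]big_seq; apply: eq_bigr => t' ht'.
    by rewrite IH ?(size_bumps ht') // (bumps_gt0 t0 ht').
  have : word_sum n.+1 (fun d => (word_weight a phi (r :: t) d)%:E) + B
    = ((word_count n (phi_incr phi) (size (r :: t)))%:R * dsum (psum a) (r :: t))%:E
      + ((psum a r) * ((word_count n (fun s => phi (1%N :: s)) (size t))%:R * dsum (psum a) t))%:E.
    rewrite -[in RHS]IH // EFinM -[in RHS]IH //.
    rewrite -word_sumZ ?psum_ge0 //; last by move=> d; rewrite lee_fin word_weight_ge0.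
    rewrite /B -word_sum_sum; last by move=> ? ?; rewrite lee_fin word_weight_ge0.
    rewrite [word_sum n.+1 _]/= -word_sumD; last 2 first.
    + by move=> d; apply: nneseries_ge0 => i _ _; rewrite lee_fin word_weight_ge0.
    + by move=> d; apply: sume_ge0 => i _; rewrite lee_fin word_weight_ge0.
    rewrite -word_sumD; last 2 first.
    + by move=> d; rewrite lee_fin word_weight_ge0.
    + by move=> d; rewrite -EFinM lee_fin mulr_ge0 ?psum_ge0 ?word_weight_ge0.
    by apply: eq_word_sum => d; rewrite word_weight_step.
  rewrite EB -EFinD => /esym/eqP; rewrite -sube_eq //; last by rewrite fin_num_adde_defl.
  move=> /eqP <-; rewrite -EFinB; congr (_%:E).
  by rewrite [size _]/= natrD dsum_cons; ring.
Qed.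

(** The subtractions in the definition hide the sign; it is recovered from the
expression as a sum over words. *)
Lemma dsum_ge0 a q : subprob a -> all (ltn 0%N) q -> (0 <= dsum (psum a) q)%R.
Proof.
move=> sa q0.
have := word_sum_weight (fun _ => 1%N) (sumn q) sa q0 => E.
have N0 := @word_count_gt0 _ (fun _ => 1%N) _ q0 erefl isT.
rewrite -(pmulr_rge0 _ (_ : 0 < (word_count (sumn q) (fun _ => 1%N) (size q))%:R)%R) ?ltr0n //.
rewrite -lee_fin -E; apply: word_sum_ge0 => d.
by rewrite lee_fin word_weight_ge0 //; exact: sa.1.
Qed.
End words.

Lemma dsum_le (R : realType) (a : nat -> R) q : subprob a -> all (ltn 0%N) q ->
  dsum (psum a) q <= 1.
Proof.
move=> sa; elim: q => [|r t IH] q0; first by [].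
have /andP[r0 t0] := q0.
rewrite dsum_cons lerBlDr; apply: le_trans (_ : 1 <= _).
  rewrite -[leRHS]mul1r ler_pM ?psum_ge0 ?dsum_ge0 ?psum_le1 ?IH //.
rewrite lerDl big_seq sumr_ge0 // => t' ht'; rewrite dsum_ge0 //.
exact: bumps_gt0 ht'.
Qed.

(** * Independence *)

Section independence.
Context d (Omega : measurableType d) (R : realType) (Pr : probability Omega R).
Variable X : nat -> {RV Pr >-> R}.
Local Open Scope ereal_scope.

Definition observable_events : set (set Omega) :=
  [set E | exists l (B : set R), measurable B /\ E = X l @^-1` B].

(** The sample space with only the events determined by [X], so that measurability
on it expresses being a function of the sequence [X]. *)
Definition observed : measurableType _ := g_sigma_algebraType observable_events.

Lemma sigma_sequence_measurable E : sigma_sequence (fun l => X l) E -> measurable E.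
Proof.
apply: (@smallest_sub _ _ _ _ _) => [|_ [l [B [mB ->]]]].
  exact: sigma_algebra_measurable.
by rewrite -[_ @^-1` _]setTI; apply: measurable_funP.
Qed.

Lemma measurable_observed : measurable_fun [set: Omega] (id : Omega -> observed).
Proof.
move=> _ E mE; rewrite setTI preimage_id; exact: sigma_sequence_measurable mE.
Qed.

Lemma measurable_observe l : measurable_fun [set: observed] (X l : observed -> R).
Proof.
move=> _ B mB; rewrite setTI; apply: sub_sigma_algebra; by exists l, B.
Qed.

Let observe : {RV Pr >-> observed} := mfun_Sub (mem_set measurable_observed).

(** The law of the pair (S, X) is a product, hence Tonelli's theorem gives the
integral by freezing the value of [S]. *)
Lemma independent_integral d' (T : measurableType d') (S : {RV Pr >-> T})
    (h : T * observed -> \bar R) :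
  independent_of Pr S (fun l => X l) ->
  measurable_fun setT h -> (forall z, 0 <= h z) ->
  \int[Pr]_w h (S w, w) = \int[distribution Pr S]_s \int[Pr]_w h (s, w).
Proof.
move=> SX mh h0.
have mJ : measurable_fun [set: Omega] (fun w => (S w, w : observed)).
  by apply/measurable_fun_pairP; split; [exact: measurable_funP|exact: measurable_observed].
pose J : {RV Pr >-> (T * observed)%type} := mfun_Sub (mem_set mJ).
have E : forall A, measurable A ->
    (distribution Pr S \x distribution Pr observe) A = distribution Pr J A.
  apply: product_measure_unique => A B mA mB.
  exact: (SX A B mA mB).
transitivity (\int[distribution Pr J]_z h z).
  by rewrite ge0_integral_distribution.
transitivity (\int[(distribution Pr S \x distribution Pr observe)]_z h z).
  by apply: eq_measure_integral => A mA _; exact: esym (E A mA).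
rewrite fubini_tonelli1 //; apply: eq_integral => s _.
rewrite /fubini_F ge0_integral_distribution //.
exact: measurableT_comp mh (pair1_measurable s).
Qed.
End independence.

Section mutual.
Context d (Omega : measurableType d) (R : realType) (Pr : probability Omega R).
Local Open Scope ereal_scope.

Definition cylinder (X : nat -> Omega -> R) (N : nat) (B : nat -> set R) : set Omega :=
  [set w | forall j, (j < N)%N -> B j (X j w)].

Lemma mutually_independent_cylinder (X : nat -> Omega -> R) N (B : nat -> set R) :
  mutually_independent Pr X -> (forall j, measurable (B j)) ->
  Pr (cylinder X N B) = \prod_(0 <= j < N) Pr (X j @^-1` B j).
Proof.
move=> XI mB; pose J := [fset j in iota 0 N]%fset.
have JE j : (j \in J) = (j < N)%N by rewrite !inE mem_iota.
have -> : cylinder X N B = \bigcap_(j in [set` J]) X j @^-1` B j.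
  by apply/seteqP; split => w /= H j; [rewrite /= JE|move=> jN; apply: H; rewrite /= JE]; [exact: H|].
rewrite XI //; apply: perm_big; apply: uniq_perm; rewrite ?fset_uniq ?iota_uniq // => j.
by rewrite JE mem_index_iota.
Qed.

Lemma mutually_independent_shift (X : nat -> Omega -> R) :
  mutually_independent Pr X -> mutually_independent Pr (fun j => X j.+1).
Proof.
move=> XI J B mB; pose J' := [fset j.+1 | j in J]%fset.
have := XI J' (fun j => B j.-1) (fun j => mB _).
rewrite big_imfset /=; last by move=> i j _ _ [].
move=> <-; congr (Pr _); apply/seteqP; split => w /= H j /=.
  by case/imfsetP => i /= iJ ->; exact: H.
by move=> jJ; apply: (H j.+1); apply/imfsetP; exists j.
Qed.

(** Finite cylinders over the coordinates [1, 2, ...] form a pi-system that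
generates the tail, and two finite measures of equal mass that agree on it are
equal. *)
Lemma mutually_independent_tail (X : nat -> {RV Pr >-> R}) :
  mutually_independent Pr (fun j => X j) ->
  independent_of Pr (X 0%N) (fun j => X j.+1).
Proof.
move=> XI A E mA sE.
pose Y : nat -> Omega -> R := fun j => X j.+1.
pose G : set (set Omega) := [set C | exists N (B : nat -> set R),
   (forall j, measurable (B j)) /\ C = cylinder Y N B].
have mY l B : measurable B -> measurable (Y l @^-1` B).
  by move=> mB; rewrite -[_ @^-1` _]setTI; apply: measurable_funP.
have mX0 : measurable (X 0%N @^-1` A) by rewrite -[_ @^-1` _]setTI; apply: measurable_funP.
have GE C : G C -> measurable C.
  case=> N [B [mB ->]].
  have -> : cylinder Y N B = \bigcap_(j in [set j | (j < N)%N]) (Y j @^-1` B j) by [].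
  by apply: bigcap_measurableType => j _; exact: mY.
have sGE : <<s G >> E.
  apply: sub_sigma_algebra2 sE => _ [l [B [mB ->]]].
  exists l.+1, (fun j => if j == l then B else setT); split => [j|].
    by case: ifP.
  apply/seteqP; split => w /= H.
    by move=> j jl; case: eqP => [->|].
  by have := H l (ltnSn l); rewrite eqxx.
(* Cylinders of different lengths are intersected at the larger length, the missing
   constraints being [setT]. *)
have GI : setI_closed G.
  move=> _ _ [N1 [B1 [mB1 ->]]] [N2 [B2 [mB2 ->]]].
  exists (maxn N1 N2), (fun j => (if (j < N1)%N then B1 j else setT) `&` (if (j < N2)%N then B2 j else setT)).
  split => [j|]; first by apply: measurableI; case: ifP.
  apply/seteqP; split => w /=.
    by move=> [H1 H2] j _; split; case: ifPn => // jN; [exact: H1|exact: H2].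
  move=> H; split => j jN.
    have [] := H j (leq_trans jN (leq_maxl _ _)); by rewrite jN.
  have [] := H j (leq_trans jN (leq_maxr _ _)); by rewrite jN.
have fA : Pr (X 0%N @^-1` A) \is a fin_num by exact: fin_num_measure.
have c0 : (0 <= fine (Pr (X 0%N @^-1` A)))%R by exact: fine_ge0.
pose m1 := mrestr Pr mX0.
pose m2 := mscale (NngNum c0) Pr.
have m2E C : m2 C = Pr (X 0%N @^-1` A) * Pr C.
  by rewrite /m2 /mscale; congr (_ * _); exact: fineK.
suff : m1 E = m2 E.
  by move=> H; rewrite setIC; apply: etrans H _; exact: m2E.
apply: (@g_sigma_algebra_measure_unique _ _ _ G GE (fun _ => setT)) => //.
- by move=> _; exists 0%N, (fun _ => setT); split => //; apply/seteqP; split.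
- by rewrite bigcup_const.
- move=> _ [N [B [mB ->]]]; apply: etrans _ (esym (m2E _)).
  pose B' j := if j is j'.+1 then B j' else A.
  have mB' j : measurable (B' j) by case: j => [|j] /=.
  have cE : cylinder Y N B `&` X 0%N @^-1` A = cylinder (fun j => X j) N.+1 B'.
    apply/seteqP; split => w /=.
      by move=> [H1 H2] [|j] //= jN; exact: H1.
    by move=> H; split => [j jN|]; [exact: (H j.+1)|exact: (H 0%N)].
  rewrite -[LHS]/(Pr (cylinder Y N B `&` X 0%N @^-1` A)) cE.
  rewrite (mutually_independent_cylinder _ XI mB') big_nat_recl //=; congr (_ * _).
  rewrite (mutually_independent_cylinder _ _ mB) //.
  exact: (@mutually_independent_shift (fun j => X j)).
- move=> _; rewrite -[ltLHS]/(Pr (setT `&` X 0%N @^-1` A)).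
  by rewrite -ge0_fin_numE // setTI.
Qed.
End mutual.

(** * Integer moments of the beta law *)

Section density.
Context d d' (T : measurableType d) (U : measurableType d') (R : realType).
Variables (mu : {measure set T -> \bar R}) (nu : {measure set U -> \bar R}).
Variables (phi : T -> U) (D : set T) (g : T -> R).
Hypotheses (mphi : measurable_fun setT phi) (mD : measurable D).
Hypotheses (mg : measurable_fun D g) (g0 : forall x, D x -> 0 <= g x).
Hypothesis nuE : forall A, measurable A ->
  nu A = (\int[mu]_(x in phi @^-1` A `&` D) (g x)%:E)%E.
Local Open Scope ereal_scope.

Import HBNNSimple.

Let density_nnsfun (h : {nnsfun U >-> R}) :
  \int[nu]_x (h x)%:E = \int[mu]_(x in D) ((h (phi x))%:E * (g x)%:E).
Proof.
have mh r : measurable (h @^-1` [set r]) by [].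
have mhphi r : measurable (phi @^-1` (h @^-1` [set r])).
  by rewrite -[_ @^-1` _]setTI; exact: mphi.
under eq_integral do rewrite fimfunE -fsumEFin//.
rewrite ge0_integral_fsum//; last 2 first.
- by move=> y; exact/measurable_EFinP/measurable_funM.
- by move=> y x _; rewrite nnfun_muleindic_ge0.
have hg0 y x : D x -> 0 <= (y * \1_(h @^-1` [set y]) (phi x))%:E * (g x)%:E.
  by move=> Dx; apply: mule_ge0; [rewrite EFinM nnfun_muleindic_ge0|rewrite lee_fin g0].
transitivity (\sum_(y \in range h)
    \int[mu]_(x in D) ((y * \1_(h @^-1` [set y]) (phi x))%:E * (g x)%:E)).
  apply: eq_fsbigr => y /[!inE] -[t _ <-].
  rewrite integralZl_indic_nnsfun // integral_indic // setIT.
  rewrite nuE // setIC integral_mkcondr.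
  rewrite -ge0_integralZl_EFin //.
  - apply: eq_integral => x _; rewrite patchE EFinM -muleA; congr (_ * _).
    rewrite indicE (_ : (phi x \in _) = (x \in phi @^-1` (h @^-1` [set h t]))) //.
    by case: ifP => _; rewrite ?mul1e ?mul0e.
  - by move=> x Dx; rewrite patchE; case: ifP => // _; rewrite lee_fin; exact: g0.
  - apply/(measurable_restrict (EFin \o g) _ mD) => //.
    by apply/measurable_EFinP; apply: measurable_funS mg => //; exact: subIsetl.
rewrite -ge0_integral_fsum //; last first.
  move=> y; apply: emeasurable_funM; last exact/measurable_EFinP.
  apply: measurable_funTS; apply/measurable_EFinP/measurable_funM => //.
  exact: measurableT_comp.
apply: eq_integral => x /[!inE] Dx.
rewrite fimfunE -fsumEFin // ge0_mule_fsuml //.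
by move=> y; rewrite nnfun_muleindic_ge0.
Qed.

(** The density formula for integrals, reduced to indicators through simple functions
and monotone convergence. *)
Lemma ge0_integral_density (f : U -> \bar R) :
  measurable_fun setT f -> (forall x, 0 <= f x) ->
  \int[nu]_x f x = \int[mu]_(x in D) (f (phi x) * (g x)%:E).
Proof.
move=> mf f0.
pose h := nnsfun_approx measurableT mf.
have hf x : EFin \o h ^~ x @ \oo --> f x by apply: cvg_nnsfun_approx.
have ndh x : nondecreasing_seq (h ^~ x) by move=> m n mn; exact/lefP/nd_nnsfun_approx.
transitivity (limn (fun n => \int[nu]_x (h n x)%:E)).
  rewrite -monotone_convergence//.
  - by apply: eq_integral => x _; apply/esym/cvg_lim => //; exact: hf.
  - by move=> n; exact/measurable_EFinP/measurable_funP.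
  - by move=> n y _; rewrite lee_fin.
  - by move=> y _ m n mn; rewrite lee_fin; exact: ndh.
under eq_fun do rewrite density_nnsfun.
rewrite -monotone_convergence//.
- apply: eq_integral => x /[!inE] Dx; apply/cvg_lim => //.
  by apply: cvgeZr => //; exact: hf.
- move=> n; apply: emeasurable_funM; last exact/measurable_EFinP.
  apply: measurable_funTS; apply/measurable_EFinP; apply: measurableT_comp mphi.
  exact: measurable_funP.
- by move=> n y Dy; rewrite mule_ge0 ?lee_fin ?g0.
- by move=> y Dy m n mn; apply: lee_wpmul2r; rewrite lee_fin; [exact: g0|exact: ndh].
Qed.
End density.

Section beta_parts.
Context (R : realType).
Notation mu := lebesgue_measure.

Definition powR_beta (p q x : R) : R := x `^ p * (1 - x) `^ q.

Lemma powR_beta_ge0 p q x : 0 <= powR_beta p q x.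
Proof. by rewrite mulr_ge0 ?powR_ge0. Qed.

Lemma measurable_powR_beta p q D : measurable_fun D (powR_beta p q).
Proof.
apply: measurable_funTS; apply: measurable_funM; first exact: measurable_powR.
apply: (measurableT_comp (measurable_powR q)) => //.
exact: measurable_funB.
Qed.

Lemma is_derive_powR_onem (q x : R) : x < 1 ->
  is_derive x 1 (fun y => (1 - y) `^ q) (- (q * (1 - x) `^ (q - 1))).
Proof.
move=> x1; have x1' : 0 < 1 - x by rewrite subr_gt0.
have h := is_derive1_powR q x1'.
apply: is_derive_eq.
  apply: (@is_derive1_comp _ (fun z => z `^ q) (fun y => 1 - y)).
by rewrite /=; ring.
Qed.

Lemma is_derive_powR_beta (p q x : R) : 0 < x < 1 ->
  is_derive x 1 (powR_beta p q)
    (p * powR_beta (p - 1) q x - q * powR_beta p (q - 1) x).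
Proof.
move=> /andP[x0 x1].
have h1 := is_derive1_powR p x0; have h2 := is_derive_powR_onem q x1.
apply: is_derive_eq; rewrite /powR_beta /GRing.scale /=; ring.
Qed.

Lemma continuous_powR_beta p q x : 0 < x < 1 -> {for x, continuous (powR_beta p q)}.
Proof.
move=> x01; apply: differentiable_continuous; apply/derivable1_diffP.
by have [] := is_derive_powR_beta p q x01.
Qed.

(* Starting at 1/3 keeps [e n] below [1 - e n]. *)
Let e (n : nat) : R := n.+3%:R^-1.
Let I (n : nat) : set R := `[e n, 1 - e n].

Let e01 n : 0 < e n < 2^-1.
Proof.
rewrite /e invr_gt0 ltr0n /= ltf_pV2 ?posrE // ?ltr0n // ltr_nat //.
Qed.

Let I01 n x : I n x -> 0 < x < 1.
Proof.
rewrite /I /= in_itv /= => /andP[ex xe]; have /andP[e0 _] := e01 n.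
by rewrite (lt_le_trans e0 ex) (le_lt_trans xe) // ltrBlDr ltrDl.
Qed.

(** On a compact subinterval the primitive is smooth even when it has unbounded
derivatives at 0 or 1. *)
Lemma powR_beta_FTC p q n :
  (\int[mu]_(x in I n) (p * powR_beta (p - 1) q x)%:E
   - \int[mu]_(x in I n) (q * powR_beta p (q - 1) x)%:E
   = (powR_beta p q (1 - e n))%:E - (powR_beta p q (e n))%:E)%E.
Proof.
have /andP[e0 e2] := e01 n.
have le : e n < 1 - e n by move: e0 e2; lra.
have cM c p' q' : {within I n, continuous (fun x => c * powR_beta p' q' x)}.
  apply: continuous_in_subspaceT => x; rewrite inE => /I01 x01.
  by apply: cvgM; [exact: cvg_cst|exact: continuous_powR_beta].
have int c p' q' : mu.-integrable (I n) (EFin \o (fun x => c * powR_beta p' q' x)).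
  by apply: continuous_compact_integrable; [exact: segment_compact|exact: cM].
rewrite -integralB_EFin //; last exact: measurable_itv.
rewrite -(@continuous_FTC2 _ (fun x => p * powR_beta (p - 1) q x - q * powR_beta p (q - 1) x)) //.
- apply: continuous_in_subspaceT => x; rewrite inE => /I01 x01.
  by apply: cvgB; (apply: cvgM; [exact: cvg_cst|exact: continuous_powR_beta]).
- have ein : 0 < e n < 1 by move: e0 e2; lra.
  have ein' : 0 < 1 - e n < 1 by move: e0 e2; lra.
  split.
  + move=> x; rewrite in_itv /= => /andP[x1 x2].
    have x01 : 0 < x < 1 by move: e0 e2 x1 x2; lra.
    by have [] := is_derive_powR_beta p q x01.
  + by apply: cvg_at_right_filter; exact: continuous_powR_beta.
  + by apply: cvg_at_left_filter; exact: continuous_powR_beta.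
- move=> x; rewrite in_itv /= => /andP[x1 x2].
  have x01 : 0 < x < 1 by move: e0 e2 x1 x2; lra.
  by rewrite derive1E; have [_ ->] := is_derive_powR_beta p q x01.
Qed.

Let bigcup_I : \bigcup_n I n = `]0, 1[%classic.
Proof.
apply/seteqP; split => [x [n _ /I01]|x]; rewrite /= in_itv //=.
move=> /andP[x0 x1].
have [n hn] : exists n, e n <= Num.min x (1 - x).
  have m0 : 0 < Num.min x (1 - x) by rewrite lt_min x0 subr_gt0.
  exists (Num.bound (Num.min x (1 - x))^-1).
  rewrite /e -[leRHS]invrK lef_pV2 ?posrE ?invr_gt0 ?ltr0n //.
  have := archi_boundP (ltW (_ : 0 < (Num.min x (1 - x))^-1)); rewrite invr_gt0 => /(_ m0).
  by move/ltW/le_trans; apply; rewrite ler_nat; lia.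
exists n => //; rewrite /I /= in_itv /=; move: hn; rewrite le_min => /andP[-> /=]; lra.
Qed.

Let cvg_int (c p q : R) : 0 <= c ->
  (\int[mu]_(x in I n) (c * powR_beta p q x)%:E @[n --> \oo] -->
   \int[mu]_(x in `]0%R, 1%R[) (c * powR_beta p q x)%:E)%E.
Proof.
move=> c0; rewrite -bigcup_I; apply: ge0_nondecreasing_set_cvg_integral.
- move=> m n mn; apply/subsetPset => x; rewrite /I /= !in_itv /= => /andP[x1 x2].
  have : e n <= e m by rewrite lef_pV2 ?posrE ?ltr0n // ler_nat.
  by move: x1 x2 => /=; lra.
- by move=> n; exact: measurable_itv.
- move=> n; apply/measurable_EFinP; apply: measurable_funM => //.
  exact: measurable_powR_beta.
- by move=> n x _; rewrite lee_fin mulr_ge0 ?powR_beta_ge0.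
Qed.

Let e_cvg : e n @[n --> \oo] --> (0 : R).
Proof.
have := @cvg_harmonic R; rewrite -cvg_shiftS -cvg_shiftS; exact.
Qed.

Let e_cvg0 p : 0 < p -> (e n) `^ p @[n --> \oo] --> (0 : R).
Proof.
move=> p0; have /cvg_at_rightP := powR_cvg0 (R := R) p0; apply; split; last exact: e_cvg.
by move=> n; have /andP[] := e01 n.
Qed.

Let powR_le1 (x q : R) : 0 < x < 1 -> 0 < q -> x `^ q <= 1.
Proof.
move=> /andP[x0 x1] q0; rewrite [leRHS](_ : 1 = 1 `^ q); last by rewrite powR1.
by apply: ge0_ler_powR => //; rewrite ?nnegrE //; exact: ltW.
Qed.

Let bdry_cvg p q : 0 < p -> 0 < q ->
  (powR_beta p q (1 - e n) - powR_beta p q (e n)) @[n --> \oo] --> (0 : R).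
Proof.
move=> p0 q0; rewrite -[0](subr0 0); apply: cvgB.
- apply: (@squeeze_cvgr _ _ _ _ (fun=> 0) (fun n => (e n) `^ q)); [|exact: cvg_cst|exact: e_cvg0].
  apply: nearW => n; rewrite powR_beta_ge0 /= /powR_beta.
  have -> : 1 - (1 - e n) = e n by ring.
  rewrite ler_piMl ?powR_ge0 // powR_le1 //.
  by have /andP[] := e01 n; move=> /=; lra.
- apply: (@squeeze_cvgr _ _ _ _ (fun=> 0) (fun n => (e n) `^ p)); [|exact: cvg_cst|exact: e_cvg0].
  apply: nearW => n; rewrite powR_beta_ge0 /= /powR_beta.
  rewrite ler_piMr ?powR_ge0 // powR_le1 //.
  by have /andP[] := e01 n; move=> /=; lra.
Qed.

(** The boundary terms tend to 0 as the compact subintervals fill [0, 1]. *)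
Lemma powR_beta_parts p q : 0 < p -> 0 < q ->
  (\int[mu]_(x in `]0%R, 1%R[) (powR_beta (p - 1) q x)%:E < +oo)%E ->
  (\int[mu]_(x in `]0%R, 1%R[) (powR_beta p (q - 1) x)%:E < +oo)%E ->
  (p%:E * \int[mu]_(x in `]0%R, 1%R[) (powR_beta (p - 1) q x)%:E
   = q%:E * \int[mu]_(x in `]0%R, 1%R[) (powR_beta p (q - 1) x)%:E)%E.
Proof.
move=> p0 q0 fu fv.
have mi p' q' D : measurable_fun D (fun x => (powR_beta p' q' x)%:E).
  by apply/measurable_EFinP; exact: measurable_powR_beta.
have pos p' q' : (0 <= \int[mu]_(x in `]0%R, 1%R[) (powR_beta p' q' x)%:E)%E.
  by apply: integral_ge0 => x _; rewrite lee_fin powR_beta_ge0.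
have Z c p' q' : 0 < c -> (\int[mu]_(x in `]0%R, 1%R[) (c * powR_beta p' q' x)%:E
    = c%:E * \int[mu]_(x in `]0%R, 1%R[) (powR_beta p' q' x)%:E)%E.
  move=> c0; under eq_integral do rewrite EFinM.
  rewrite ge0_integralZl_EFin //; [|exact: mi|exact: ltW].
  by move=> x _; rewrite lee_fin powR_beta_ge0.
rewrite -!Z //.
have cu := @cvg_int p (p - 1) q (ltW p0).
have cv := @cvg_int q p (q - 1) (ltW q0).
have Fu : (\int[mu]_(x in `]0%R, 1%R[) (p * powR_beta (p - 1) q x)%:E \is a fin_num)%E.
  by rewrite Z // fin_numM // ge0_fin_numE.
have Fv : (\int[mu]_(x in `]0%R, 1%R[) (q * powR_beta p (q - 1) x)%:E \is a fin_num)%E.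
  by rewrite Z // fin_numM // ge0_fin_numE.
have ad : (\int[mu]_(x in `]0%R, 1%R[) (p * powR_beta (p - 1) q x)%:E +?
   - \int[mu]_(x in `]0%R, 1%R[) (q * powR_beta p (q - 1) x)%:E)%E.
  by rewrite fin_num_adde_defr // fin_numN.
have c0 : ((\int[mu]_(x in I n) (p * powR_beta (p - 1) q x)%:E -
    \int[mu]_(x in I n) (q * powR_beta p (q - 1) x)%:E) @[n --> \oo] --> 0%:E)%E.
  under eq_fun do rewrite powR_beta_FTC -EFinB.
  by apply: cvg_EFin; [exact: nearW|exact: bdry_cvg].
have E : (\int[mu]_(x in `]0%R, 1%R[) (p * powR_beta (p - 1) q x)%:E -
    \int[mu]_(x in `]0%R, 1%R[) (q * powR_beta p (q - 1) x)%:E = 0%:E)%E.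
  rewrite -(cvg_lim (@ereal_hausdorff R) c0).
  by apply/esym/(cvg_lim (@ereal_hausdorff R)); exact: cvgeB.
move: E; rewrite -(fineK Fu) -(fineK Fv) -EFinB => E'; have E0 := EFin_inj E'.
by congr (_%:E); apply/eqP; rewrite -subr_eq0 E0.
Qed.
End beta_parts.

Section beta_moments.
Context d (Omega : measurableType d) (R : realType) (Pr : probability Omega R).
Variables (W : {RV Pr >-> R}) (a b : R).
Hypotheses (a0 : 0 < a) (b0 : 0 < b) (WB : beta_distributed Pr W a b).
Hypothesis W01 : forall w, 0 <= W w <= 1.
Notation mu := lebesgue_measure.

Let B := real_beta a b.

Let kernelE x : beta_kernel a b x = powR_beta (a - 1) (b - 1) x.
Proof. by []. Qed.

Let B_ge0 : 0 <= B.
Proof. by apply: Rintegral_ge0 => x _; rewrite kernelE powR_beta_ge0. Qed.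

Let moment r s : \bar R := (\int[Pr]_w (W w ^+ r * (1 - W w) ^+ s)%:E)%E.

Let integrand_ge0 r s w : 0 <= W w ^+ r * (1 - W w) ^+ s.
Proof.
by have /andP[w0 w1] := W01 w; rewrite mulr_ge0 ?exprn_ge0 // subr_ge0.
Qed.

Let momentE r s : moment r s =
  (B^-1%:E * \int[mu]_(x in `]0%R, 1%R[) (powR_beta (a + r%:R - 1) (b + s%:R - 1) x)%:E)%E.
Proof.
pose f (x : R) : \bar R := (`|x ^+ r * (1 - x) ^+ s|)%:E.
have mf : measurable_fun [set: R] f.
  apply/measurable_EFinP; apply: measurableT_comp => //.
  by apply: measurable_funM; apply: measurable_funX => //; exact: measurable_funB.
have f0 x : (0 <= f x)%E by rewrite lee_fin.
have -> : moment r s = (\int[distribution Pr W]_x f x)%E.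
  rewrite ge0_integral_distribution //; apply: eq_integral => w _.
  by rewrite /f /= ger0_norm.
have mk : measurable_fun (`]0%R, 1%R[%classic : set R) (fun x => beta_kernel a b x / B).
  by apply: measurable_funM => //; exact: measurable_powR_beta.
rewrite (@ge0_integral_density _ _ _ _ R (@lebesgue_measure R) (distribution Pr W)
  id _ _ _ _ mk) //; last first.
- by move=> x _; rewrite divr_ge0 // kernelE powR_beta_ge0.
rewrite -ge0_integralZl_EFin ?invr_ge0 //; last 2 first.
- by move=> x _; rewrite lee_fin powR_beta_ge0.
- by apply/measurable_EFinP; exact: measurable_powR_beta.
apply: eq_integral => x; rewrite inE /= in_itv /= => /andP[x0 x1].
have x1' : 0 < 1 - x by rewrite subr_gt0.
rewrite /f ger0_norm; last by rewrite mulr_ge0 ?exprn_ge0 // ltW.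
rewrite -!EFinM; congr (_%:E); rewrite /beta_kernel /powR_beta.
rewrite !(addrAC _ (_%:R)) !powRD ?(gt_eqF x0) ?(gt_eqF x1') ?implybT //.
rewrite !powR_mulrn ?ltW //; ring.
Qed.

Let measurable_moment r s :
  measurable_fun [set: Omega] (fun w => (W w ^+ r * (1 - W w) ^+ s)%:E).
Proof.
apply/measurable_EFinP; apply: measurable_funM; apply: measurable_funX => //.
exact: measurable_funB.
Qed.

Let moment00 : moment 0 0 = 1%E.
Proof.
rewrite /moment; under eq_integral do rewrite !expr0 mulr1.
by rewrite (@integral_cst _ _ _ _ _ _ 1%E) // mul1e; exact: probability_setT.
Qed.

Let moment_fin r s : moment r s \is a fin_num.
Proof.
rewrite ge0_fin_numE; last by apply: integral_ge0 => w _; rewrite lee_fin.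
apply: le_lt_trans (_ : moment 0 0 < +oo)%E; last by rewrite moment00 ltry.
apply: ge0_le_integral => // w _; rewrite lee_fin // !expr0 mulr1.
have /andP[w0 w1] := W01 w.
by rewrite mulr_ile1 ?exprn_ge0 ?exprn_ile1 ?subr_ge0 // lerBlDr lerDl.
Qed.

Let B_gt0 : 0 < B.
Proof.
rewrite lt_neqAle B_ge0 andbT; apply/eqP => B0.
have := moment00; rewrite momentE -B0 invr0 mul0e => /eqP.
by rewrite eq_sym onee_eq0.
Qed.

Let int_fin r s :
  (\int[mu]_(x in `]0%R, 1%R[) (powR_beta (a + r%:R - 1) (b + s%:R - 1) x)%:E < +oo)%E.
Proof.
have := moment_fin r s; rewrite momentE.
set J := (\int[mu]_(x in _) _)%E.
have : (0 <= J)%E by apply: integral_ge0 => x _; rewrite lee_fin powR_beta_ge0.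
case: J => [x| |] //; rewrite ?ltry // => _.
by rewrite mulry gtr0_sg ?invr_gt0 // mul1e.
Qed.

Let moment_parts r s : (a + r%:R) * fine (moment r s.+1) = (b + s%:R) * fine (moment r.+1 s).
Proof.
have ar : 0 < a + r%:R by rewrite ltr_wpDr.
have bs : 0 < b + s%:R by rewrite ltr_wpDr.
have := powR_beta_parts ar bs.
have := int_fin r s.+1; have := int_fin r.+1 s.
rewrite -!natr1 !addrA !addrK => f1 f2 /(_ f2 f1) E.
rewrite !momentE -!natr1 !addrA !addrK.
set u := (\int[mu]_(x in _) _)%E in f1 f2 E *.
set v := (\int[mu]_(x in _) _)%E in f1 E *.
have u0 : (0 <= u)%E by apply: integral_ge0 => x _; rewrite lee_fin powR_beta_ge0.
have v0 : (0 <= v)%E by apply: integral_ge0 => x _; rewrite lee_fin powR_beta_ge0.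
have fu : u \is a fin_num by rewrite ge0_fin_numE.
have fv : v \is a fin_num by rewrite ge0_fin_numE.
move: E; rewrite -(fineK fu) -(fineK fv) -!EFinM => E'; have E := EFin_inj E'.
by rewrite /= mulrCA E; ring.
Qed.

Let moment_split r s : fine (moment r s) = fine (moment r.+1 s) + fine (moment r s.+1).
Proof.
rewrite -fineD //; congr fine; rewrite /moment -ge0_integralD //.
- apply: eq_integral => w _; rewrite -EFinD; congr (_%:E).
  by rewrite !exprS; ring.
- by move=> w _; rewrite lee_fin.
- by move=> w _; rewrite lee_fin.
Qed.

(** Integration by parts gives [(a + r) E (W^r (1 - W)^(s + 1)) =
(b + s) E (W^(r + 1) (1 - W)^s)], and the two expectations add up to
[E (W^r (1 - W)^s)]; this determines all of them from the total mass 1, so the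
normalising constant is never computed. *)
Lemma beta_moments r s :
  (\int[Pr]_w (W w ^+ r * (1 - W w) ^+ s)%:E)%E = (beta_moment a b r s)%:E.
Proof.
rewrite -[LHS]/(moment r s) -(fineK (moment_fin r s)); congr (_%:E).
have ab n : a + b + n%:R != 0 by rewrite gt_eqF // ltr_wpDr // addr_gt0.
have rab n : rising (a + b) n != 0 by rewrite gt_eqF // rising_gt0 // addr_gt0.
elim: s => [|s IH].
  elim: r => [|r IH]; first by rewrite moment00 /beta_moment !rising0 divr1 mulr1.
  have P := moment_parts r 0; have S := moment_split r 0.
  have E : (a + b + r%:R) * fine (moment r.+1 0) = (a + r%:R) * fine (moment r 0).
    by rewrite S [RHS]mulrDr P; ring.
  apply: (mulfI (ab r)); rewrite E IH /beta_moment !addn0 !rising0 !risingS.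
  by field; rewrite rab ab.
have P := moment_parts r s; have S := moment_split r s.
have E : (a + b + (r + s)%:R) * fine (moment r s.+1) = (b + s%:R) * fine (moment r s).
  by rewrite S [RHS]mulrDr -P natrD; ring.
apply: (mulfI (ab (r + s)%N)); rewrite E IH /beta_moment addnS !risingS.
by field; rewrite rab -natrD ab.
Qed.
End beta_moments.

(** * Stick breaking *)

Section products.
Variable R : realType.

(** With [C = c / (t + al)] the factors are at most [1 - C / (i + 1)], so by induction
the product is at most the inverse of [1 + C * (1 + 1/2 + ... + 1/N)], which tends
to 0 by divergence of the harmonic series. *)
Lemma prod_cvg0 (c t al : R) : 0 < c -> c <= t -> 0 <= al ->
  \prod_(i < N) (1 - c / (t + i%:R * al)) @[N --> \oo] --> (0 : R).
Proof.
move=> c0 ct al0.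
have t0 : 0 < t by exact: lt_le_trans ct.
pose x (i : nat) := c / (t + i%:R * al).
have ti i : 0 < t + i%:R * al by rewrite ltr_wpDr // mulr_ge0.
have x0 i : 0 <= x i by rewrite divr_ge0 // ltW.
have x1 i : x i <= 1 by rewrite ler_pdivrMr // mul1r (le_trans ct) // lerDl mulr_ge0.
pose C := c / (t + al).
have C0 : 0 < C by rewrite divr_gt0 // ltr_wpDr.
have xC i : C * harmonic i <= x i.
  have tal : 0 < t + al by rewrite ltr_wpDr.
  rewrite /x /C /harmonic /= -mulrA -invfM ler_pM2l //.
  rewrite lef_pV2 ?posrE ?(ti i) ?(mulr_gt0 tal) ?ltr0n // -natr1.
  have := mulr_ge0 (ltW t0) (ler0n R i); nra.
have bnd N : \prod_(i < N) (1 - x i) <= (1 + C * series harmonic N)^-1.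
  have H N' : 0 <= series (@harmonic R) N' by apply: sumr_ge0 => i _; exact: harmonic_ge0.
  have pos N' : 0 < 1 + C * series harmonic N' by rewrite ltr_wpDr // mulr_ge0 ?H // ltW.
  rewrite -[leRHS]mul1r ler_pdivlMr //.
  elim: N => [|N IH]; first by rewrite big_ord0 /series /= big_geq // mulr0 addr0 mulr1.
  rewrite big_ord_recr /=; apply: le_trans IH; rewrite -mulrA ler_wpM2l //.
    by apply: prodr_ge0 => i _; rewrite subr_ge0.
  rewrite /series /= big_nat_recr //= (mulrDr C).
  set S := \sum_(0 <= i < N) _.
  have S0 : 0 <= C * S by rewrite mulr_ge0 ?(ltW C0) // sumr_ge0 // => i _; exact: harmonic_ge0.
  have h0 : 0 <= C * harmonic N by rewrite mulr_ge0 ?harmonic_ge0 // ltW.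
  have key (y s h : R) : 0 <= y -> 0 <= s -> 0 <= h -> h <= y -> (1 - y) * (1 + (s + h)) <= 1 + s.
    by move=> y0 s0 h0' hy; have := mulr_ge0 y0 s0; have := mulr_ge0 y0 h0'; nra.
  apply: (key (x N) (C * S) (C * harmonic N)) => //; exact: xC.
apply: (@squeeze_cvgr _ _ _ _ (fun=> 0) (fun N => (1 + C * series harmonic N)^-1)).
- apply: nearW => N; rewrite bnd andbT.
  by apply: prodr_ge0 => i _; rewrite subr_ge0; exact: x1.
- exact: cvg_cst.
- apply/gtr0_cvgV0.
    apply: nearW => N; rewrite ltr_wpDr // mulr_ge0 ?(ltW C0) // sumr_ge0 // => i _; exact: harmonic_ge0.
  have hoo : series (@harmonic R) @ \oo --> +oo.
    apply: nondecreasing_dvgn_lt; last exact: dvg_harmonic.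
    by apply/nondecreasing_seqP => n; rewrite /series /= big_nat_recr //= lerDl.
  apply/cvgryPge => M; move/cvgryPge : hoo => /(_ (M / C)).
  apply: filterS => N; rewrite ler_pdivrMr // mulrC => h.
  by rewrite (le_trans h) // lerDr.
Qed.
End products.

Section stick.
Variable R : realType.
Implicit Types (x : nat -> R).

Lemma stick_recl x j : stick_breaking x j.+1 = (1 - x 0%N) * stick_breaking (fun i => x i.+1) j.
Proof. by rewrite /stick_breaking big_ord_recl /=; ring. Qed.

Lemma sum_stick x N : \sum_(0 <= j < N) stick_breaking x j = 1 - \prod_(i < N) (1 - x i).
Proof.
elim: N => [|N IH]; first by rewrite big_geq // big_ord0 subrr.
by rewrite big_nat_recr //= IH big_ord_recr /= /stick_breaking; ring.
Qed.

Lemma stick_subprob x : (forall i, 0 <= x i <= 1) -> subprob (stick_breaking x).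
Proof.
move=> x01; split.
  move=> i; rewrite mulr_ge0 //; first by case/andP: (x01 i).
  by apply: prodr_ge0 => j _; rewrite subr_ge0; case/andP: (x01 j).
apply: lime_le.
  apply: is_cvg_nneseries => i _ _; rewrite lee_fin mulr_ge0 //; first by case/andP: (x01 i).
  by apply: prodr_ge0 => j _; rewrite subr_ge0; case/andP: (x01 j).
apply: nearW => N; rewrite sumEFin lee_fin sum_stick gerBl.
by apply: prodr_ge0 => j _; rewrite subr_ge0; case/andP: (x01 j).
Qed.

Lemma psum_stick x r : (forall i, 0 <= x i <= 1) -> (0 < r)%N ->
  psum (stick_breaking x) r
  = x 0%N ^+ r + (1 - x 0%N) ^+ r * psum (stick_breaking (fun i => x i.+1)) r.
Proof.
move=> x01 r0; apply: EFin_inj; rewrite EFinD EFinM.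
have s1 := stick_subprob x01.
have s2 : subprob (stick_breaking (fun i => x i.+1)) by apply: stick_subprob => i; exact: x01.
have x10 : 0 <= 1 - x 0%N by rewrite subr_ge0; case/andP: (x01 0%N).
rewrite -!psumE // -nneseriesZl; last first.
  by move=> i _; rewrite lee_fin exprn_ge0 // s2.1.
have ge j : (0 <= (stick_breaking x j ^+ r)%:E)%E by rewrite lee_fin exprn_ge0 // s1.1.
rewrite nneseries_recl // -(@nneseries_addn _ _ 1%N) //.
rewrite {1}/stick_breaking big_ord0 mulr1; congr (_ + _)%E.
by apply: eq_eseriesr => i _; rewrite addn1 stick_recl exprMn EFinM.
Qed.

Lemma dsum_stick x q : (forall i, 0 <= x i <= 1) -> all (ltn 0%N) q ->
  dsum (psum (stick_breaking x)) q
  = (1 - x 0%N) ^+ sumn q * dsum (psum (stick_breaking (fun i => x i.+1))) q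
  + \sum_(y <- picks q) x 0%N ^+ y.1 * (1 - x 0%N) ^+ sumn y.2
      * dsum (psum (stick_breaking (fun i => x i.+1))) y.2.
Proof.
move=> x01 q0; apply: (@dsum_shift _ (fun r => x 0%N ^+ r) (fun r => (1 - x 0%N) ^+ r)) => //.
- by move=> m n; rewrite exprD.
- by move=> m n; rewrite exprD.
- by move=> r r0; exact: psum_stick.
Qed.
End stick.

Section measurability.
Context d (T : measurableType d) (R : realType).

Lemma measurable_psum (a : T -> nat -> R) r :
  (forall j, measurable_fun setT (a ^~ j)) -> (forall w j, 0 <= a w j) ->
  measurable_fun setT (fun w => psum (a w) r).
Proof.
move=> ma a0; apply: measurableT_comp; first exact: fine_measurable.
apply: ge0_emeasurable_sum => [k w _ _|k _]; first by rewrite lee_fin exprn_ge0.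
by apply/measurable_EFinP; exact: measurable_funX.
Qed.

Lemma measurable_dsum (a : T -> nat -> R) q :
  (forall j, measurable_fun setT (a ^~ j)) -> (forall w j, 0 <= a w j) ->
  measurable_fun setT (fun w => dsum (psum (a w)) q).
Proof.
move=> ma a0; have [n] := ubnP (size q); elim: n q => // n IH [|r t] sz.
  exact: measurable_cst.
under eq_fun do rewrite dsum_cons.
apply: measurable_funB; first by apply: measurable_funM; [exact: measurable_psum|exact: IH].
rewrite (_ : (fun _ => _) = fun w => \sum_(t' <- bumps r t)
    (if t' \in bumps r t then dsum (psum (a w)) t' else 0)).
  apply: (@measurable_sum _ _ _ _ _ _ (fun t' w =>
    if t' \in bumps r t then dsum (psum (a w)) t' else 0)) => t'.
  have [ht'|_] := boolP (t' \in bumps r t); last exact: measurable_cst.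
  by apply: IH; rewrite (size_bumps ht').
by apply/funext => w; apply: eq_big_seq => t' ->.
Qed.

Lemma ge0_integral_sum_seq (mu : {measure set T -> \bar R}) (I : eqType) (s : seq I)
    (f : I -> T -> \bar R) :
  (forall i, i \in s -> measurable_fun setT (f i)) ->
  (forall i x, i \in s -> (0 <= f i x)%E) ->
  (\int[mu]_x (\sum_(i <- s) f i x) = \sum_(i <- s) \int[mu]_x f i x)%E.
Proof.
move=> mf f0; pose g i x := if i \in s then f i x else 0%E.
transitivity (\int[mu]_x (\sum_(i <- s) g i x))%E.
  by apply: eq_integral => x _; apply: eq_big_seq => i si; rewrite /g si.
rewrite ge0_integral_sum //.
- by apply: eq_big_seq => i si; apply: eq_integral => x _; rewrite /g si.
- move=> i; rewrite /g; have [si|_] := boolP (i \in s); first exact: mf.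
  exact: measurable_cst.
- by move=> i x _; rewrite /g; have [si|//] := boolP (i \in s); exact: f0.
Qed.

Lemma measurable_stick (W : nat -> T -> R) j :
  (forall i, measurable_fun setT (W i)) ->
  measurable_fun setT (fun w => stick_breaking (W ^~ w) j).
Proof.
move=> mW; apply: measurable_funM => //.
by apply: measurable_prod => i _; exact: measurable_funB.
Qed.
End measurability.

(** * Moments of the stick-breaking sequence *)

Section gem.
Context d (Omega : measurableType d) (R : realType) (Pr : probability Omega R).

Lemma independent_product (X : nat -> {RV Pr >-> R}) d' (T : measurableType d')
    (S : {RV Pr >-> T}) (f : T -> R) (g : observed X -> R) :
  independent_of Pr S (fun l => X l) ->
  measurable_fun setT f -> measurable_fun setT g ->
  (forall t, 0 <= f t) -> (forall w, 0 <= g w) ->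
  (\int[Pr]_w (f (S w) * g w)%:E
   = (\int[Pr]_w (f (S w))%:E) * \int[Pr]_w (g w)%:E)%E.
Proof.
move=> SX mf mg f0 g0.
have mg' : measurable_fun [set: Omega] g.
  exact: (measurableT_comp mg (@measurable_observed _ _ _ _ X)).
rewrite (@independent_integral _ _ _ _ X _ T S (fun z => (f z.1 * g z.2)%:E)) //; last 2 first.
- apply/measurable_EFinP; apply: measurable_funM.
    exact: measurableT_comp mf measurable_fst.
  exact: measurableT_comp mg measurable_snd.
- by move=> z; rewrite lee_fin mulr_ge0.
transitivity (\int[distribution Pr S]_s ((f s)%:E * \int[Pr]_w (g w)%:E))%E.
  apply: eq_integral => s _; rewrite -ge0_integralZl_EFin //.
  - by move=> w _; rewrite lee_fin.
  - exact/measurable_EFinP.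
rewrite ge0_integralZr //; last 3 first.
- exact/measurable_EFinP.
- by move=> s _; rewrite lee_fin.
- by apply: integral_ge0 => w _; rewrite lee_fin.
congr (_ * _)%E.
by rewrite ge0_integral_distribution //; exact/measurable_EFinP.
Qed.

Definition stick_dsum (W : nat -> Omega -> R) (q : seq nat) (w : Omega) : R :=
  dsum (psum (stick_breaking (W ^~ w))) q.

Variable alpha : R.
Hypotheses (a0 : 0 <= alpha) (a1 : alpha < 1).

Definition gem_factors (theta : R) (W : nat -> {RV Pr >-> R}) : Prop :=
  [/\ mutually_independent Pr (fun j => W j),
      (forall j, beta_distributed Pr (W j) (1 - alpha) (theta + alpha * j.+1%:R)) &
      (forall j w, 0 <= W j w <= 1)].

Lemma gem_factors_shift theta W : gem_factors theta W ->
  gem_factors (theta + alpha) (fun j => W j.+1).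
Proof.
move=> [WI WB W01]; split; last by move=> j; exact: W01.
- exact: (@mutually_independent_shift _ _ _ _ (fun j => W j)).
- move=> j; have := WB j.+1.
  by rewrite -[j.+2%:R]natr1 mulrDr mulr1 (addrC (alpha * _)) addrA.
Qed.

Lemma stick_dsum_ge0 theta W q w : gem_factors theta W -> all (ltn 0%N) q ->
  0 <= stick_dsum W q w.
Proof.
by move=> [_ _ W01] q0; rewrite dsum_ge0 //; apply: stick_subprob => j; exact: W01.
Qed.

Lemma stick_dsum_le1 theta W q w : gem_factors theta W -> all (ltn 0%N) q ->
  stick_dsum W q w <= 1.
Proof.
by move=> [_ _ W01] q0; rewrite dsum_le //; apply: stick_subprob => j; exact: W01.
Qed.

Lemma measurable_stick_dsum_observed theta W q : gem_factors theta W ->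
  measurable_fun [set: observed W] (stick_dsum W q : observed W -> R).
Proof.
move=> [_ _ W01].
apply: (@measurable_dsum _ (observed W) R (fun w => stick_breaking ((fun j => W j : observed W -> R) ^~ w))).
- by move=> j; apply: measurable_stick => i; exact: measurable_observe.
- by move=> w j; apply: (stick_subprob _).1 => i; exact: W01.
Qed.

Lemma measurable_stick_dsum theta W q : gem_factors theta W ->
  measurable_fun setT (stick_dsum W q).
Proof.
move=> GW; exact: (measurableT_comp (measurable_stick_dsum_observed q GW) (@measurable_observed _ _ _ _ W)).
Qed.

Definition gem_mean (W : nat -> {RV Pr >-> R}) q : R := fine (\int[Pr]_w (stick_dsum W q w)%:E)%E.

Lemma gem_meanE theta W q : gem_factors theta W -> all (ltn 0%N) q ->
  (\int[Pr]_w (stick_dsum W q w)%:E)%E = (gem_mean W q)%:E /\ 0 <= gem_mean W q <= 1.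
Proof.
move=> GW q0.
have ge : (0 <= \int[Pr]_w (stick_dsum W q w)%:E)%E.
  by apply: integral_ge0 => w _; rewrite lee_fin (stick_dsum_ge0 _ GW).
have le : (\int[Pr]_w (stick_dsum W q w)%:E <= 1)%E.
  apply: (@le_trans _ _ (\int[Pr]_w 1)%E).
    apply: ge0_le_integral => //.
    + by move=> w _; rewrite lee_fin (stick_dsum_ge0 _ GW).
    + by apply/measurable_EFinP; exact: measurable_stick_dsum GW.
    + by move=> w _; rewrite lee_fin (stick_dsum_le1 _ GW).
  by rewrite (@integral_cst _ _ _ _ _ _ 1%E) // mul1e; exact: probability_le1.
have fin : (\int[Pr]_w (stick_dsum W q w)%:E)%E \is a fin_num.
  by rewrite ge0_fin_numE // (le_lt_trans le) // ltry.
split; first by rewrite /gem_mean fineK.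
by rewrite -!lee_fin /gem_mean fineK // ge le.
Qed.

(** The first stick carries none or one of the distinct indices, and it is
independent of the later factors, which generate the sequence with parameter
[theta + alpha]. *)
Lemma gem_mean_rec theta W q : - alpha < theta -> gem_factors theta W -> all (ltn 0%N) q ->
  gem_mean W q =
  beta_moment (1 - alpha) (theta + alpha) 0 (sumn q) * gem_mean (fun j => W j.+1) q
  + \sum_(y <- picks q) beta_moment (1 - alpha) (theta + alpha) y.1 (sumn y.2)
      * gem_mean (fun j => W j.+1) y.2.
Proof.
move=> ht GW q0; have GW' := gem_factors_shift GW.
have [WI WB W01] := GW.
have b0 : 0 < 1 - alpha by rewrite subr_gt0.
have b1 : 0 < theta + alpha by move: ht; lra.
have WB0 : beta_distributed Pr (W 0%N) (1 - alpha) (theta + alpha).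
  by have := WB 0%N; rewrite mulr1.
have prod r s q' : all (ltn 0%N) q' ->
  (\int[Pr]_w (W 0%N w ^+ r * (1 - W 0%N w) ^+ s * stick_dsum (fun j => W j.+1) q' w)%:E
   = (beta_moment (1 - alpha) (theta + alpha) r s * gem_mean (fun j => W j.+1) q')%:E)%E.
  move=> q'0.
  have := @independent_product (fun j => W j.+1) _ R (W 0%N)
    (fun x => `|x ^+ r * (1 - x) ^+ s|) (stick_dsum (fun j => W j.+1) q')
    (mutually_independent_tail WI).
  have E w : `|W 0%N w ^+ r * (1 - W 0%N w) ^+ s| = W 0%N w ^+ r * (1 - W 0%N w) ^+ s.
    by have /andP[w0 w1] := W01 0%N w; rewrite ger0_norm // mulr_ge0 ?exprn_ge0 // subr_ge0.
  under eq_integral do rewrite E.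
  under [X in _ -> _ -> _ -> _ -> _ = (X * _)%E]eq_integral do rewrite E.
  move=> ->.
  - by rewrite (beta_moments b0 b1 WB0 (W01 0%N)) (gem_meanE GW' q'0).1 -EFinM.
  - apply: measurableT_comp => //.
    by apply: measurable_funM; apply: measurable_funX => //; exact: measurable_funB.
  - exact: measurable_stick_dsum_observed GW'.
  - by [].
  - by move=> w; exact: stick_dsum_ge0 GW' _.
apply: EFin_inj; rewrite -(gem_meanE GW q0).1 EFinD -sumEFin.
have SE w : stick_dsum W q w =
  W 0%N w ^+ 0 * (1 - W 0%N w) ^+ sumn q * stick_dsum (fun j => W j.+1) q w
  + \sum_(y <- picks q) W 0%N w ^+ y.1 * (1 - W 0%N w) ^+ sumn y.2
      * stick_dsum (fun j => W j.+1) y.2 w.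
  by rewrite /stick_dsum dsum_stick ?expr0 ?mul1r // => i; exact: W01.
under eq_integral do rewrite SE EFinD -sumEFin.
have ge r s q' w : all (ltn 0%N) q' ->
  (0 <= (W 0%N w ^+ r * (1 - W 0%N w) ^+ s * stick_dsum (fun j => W j.+1) q' w)%:E)%E.
  move=> q'0; rewrite lee_fin; have /andP[w0 w1] := W01 0%N w.
  by rewrite !mulr_ge0 ?exprn_ge0 ?subr_ge0 // (stick_dsum_ge0 _ GW').
have me r s q' : measurable_fun setT
  (fun w => (W 0%N w ^+ r * (1 - W 0%N w) ^+ s * stick_dsum (fun j => W j.+1) q' w)%:E).
  apply/measurable_EFinP; apply: measurable_funM; last exact: measurable_stick_dsum GW'.
  by apply: measurable_funM; apply: measurable_funX => //; exact: measurable_funB.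
rewrite ge0_integralD //.
- rewrite prod //; congr (_ + _)%E.
  rewrite ge0_integral_sum_seq.
  + by apply: eq_big_seq => y yq; rewrite prod //; have [] := picks_gt0 q0 yq.
  + by move=> y _; exact: me.
  + by move=> y w yq; apply: ge; have [] := picks_gt0 q0 yq.
- by move=> w _; exact: ge.
- move=> w _; rewrite big_seq; apply: sume_ge0 => y yq; apply: ge.
  by have [] := picks_gt0 q0 yq.
- by apply: emeasurable_sum => y; exact: me.
Qed.

(** The two sides obey the same recursion in [theta], so for each [q] their
difference at [theta] is a product of [N] factors [m] times the difference at
[theta + N * alpha].  The part of it that comes from the mean stays below the
product, since the mean is at most 1; the part that comes from the formula is
given by [pitman_moment_step].  Both vanish in the limit by [prod_cvg0]. *)
Lemma gem_mean_pitman theta W q : - alpha < theta -> gem_factors theta W ->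
  all (ltn 0%N) q -> gem_mean W q = pitman_moment alpha theta q.
Proof.
have [k] := ubnP (size q); elim: k q theta W => // k IH q theta W sz ht GW q0.
have [->|qN] := eqVneq q [::].
  have -> : gem_mean W [::] = 1.
    rewrite /gem_mean /stick_dsum /dsum /= (@integral_cst _ _ _ _ _ _ 1%E) // mul1e.
    by rewrite -[RHS]/(fine 1%E); congr fine; exact: probability_setT.
  by rewrite /pitman_moment /= big_ord0 big_nil rising0 divr1 mulr1.
pose th i := theta + i%:R * alpha.
have thS i : th i.+1 = th i + alpha by rewrite /th -natr1; ring.
pose Wn i := fun j => W (i + j)%N.
have hth i : - alpha < th i.
  by rewrite (lt_le_trans ht) // lerDl mulr_ge0.
have GWn i : gem_factors (th i) (Wn i).
  elim: i => [|i IHi].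
    by rewrite /th mul0r addr0.
  rewrite thS (_ : Wn i.+1 = fun j => Wn i j.+1); first exact: gem_factors_shift.
  by apply/funext => j; rewrite /Wn addSnnS.
pose m i := beta_moment (1 - alpha) (th i + alpha) 0 (sumn q).
pose De i := gem_mean (Wn i) q - pitman_moment alpha (th i) q.
have DeS i : De i = m i * De i.+1.
  rewrite /De (gem_mean_rec (hth i) (GWn i) q0) (pitman_moment_rec a0 a1 (hth i) q0 qN) -thS.
  rewrite (_ : (fun j => Wn i j.+1) = Wn i.+1); last first.
    by apply/funext => j; rewrite /Wn addSnnS.
  rewrite thS -/(m i) -thS.
  set s1 := \sum_(y <- _) _; set s2 := \sum_(y <- _) _.
  have -> : s1 = s2.
    apply: eq_big_seq => y yq; congr (_ * _).
    apply: IH => //; last by have [] := picks_gt0 q0 yq.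
    by move: sz; rewrite (size_picks yq) ltnS.
  by ring.
have m0 i : 0 <= m i.
  rewrite /m /beta_moment rising0 mul1r divr_ge0 // ltW // rising_gt0 //.
    by have := hth i; lra.
  by have := hth i; move: a1; lra.
have DeN N : De 0%N = \prod_(i < N) m i * De N.
  elim: N => [|N IHN]; first by rewrite big_ord0 mul1r.
  by rewrite big_ord_recr /= -mulrA -DeS.
have n0 : (0 < sumn q)%N.
  by have := sumn_ge_size q0; case: (q) qN => //= x t _; lia.
have mle i : m i <= 1 - (1 - alpha) / (theta + 1 + i%:R * alpha).
  have t1 : 0 < th i + 1 by have := hth i; move: a1; lra.
  have t2 : 0 < th i + alpha by have := hth i; lra.
  have -> : 1 - (1 - alpha) / (theta + 1 + i%:R * alpha) = (th i + alpha) / (th i + 1).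
    by rewrite /th; field; move: t1; rewrite /th addrAC => /gt_eqF ->.
  rewrite /m /beta_moment rising0 mul1r add0n.
  rewrite (_ : 1 - alpha + (th i + alpha) = th i + 1); last by ring.
  have d0 : 0 <= (th i + alpha) / (th i + 1) by rewrite divr_ge0 // ltW.
  have r0 : 0 < rising (th i + 1 + 1) (sumn q).-1 by rewrite rising_gt0 // addr_gt0.
  rewrite -(prednK n0) !risingSl invfM mulrACA -[leRHS]mulr1.
  apply: ler_wpM2l => //; rewrite ler_pdivrMr // mul1r.
  apply: ler_prod => j _; apply/andP; split.
    by rewrite addr_ge0 // addr_ge0 // ltW.
  by rewrite lerD2r lerD2r lerD2l ltW.
have F0 i : 0 <= pitman_moment alpha (th i) q by rewrite ltW // pitman_moment_gt0.
(* [P1] bounds the product of the [m i]; [P2] is that product times the ratio of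
   the values of [pitman_moment] at [th N] and at [theta]. *)
pose P1 N := \prod_(i < N) (1 - (1 - alpha) / (theta + 1 + i%:R * alpha)).
pose c := (sumn q)%:R - (size q)%:R * alpha.
have szn : (size q)%:R <= (sumn q)%:R :> R by rewrite ler_nat sumn_ge_size.
have c0 : 0 < c.
  rewrite /c subr_gt0; apply: lt_le_trans szn; rewrite gtr_pMr // ltr0n.
  by case: (q) qN.
pose P2 N := \prod_(i < N) (1 - c / (theta + (sumn q)%:R + i%:R * alpha)).
have bnd N : `|De 0%N| <= P1 N + pitman_moment alpha theta q * P2 N.
  have mP : \prod_(i < N) m i <= P1 N by apply: ler_prod => i _; rewrite m0 mle.
  have mF : \prod_(i < N) m i * pitman_moment alpha (th N) q
     = pitman_moment alpha theta q * P2 N.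
    rewrite /P2; elim: N {mP} => [|N IHN]; first by rewrite !big_ord0 mul1r mulr1 /th mul0r addr0.
    rewrite !big_ord_recr /= [RHS]mulrA -IHN -[LHS]mulrA -[RHS]mulrA; congr (_ * _).
    rewrite thS /m (pitman_moment_step a0 a1 (hth N) q0 qN); congr (_ * _).
    have d0 : theta + (sumn q)%:R + N%:R * alpha != 0.
      have n1 : 1 <= (sumn q)%:R :> R by rewrite ler1n.
      by rewrite gt_eqF //; have := hth N; rewrite /th; move: a1 n1; lra.
    by rewrite /th /c; field; move: d0; rewrite addrAC => ->.
  have [_ /andP[G0 G1]] := gem_meanE (GWn N) q0.
  have M0 : 0 <= \prod_(i < N) m i by apply: prodr_ge0.
  rewrite (DeN N) /De mulrBr (le_trans (ler_normB _ _)) //.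
  rewrite (ger0_norm (mulr_ge0 M0 G0)) (ger0_norm (mulr_ge0 M0 (F0 N))) mF lerD2r (le_trans _ mP) //.
  by rewrite ler_piMr.
have lim0 : (P1 N + pitman_moment alpha theta q * P2 N) @[N --> \oo] --> (0 : R).
  rewrite -[0](addr0 0) -[X in _ + X](mulr0 (pitman_moment alpha theta q)).
  apply: cvgD.
    by apply: prod_cvg0 => //; move: a1 ht; lra.
  apply: cvgM; first exact: cvg_cst.
  apply: prod_cvg0 => //; rewrite /c.
  have h : alpha <= (size q)%:R * alpha by rewrite ler_peMl // ler1n; case: (q) qN.
  by move: ht h; lra.
have : `|De 0%N| <= 0.
  rewrite -(cvg_lim (@Rhausdorff R) lim0).
  by apply: limr_ge; [apply/cvg_ex; exists 0|exact: nearW].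
rewrite normr_le0 subr_eq0 => /eqP.
by rewrite /th mul0r addr0.
Qed.
End gem.

(** * Decreasing rearrangement *)

Section rearrangement.
Variable R : realType.

(** Only the positive terms matter, and they correspond bijectively, value by
value. *)
Lemma nneseries_rearrangement (a b : nat -> R) (f : R -> R) :
  (forall i, 0 <= a i) -> (forall i, 0 <= b i) ->
  (forall x, 0 <= f x) -> f 0 = 0 ->
  (forall x : R, 0 < x -> ([set i | a i = x] #= [set i | b i = x])%card) ->
  (\sum_(0 <= i <oo) (f (a i))%:E = \sum_(0 <= i <oo) (f (b i))%:E)%E.
Proof.
move=> a0 b0 f0 f00 ab.
have pos (u : nat -> R) : (forall i, 0 <= u i) ->
    (\sum_(0 <= i <oo) (f (u i))%:E = \esum_(i in [set i | (0 < u i)%R]) (f (u i))%:E)%E.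
  move=> u0; rewrite nneseries_esumT; last by move=> i; rewrite lee_fin.
  rewrite esum_mkcond [RHS]esum_mkcond; apply: eq_esum => i _.
  rewrite mem_setT; case: ifPn => // /negP; rewrite inE /= lt_neqAle u0 andbT => /negP.
  by rewrite negbK eq_sym => /eqP ->; rewrite f00.
rewrite !pos //.
have /choice [e he] : forall x : R, exists g : nat -> nat,
    0 < x -> set_bij [set i | a i = x] [set i | b i = x] g.
  move=> x; have [x0|nx0] := boolP (0 < x); last by exists id.
  by have /card_set_bijP[g hg] := ab _ x0; exists g.
rewrite (@reindex_esum _ _ _ [set i | 0 < a i] [set i | 0 < b i] (fun i => e (a i) i)) //.
  by apply: eq_esum => i /= ai; have [/(_ i erefl) /= -> _ _] := he _ ai.
split.
- by move=> i /= ai; have [/(_ i erefl) /= -> _ _] := he _ ai.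
- move=> i j /[!inE] /= ai aj eij.
  have [/(_ i erefl) /= bi _ _] := he _ ai.
  have [/(_ j erefl) /= bj _ _] := he _ aj.
  have aij : a i = a j by rewrite -bi -bj eij.
  have [_ inj _] := he _ ai; apply: inj; rewrite ?inE //=.
  by rewrite eij aij.
- move=> j /= bj; have [_ _ /(_ j erefl) [i /= ai <-]] := he _ bj.
  by exists i; rewrite /= ai.
Qed.

Lemma psum_rearrangement (a b : nat -> R) r :
  (forall i, 0 <= a i) -> (forall i, 0 <= b i) -> (0 < r)%N ->
  (forall x : R, 0 < x -> ([set i | a i = x] #= [set i | b i = x])%card) ->
  psum a r = psum b r.
Proof.
move=> a0 b0 r0 ab; rewrite /psum.
have E (u : nat -> R) : (forall i, 0 <= u i) ->
    (\sum_(0 <= i <oo) (u i ^+ r)%:E = \sum_(0 <= i <oo) (`|u i ^+ r|)%:E)%E.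
  by move=> u0; apply: eq_eseriesr => i _; rewrite ger0_norm // exprn_ge0.
rewrite (E a) // (E b) // (@nneseries_rearrangement a b (fun x => `|x ^+ r|)) //.
by rewrite expr0n eqn0Ngt r0 normr0.
Qed.

Lemma dsum_rearrangement (a b : nat -> R) q :
  (forall i, 0 <= a i) -> (forall i, 0 <= b i) -> all (ltn 0%N) q ->
  (forall x : R, 0 < x -> ([set i | a i = x] #= [set i | b i = x])%card) ->
  dsum (psum a) q = dsum (psum b) q.
Proof.
move=> a0 b0 + ab; have [n] := ubnP (size q); elim: n q => // n IH [|r t] sz // rt0.
have /andP[r0 t0] := rt0.
rewrite !dsum_cons (psum_rearrangement a0 b0 r0 ab) IH //; congr (_ - _).
apply: eq_big_seq => t' ht'; apply: IH; first by rewrite (size_bumps ht').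
exact: bumps_gt0 ht'.
Qed.

Lemma sdown_subprob (s : sdown R) : subprob s.
Proof. by split; [exact: sdown_ge0|rewrite sdown_sum1]. Qed.

Lemma measurable_sdown i : measurable_fun setT (fun s : sdown R => s i).
Proof.
move=> _ B mB; rewrite setTI; apply: sub_sigma_algebra; exists i, B; by [].
Qed.

Lemma measurable_dsum_sdown q : measurable_fun setT (fun s : sdown R => dsum (psum s) q).
Proof.
apply: measurable_dsum => [j|s j]; [exact: measurable_sdown|exact: sdown_ge0].
Qed.

End rearrangement.

Section pdp.
Variables (R : realType) (alpha theta : R) (P : probability (sdown R) R).
Hypotheses (a0 : 0 <= alpha) (a1 : alpha < 1) (ht : - alpha < theta).
Hypothesis PD : is_PDP alpha theta P.

(** The factors are only almost surely in [0, 1]; clipping them leaves their joint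
law unchanged and makes the bounds hold everywhere. *)
Definition clip01 (x : R) : R := Num.max 0 (Num.min x 1).

Lemma clip01_itv x : 0 <= clip01 x <= 1.
Proof. by rewrite /clip01 le_max lexx /= ge_max ler01 /= ge_min lexx orbT. Qed.

Lemma clip01_id x : 0 < x < 1 -> clip01 x = x.
Proof.
move=> /andP[x0 x1]; rewrite /clip01 (min_idPl _) ?(ltW x1) //.
by rewrite (max_idPr _) // ltW.
Qed.

Lemma measurable_clip01 : measurable_fun setT clip01.
Proof. by apply: measurable_maxr => //; exact: measurable_minr. Qed.

Lemma PDP_dsum q : all (ltn 0%N) q ->
  (\int[P]_s (dsum (psum s) q)%:E)%E = (pitman_moment alpha theta q)%:E.
Proof.
move=> q0; have [d [U [Pr [W [V [WI WB VW VP]]]]]] := PD.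
have mW j : measurable_fun setT (clip01 \o W j).
  exact: measurableT_comp measurable_clip01 _.
pose W' j : {RV Pr >-> R} := mfun_Sub (mem_set (mW j)).
have W'E j w : W' j w = clip01 (W j w) by [].
have pre j (A : set R) : W' j @^-1` A = W j @^-1` (clip01 @^-1` A) by [].
have mpre (A : set R) : measurable A -> measurable (clip01 @^-1` A).
  by move=> mA; rewrite -[_ @^-1` _]setTI; exact: measurable_clip01.
have GW : gem_factors alpha theta W'.
  split.
  - move=> J B mB; under eq_bigr do rewrite pre.
    rewrite -(WI J (fun j => clip01 @^-1` B j)) // => j; exact: mpre.
  - move=> j A mA; rewrite pre WB; last exact: mpre.
    congr (integral _ _ _); apply/seteqP; split => x /= [Ax]; rewrite in_itv /= => x01.
      by split => //; move: Ax; rewrite /= clip01_id.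
    by split => //; rewrite /= clip01_id.
  - by move=> j w; exact: clip01_itv.
(* The density lives on the open interval, so taking [setT] as the event shows that
   it has full mass. *)
have W01 : {ae Pr, forall w, forall j, 0 < W j w < 1}.
  apply: ae_foralln => j.
  have mI : measurable (W j @^-1` `]0, 1[%classic).
    by rewrite -[_ @^-1` _]setTI; apply: measurable_funP.
  exists (~` (W j @^-1` `]0, 1[%classic)); split; first exact: measurableC.
  - apply: (etrans (probability_setC _ mI)).
    have -> : Pr (W j @^-1` `]0, 1[%classic) = Pr (W j @^-1` setT).
      by rewrite !WB //; congr (integral _ _ _); rewrite setIid setTI.
    rewrite preimage_setT; apply: (etrans (congr1 (fun x => 1 - x)%E (probability_setT Pr))).
    by rewrite subee.
  - by move=> w /= nw; apply: contra_not nw; rewrite in_itv.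
rewrite -(gem_mean_pitman a0 a1 ht GW q0) -(gem_meanE GW q0).1.
transitivity (\int[distribution Pr V]_s (dsum (psum s) q)%:E)%E.
  by apply: eq_measure_integral => A mA _; exact: VP.
rewrite ge0_integral_distribution; last 2 first.
- by apply/measurable_EFinP; exact: measurable_dsum_sdown.
- by move=> s; rewrite lee_fin dsum_ge0 //; exact: sdown_subprob.
apply: ge0_ae_eq_integral => //.
- apply/measurable_EFinP; exact: (measurableT_comp (measurable_dsum_sdown q)).
- apply/measurable_EFinP; exact: (measurable_stick_dsum q GW).
- by move=> w _; rewrite lee_fin dsum_ge0 //; exact: sdown_subprob.
- by move=> w _; rewrite lee_fin; exact: (stick_dsum_ge0 _ GW).
move: VW W01; apply: filterS2 => w Vw Ww _.
congr (_%:E); rewrite /stick_dsum.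
have EW : (fun j => W' j w) = (fun j => W j w).
  by apply/funext => j; rewrite W'E clip01_id.
rewrite EW; apply/esym/dsum_rearrangement => //.
- by apply: (stick_subprob _).1 => j; have /andP[/ltW -> /ltW ->] := Ww j.
- by move=> i; exact: sdown_ge0.
Qed.
End pdp.

(** * The abundance vector given the frequencies *)

Definition rel_discoverers (same : rel nat) (n : nat) : seq nat :=
  [seq l <- iota 0 n | ~~ has (same l) (iota 0 l)].

(** The abundance vector of an arbitrary relation between individuals, so that the
random relation of the sample can be compared with the one read off a word. *)
Definition rel_abundance (same : rel nat) (n : nat) : seq nat :=
  [seq count (same l) (iota 0 n) | l <- rel_discoverers same n].

Lemma eq_rel_abundance (r1 r2 : rel nat) n :
  (forall l m, (l < n)%N -> (m < n)%N -> r1 l m = r2 l m) ->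
  rel_abundance r1 n = rel_abundance r2 n.
Proof.
move=> r12; rewrite /rel_abundance.
have -> : rel_discoverers r1 n = rel_discoverers r2 n.
  apply: eq_in_filter => l; rewrite mem_iota /= => ln; congr (~~ _).
  by apply: eq_in_has => m; rewrite mem_iota /= => ml; rewrite r12 // (ltn_trans ml).
apply/eq_in_map => l; rewrite mem_filter mem_iota /= => /andP[_ ln].
by apply: eq_in_count => m; rewrite mem_iota /= => mn; rewrite r12.
Qed.

Definition word_rel (c : seq nat) : rel nat := fun l m => nth 0%N c l == nth 0%N c m.

Lemma has_word_rel c l x : (l <= size c)%N ->
  has (fun m => x == nth 0%N c m) (iota 0 l) = (x \in take l c).
Proof.
move=> lc; rewrite -[take l c](mkseq_nth 0%N) size_takel // -has_pred1 has_map.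
apply: eq_in_has => m; rewrite mem_iota /= => ml.
by rewrite nth_take // eq_sym.
Qed.

Lemma discoverers_word d :
  [seq nth 0%N (rev d) l | l <- rel_discoverers (word_rel (rev d)) (size d)] = rev (undup d).
Proof.
elim: d => [//|i d IH]; rewrite rev_cons.
set c := rev d in IH *; have sc : size c = size d by rewrite size_rev.
rewrite /rel_discoverers [size (i :: d)]/= -[(size d).+1]addn1 iotaD add0n filter_cat map_cat.
have -> : [seq nth 0%N (rcons c i) l | l <-
     [seq l <- iota 0 (size d) | ~~ has (word_rel (rcons c i) l) (iota 0 l)]]
   = rev (undup d).
  rewrite -IH /rel_discoverers.
  have nr l : (l < size d)%N -> nth 0%N (rcons c i) l = nth 0%N c l.
    by move=> ld; rewrite nth_rcons sc ld.
  rewrite (@eq_in_filter _ _ (fun l => ~~ has (word_rel c l) (iota 0 l))); last first.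
    move=> l; rewrite mem_iota /= => ld; congr (~~ _); apply: eq_in_has => m.
    by rewrite mem_iota /= => ml; rewrite /word_rel !nr // (ltn_trans ml).
  by apply/eq_in_map => l; rewrite mem_filter mem_iota => /andP[_ /= ld]; rewrite nr.
have nn : nth 0%N (rcons c i) (size d) = i by rewrite nth_rcons sc ltnn eqxx.
have hi : has (word_rel (rcons c i) (size d)) (iota 0 (size d)) = (i \in d).
  rewrite /word_rel nn has_word_rel ?size_rcons ?sc //.
  by rewrite -cats1 take_size_cat // mem_rev.
rewrite /= hi; case: (i \in d) => /=; first by rewrite cats0.
by rewrite nn rev_cons cats1.
Qed.

(** Both reversals come from words being stored with the last individual first:
[undup] keeps the last occurrence in the list, that is, the earliest individual,
but lists the species in reverse order of discovery. *)
Lemma abundance_word d : rel_abundance (word_rel (rev d)) (size d) = rev (occurrences d).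
Proof.
rewrite /occurrences -map_rev -discoverers_word -map_comp; apply/eq_in_map => l /=.
rewrite mem_filter mem_iota /= => /andP[_ ld].
have E x : count_mem x d = count (fun m => nth 0%N (rev d) m == x) (iota 0 (size d)).
  by rewrite -count_rev -[X in count _ X](mkseq_nth 0%N) /mkseq size_rev count_map.
by rewrite E; apply: eq_count => m; rewrite /word_rel eq_sym.
Qed.

Section paint.
Context (R : realType) d (Omega : measurableType d) (Pr : probability Omega R).
Variables (left : sdown R -> nat -> R) (X : nat -> {RV Pr >-> R}).
Hypothesis leftP : interval_assignment left.
Hypothesis Xunif : forall l A, measurable A ->
  distribution Pr (X l) A = uniform_prob (@ltr01 R) A.
Hypothesis XI : mutually_independent Pr (fun l => X l).

(** The relation at a frozen value [s] of the frequencies. *)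
Definition paint_same (s : sdown R) (w : Omega) : rel nat := fun l m =>
  (l == m) || `[< exists i, paint_interval left s i (X l w) /\
                            paint_interval left s i (X m w) >].

Definition paint_abundance s w n := rel_abundance (paint_same s w) n.

Lemma measurable_paint_interval s i : measurable (paint_interval left s i).
Proof. exact: measurable_itv. Qed.

Let mX l A : measurable A -> measurable (X l @^-1` A).
Proof. by move=> mA; rewrite -[_ @^-1` _]setTI; apply: measurable_funP. Qed.

Lemma prob_paint_interval s i l : Pr (X l @^-1` paint_interval left s i) = (s i)%:E.
Proof.
have mI := measurable_paint_interval s i.
rewrite -[LHS]/(distribution Pr (X l) (paint_interval left s i)) Xunif //.
have [l0 l1] := assign_in01 leftP s i.
rewrite /uniform_prob integral_uniform_pdf setIidl; last first.
  move=> x; rewrite /paint_interval /= !in_itv /= => /andP[/ltW x0 /ltW x1].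
  by rewrite (le_trans l0) // (le_trans x1).
rewrite (eq_integral (fun=> 1%E)); last first.
  move=> x; rewrite inE /paint_interval /= in_itv /= => /andP[/ltW x0 /ltW x1].
  by rewrite /uniform_pdf (le_trans l0) // (le_trans x1) // subr0 invr1.
rewrite (@integral_cst _ _ _ _ _ _ 1%E) //= mul1e /paint_interval lebesgue_measure_itv /= lte_fin ltrDl.
have := sdown_ge0 s i; rewrite le_eqVlt => /orP[/eqP <-|si]; first by rewrite ltxx.
by rewrite si -EFinD addrAC subrr add0r.
Qed.

Lemma paint_interval_inj s i j x :
  paint_interval left s i x -> paint_interval left s j x -> i = j.
Proof.
by move=> xi xj; apply: (@assign_disjoint _ _ leftP s i j) => //; exists x.
Qed.

Definition word_event s (c : seq nat) : set Omega :=
  cylinder (fun l => X l) (size c) (fun l => paint_interval left s (nth 0%N (rev c) l)).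

Lemma measurable_word_event s c : measurable (word_event s c).
Proof.
have -> : word_event s c = \bigcap_(l in [set l | (l < size c)%N])
    (X l @^-1` paint_interval left s (nth 0%N (rev c) l)) by [].
by apply: bigcap_measurableType => l _; apply: mX; exact: measurable_paint_interval.
Qed.

Lemma prob_word_event s c : Pr (word_event s c) = (\prod_(i <- c) s i)%:E.
Proof.
rewrite mutually_independent_cylinder //; last by move=> l; exact: measurable_paint_interval.
rewrite (eq_bigr (fun l => (s (nth 0%N (rev c) l))%:E)); last first.
  by move=> l _; exact: prob_paint_interval.
rewrite prodEFin -(size_rev c) -(big_nth 0%N predT s) (perm_big c) //.
by rewrite perm_rev.
Qed.

Lemma word_event_cons s i c :
  word_event s (i :: c) = word_event s c `&` X (size c) @^-1` paint_interval left s i.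
Proof.
have E l : (l < size c)%N -> nth 0%N (rev (i :: c)) l = nth 0%N (rev c) l.
  by move=> lc; rewrite rev_cons nth_rcons size_rev lc.
have E' : nth 0%N (rev (i :: c)) (size c) = i.
  by rewrite rev_cons nth_rcons size_rev ltnn eqxx.
apply/seteqP; split => w /=.
  move=> H; split; first by move=> l lc; rewrite -E //; apply: H; rewrite /= ltnW.
  by have := H (size c) (ltnSn _); rewrite E'.
move=> [H1 H2] l /=; rewrite ltnS leq_eqVlt => /orP[/eqP ->|lc]; first by rewrite E'.
by rewrite E //; exact: H1.
Qed.

(** The next individual almost surely falls into one of the intervals, because their
lengths add up to 1. *)
Lemma prob_word_event_split s c A : measurable A ->
  Pr (A `&` word_event s c) = (\sum_(0 <= i <oo) Pr (A `&` word_event s (i :: c)))%E.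
Proof.
move=> mA.
pose F i := A `&` word_event s (i :: c).
have mF i : measurable (F i) by apply: measurableI => //; exact: measurable_word_event.
pose U := \bigcup_i (paint_interval left s i).
have mU : measurable U.
  by apply: bigcupT_measurable => i; exact: measurable_paint_interval.
have tI : trivIset setT (paint_interval left s) by exact: assign_disjoint.
have PU : Pr (X (size c) @^-1` U) = 1%E.
  rewrite -[LHS]/(distribution Pr (X (size c)) U) measure_semi_bigcup //; last first.
    by move=> i; exact: measurable_paint_interval.
  rewrite -(sdown_sum1 s); apply: eq_eseriesr => i _; exact: prob_paint_interval.
have PCU : Pr (X (size c) @^-1` ~` U) = 0%E.
  apply: (etrans (probability_setC _ (mX (size c) mU))).
  by rewrite PU subee.
have tF : trivIset setT F.
  move=> i j _ _ [w [[_ Hi] [_ Hj]]].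
  rewrite word_event_cons in Hi; rewrite word_event_cons in Hj.
  by apply: paint_interval_inj Hi.2 Hj.2.
have -> : A `&` word_event s c = \bigcup_i F i `|` (A `&` word_event s c `&` X (size c) @^-1` ~` U).
  apply/seteqP; split => w.
    move=> [Aw Cw]; have [[i _ Iw]|nU] := pselect (U (X (size c) w)).
      by left; exists i => //; split => //; rewrite word_event_cons.
    by right; split => //; split.
  case=> [[i _ [Aw]]|[[Aw Cw] _]]; last by split.
  by rewrite word_event_cons => -[Cw _]; split.
rewrite measureU0.
- rewrite measure_semi_bigcup //; exact: bigcupT_measurable.
- exact: bigcupT_measurable.
- apply: measurableI; last by apply: mX; exact: measurableC.
  by apply: measurableI => //; exact: measurable_word_event.
- apply: (subset_measure0 _ _ _ PCU).
  + apply: measurableI; last by apply: mX; exact: measurableC.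
    by apply: measurableI => //; exact: measurable_word_event.
  + by apply: mX; exact: measurableC.
  + by move=> w [].
Qed.
End paint.

Lemma eq_word_sum_size (R : realType) n (P1 P2 : seq nat -> \bar R) :
  (forall c, size c = n -> P1 c = P2 c) -> word_sum n P1 = word_sum n P2.
Proof.
elim: n P1 P2 => [|n IH] P1 P2 P12 /=; first exact: P12.
by apply: IH => c cn; apply: eq_eseriesr => i _; apply: P12; rewrite /= cn.
Qed.

Lemma label_weight_occurrences (R : realType) (a : nat -> R) c :
  label_weight a (undup c) (occurrences c) = \prod_(i <- c) a i.
Proof.
rewrite -[RHS]big_undup_iterop_count /label_weight /occurrences.
elim: (undup c) => [|x u IH]; first by rewrite !big_nil.
by rewrite /= !big_cons IH.
Qed.

Section discrete.
Context d (Z : measurableType d).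

(** Measurability for the discrete sigma-algebra on [T], used for values in countable
types such as lists of integers. *)
Definition discrete_measurable (T : Type) (f : Z -> T) :=
  forall B : set T, measurable (f @^-1` B).

Lemma discrete_measurable_cst (T : Type) (t : T) : discrete_measurable (fun _ => t).
Proof. by move=> B; rewrite preimage_cst; case: ifP. Qed.

Lemma discrete_measurable_bool (f : Z -> bool) :
  measurable [set z | f z] -> discrete_measurable f.
Proof.
move=> mf B.
have -> : f @^-1` B = ([set z | f z] `&` (fun _ => true) @^-1` B)
    `|` (~` [set z | f z] `&` (fun _ => false) @^-1` B).
  apply/seteqP; split => z /=; first by case: (f z) => h; [left|right].
  by case=> -[]; case: (f z).
apply: measurableU; apply: measurableI => //; try exact: discrete_measurable_cst.
exact: measurableC.
Qed.

Lemma discrete_measurable_bind (T : countType) (T' : Type) (f : Z -> T) (g : T -> Z -> T') :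
  discrete_measurable f -> (forall t, discrete_measurable (g t)) ->
  discrete_measurable (fun z => g (f z) z).
Proof.
move=> mf mg B.
have -> : (fun z => g (f z) z) @^-1` B = \bigcup_n
    (if @choice.unpickle T n is Some t then f @^-1` [set t] `&` g t @^-1` B else set0).
  apply/seteqP; split => z /=.
    by move=> Bz; exists (choice.pickle (f z)) => //; rewrite choice.pickleK.
  by case=> n _; case: (@choice.unpickle T n) => // t [/= <-].
apply: bigcupT_measurable => n; case: (@choice.unpickle T n) => // t.
by apply: measurableI; [exact: mf|exact: mg].
Qed.

Lemma discrete_measurable_rel_abundance (same : Z -> rel nat) n :
  (forall l m, measurable [set z | same z l m]) ->
  discrete_measurable (fun z => rel_abundance (same z) n).
Proof.
move=> ms.
have mb l m : discrete_measurable (fun z => same z l m) by exact: discrete_measurable_bool.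
have mcount l L : discrete_measurable (fun z => count (same z l) L).
  elim: L => [|m L IH] /=; first exact: discrete_measurable_cst.
  apply: (@discrete_measurable_bind _ _ _ (fun k z => same z l m + k)%N) IH _ => k.
  apply: (@discrete_measurable_bind _ _ _ (fun (b : bool) _ => b + k)%N) (mb l m) _ => b.
  exact: discrete_measurable_cst.
have mhas l L : discrete_measurable (fun z => ~~ has (same z l) L).
  move=> B; under eq_fun do rewrite has_count.
  exact: (mcount l L [set k | B (~~ (0 < k)%N)]).
have mdisc L : discrete_measurable (fun z => [seq l <- L | ~~ has (same z l) (iota 0 l)]).
  elim: L => [|l L IH] /=; first exact: discrete_measurable_cst.
  apply: (@discrete_measurable_bind _ _ _
    (fun K z => if ~~ has (same z l) (iota 0 l) then l :: K else K)) IH _ => K.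
  apply: (@discrete_measurable_bind _ _ _ (fun (b : bool) _ => if b then l :: K else K)) (mhas _ _) _ => b.
  exact: discrete_measurable_cst.
apply: (@discrete_measurable_bind _ _ _
  (fun L z => [seq count (same z l) (iota 0 n) | l <- L])) (mdisc _) _.
elim=> [|l L IH] /=; first exact: discrete_measurable_cst.
apply: (@discrete_measurable_bind _ _ _ (fun K z => count (same z l) (iota 0 n) :: K)) IH _ => K.
apply: (@discrete_measurable_bind _ _ _ (fun k _ => k :: K)) (mcount _ _) _ => k.
exact: discrete_measurable_cst.
Qed.
End discrete.

Section prob_abundance.
Context (R : realType) d (Omega : measurableType d) (Pr : probability Omega R).
Variables (left : sdown R -> nat -> R) (X : nat -> {RV Pr >-> R}).
Hypothesis leftP : interval_assignment left.
Hypothesis Xunif : forall l A, measurable A ->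
  distribution Pr (X l) A = uniform_prob (@ltr01 R) A.
Hypothesis XI : mutually_independent Pr (fun l => X l).

Lemma measurable_in_paint d' (Z : measurableType d') (S : Z -> sdown R) (Y : Z -> R) i :
  measurable_fun setT S -> measurable_fun setT Y ->
  measurable [set z | paint_interval left (S z) i (Y z)].
Proof.
move=> mS mY.
have ml : measurable_fun setT (fun z => left (S z) i).
  exact: (measurableT_comp (assign_measurable leftP i) mS).
have mr : measurable_fun setT (fun z => left (S z) i + S z i).
  by apply: measurable_funD => //; exact: (measurableT_comp (@measurable_sdown R i) mS).
have -> : [set z | paint_interval left (S z) i (Y z)]
   = [set z | left (S z) i < Y z] `&` [set z | Y z < left (S z) i + S z i].
  by apply/seteqP; split => z; rewrite /paint_interval /= in_itv /= => /andP.
by apply: measurableI; rewrite -[X in measurable X]setTI; apply: measurable_fun_ltr.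
Qed.

Lemma measurable_paint_same d' (Z : measurableType d') (S : Z -> sdown R) (w : Z -> Omega) l m :
  measurable_fun setT S -> (forall l, measurable_fun setT (fun z => X l (w z))) ->
  measurable [set z | paint_same left X (S z) (w z) l m].
Proof.
move=> mS mw; rewrite /paint_same.
have [->|lm] := eqVneq l m; first by rewrite (_ : [set z | _] = setT) //; apply/seteqP; split.
have -> : [set z | false || `[< exists i, paint_interval left (S z) i (X l (w z)) /\
                            paint_interval left (S z) i (X m (w z)) >]]
  = \bigcup_i ([set z | paint_interval left (S z) i (X l (w z))]
      `&` [set z | paint_interval left (S z) i (X m (w z))]).
  apply/seteqP; split => z /=.
    by move=> /asboolP[i [h1 h2]]; exists i.
  by move=> [i _ [h1 h2]]; apply/asboolP; exists i.
by apply: bigcupT_measurable => i; apply: measurableI; exact: measurable_in_paint.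
Qed.

Lemma word_event_abundance s c w : word_event left X s c w ->
  paint_abundance left X s w (size c) = rev (occurrences c).
Proof.
move=> wc; rewrite -abundance_word; apply: eq_rel_abundance => l m lc mc.
have wl := wc l lc; have wm := wc m mc.
rewrite /paint_same /word_rel; apply/idP/idP.
  move=> /orP[/eqP -> //|/asboolP[i [il im]]].
  by rewrite (paint_interval_inj leftP wl il) (paint_interval_inj leftP wm im).
move=> /eqP e; apply/orP; right; apply/asboolP; exists (nth 0%N (rev c) l).
by split => //; rewrite e.
Qed.

Lemma measurable_paint_abundance s p : measurable [set w | paint_abundance left X s w (sumn p) = p].
Proof.
apply: (@discrete_measurable_rel_abundance _ Omega (fun w => paint_same left X s w) (sumn p) _ [set p]).
by move=> l m; apply: (@measurable_paint_same _ _ (fun _ => s) id).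
Qed.

(** The number of set partitions of the sample that give the abundance vector [p]. *)
Definition partition_count (p : seq nat) : nat :=
  word_count (sumn p) (fun t => (t == rev p) : nat) (size (rev p)).

Lemma partition_count_gt0 p : all (ltn 0%N) p -> (0 < partition_count p)%N.
Proof.
move=> p0; apply: word_count_gt0; first by rewrite all_rev.
- by rewrite sumn_rev.
- by rewrite eqxx.
Qed.

(** The event is decomposed according to the word of intervals hit by the sample;
on a word the abundance vector is constant, and its probability is the product of
the frequencies of the letters. *)
Lemma prob_paint_abundance s p : all (ltn 0%N) p ->
  Pr [set w | paint_abundance left X s w (sumn p) = p]
  = ((partition_count p)%:R * dsum (psum s) (rev p))%:E.
Proof.
move=> p0; set A := [set w | _]; have mA : measurable A by exact: measurable_paint_abundance.
have split n : Pr A = word_sum n (fun c => Pr (A `&` word_event left X s c)).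
  elim: n => [|n IH] /=.
    congr (Pr _); apply/seteqP; split => w; last by case.
    by move=> Aw; split.
  rewrite IH; apply: eq_word_sum => c.
  exact: prob_word_event_split.
rewrite (split (sumn p)) -word_sum_weight ?all_rev //; last exact: sdown_subprob.
apply: eq_word_sum_size => c cn.
rewrite /word_weight.
have [tp|tp] := eqVneq (occurrences c) (rev p).
  have -> : A `&` word_event left X s c = word_event left X s c.
    apply/setIidPr => w wc; rewrite /A /= -cn (word_event_abundance wc) tp.
    exact: revK.
  rewrite prob_word_event // -tp label_weight_occurrences size_map eqxx muln1 mul1r //.
have -> : A `&` word_event left X s c = set0.
  rewrite -subset0 => w [Aw wc]; move: Aw; rewrite /A /= -cn (word_event_abundance wc) => e.
  by move: tp; rewrite -e revK eqxx.
by rewrite measure0 mul0n mul0r.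
Qed.
End prob_abundance.

Section bridge.
Context (R : realType) (P : probability (sdown R) R) (E : exch_partition P).
Local Open Scope ereal_scope.

Let S := ep_S E.
Let X := ep_X E.

(** Conditioning on [S = s] by independence replaces the event by its conditional
probability. *)
Lemma integral_abundance_event p (G : sdown R -> \bar R) :
  all (ltn 0%N) p -> measurable_fun setT G -> (forall s, 0 <= G s) ->
  \int[ep_Pr E]_(w in @abundance_event _ _ E p) G (S w)
  = \int[P]_s (G s * ((partition_count p)%:R * dsum (psum s) (rev p))%:E).
Proof.
move=> p0 mG G0.
(* The event is turned into an integrand on the product of the frequencies with
   the sample. *)
pose h (z : sdown R * observed X) : \bar R :=
  if paint_abundance (@ep_left _ _ E) X z.1 z.2 (sumn p) == p then G z.1 else 0.
have mh : measurable_fun setT h.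
  apply: measurable_fun_ifT; last 2 first.
  - exact: measurableT_comp mG measurable_fst.
  - exact: measurable_cst.
  apply: (measurable_fun_bool true); rewrite setTI.
  have -> : (fun z : sdown R * observed X =>
       paint_abundance (@ep_left _ _ E) X z.1 z.2 (sumn p) == p) @^-1` [set true]
     = (fun z : sdown R * observed X => rel_abundance
         (paint_same (@ep_left _ _ E) X z.1 z.2) (sumn p)) @^-1` [set p].
    by apply/seteqP; split => z /= /eqP.
  apply: discrete_measurable_rel_abundance => l m.
  apply: (@measurable_paint_same R _ _ _ _ X (ep_leftP E) _ (sdown R * observed X)%type
    (fun z => z.1) (fun z => z.2) l m).
  - exact: measurable_fst.
  - move=> l'; exact: (measurableT_comp (@measurable_observe _ _ _ _ X l') measurable_snd).
have h0 z : 0 <= h z by rewrite /h; case: ifP.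
have -> : \int[ep_Pr E]_(w in @abundance_event _ _ E p) G (S w) = \int[ep_Pr E]_w h (S w, w).
  rewrite integral_mkcond; apply: eq_integral => w _; rewrite patchE /h /=.
  congr (if _ then _ else _); apply/idP/idP.
    by rewrite inE => /eqP.
  by move/eqP => H; rewrite inE.
rewrite (independent_integral (ep_SX_indep (e := E)) mh h0).
transitivity (\int[P]_s \int[ep_Pr E]_w h (s, w)).
  by apply: eq_measure_integral => A mA _; exact: ep_S_law.
apply: eq_integral => s _.
rewrite -(@prob_paint_abundance _ _ _ _ _ X (ep_leftP E) (@ep_X_uniform _ _ E) (@ep_X_indep _ _ E) s p p0).
rewrite -integral_cst; last first.
  exact: (@measurable_paint_abundance _ _ _ _ _ X (ep_leftP E)).
rewrite [RHS]integral_mkcond; apply: eq_integral => w _; rewrite patchE /h /=.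
congr (if _ then _ else _); apply/idP/idP.
  by move/eqP => H; rewrite inE.
by rewrite inE => /eqP.
Qed.
End bridge.

(** * Logarithmic series *)

Section log_series.
Variable R : realType.

Let rem (M : nat) (x : R) : R := - ln x - \sum_(0 <= m < M) (1 - x) ^+ m.+1 / m.+1%:R.

Let is_derive_rem M (x : R) : 0 < x -> is_derive x 1 (rem M) (- ((1 - x) ^+ M / x)).
Proof.
move=> x0; elim: M => [|M IH].
  have -> : rem 0 = fun y => - ln y.
    by apply/funext => y; rewrite /rem big_geq // subr0.
  have h := is_derive1_ln x0.
  apply: is_derive_eq; by rewrite expr0 mul1r.
have -> : rem M.+1 = fun y => rem M y - (M.+1%:R)^-1 * ((1 - y) ^+ M.+1).
  apply/funext => y; rewrite /rem big_nat_recr //= opprD addrA; congr (_ - _).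
  by rewrite mulrC.
have h1 : is_derive x 1 (fun y : R => 1 - y) (0 - 1) by exact: is_deriveB.
have h2 := @is_deriveX _ _ (fun y : R => 1 - y) M.+1 x 1 _ h1.
have h3 := @is_deriveZ _ _ _ _ (M.+1%:R)^-1 x 1 _ h2.
have h4 := @is_deriveB _ _ _ (rem M) _ x 1 _ _ IH h3.
have -> : (fun y => rem M y - (M.+1%:R)^-1 * (1 - y) ^+ M.+1)
   = rem M - (M.+1%:R)^-1 \*: (fun y : R => 1 - y) ^+ M.+1.
  by apply/funext => y; rewrite exprfctE.
apply: is_derive_eq.
have x0' : x != 0 by rewrite gt_eqF.
have M0 : M.+1%:R != 0 :> R by rewrite pnatr_eq0.
rewrite /GRing.scale /= exprS; move: M0; move: (M.+1%:R : R) => k k0.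
by field; rewrite x0' k0.
Qed.

(** The remainder vanishes at 1 and has derivative [- (1 - x)^M / x], so the mean
value theorem bounds it. *)
Lemma ln_remainder_bound M (x : R) : 0 < x -> x <= 1 ->
  0 <= - ln x - \sum_(0 <= m < M) (1 - x) ^+ m.+1 / m.+1%:R <= (1 - x) ^+ M.+1 / x.
Proof.
move=> x0; rewrite le_eqVlt => /orP[/eqP ->|x1].
  rewrite subrr ln1 oppr0 sub0r big1 ?oppr0 ?lexx ?expr0n ?mul0r ?lexx //.
  by move=> m _; rewrite expr0n mul0r.
have [||c] := @MVT R (rem M) (fun y => - ((1 - y) ^+ M / y)) x 1 x1.
- move=> y; rewrite in_itv /= => /andP[xy _]; apply: is_derive_rem; exact: lt_trans xy.
- apply: derivable_within_continuous => y; rewrite in_itv /= => /andP[xy _].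
  by apply: ex_derive; apply: is_derive_rem; exact: lt_le_trans xy.
rewrite in_itv /= => /andP[xc c1].
have -> : rem M 1 = 0.
  rewrite /rem ln1 oppr0 sub0r big1 ?oppr0 // => m _.
  by rewrite subrr expr0n mul0r.
rewrite sub0r mulNr => /oppr_inj; rewrite -/(rem M x) => ->.
have c0 : 0 < c by exact: lt_trans xc.
have c1' : 0 <= 1 - c by rewrite subr_ge0 ltW.
have x1' : 0 <= 1 - x by rewrite subr_ge0 ltW.
rewrite mulr_ge0 ?divr_ge0 ?exprn_ge0 ?(ltW c0) //=.
rewrite exprSr [leRHS]mulrAC ler_wpM2r // ler_pM ?exprn_ge0 ?invr_ge0 ?(ltW c0) //.
  by rewrite lerXn2r ?nnegrE // lerD2l lerN2 ltW.
by rewrite lef_pV2 ?posrE // ltW.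
Qed.

Lemma ln_series (x : R) : 0 < x -> x <= 1 ->
  (\sum_(0 <= m <oo) ((1 - x) ^+ m.+1 / m.+1%:R)%:E = (- ln x)%:E)%E.
Proof.
move=> x0 x1; apply/cvg_lim => //.
under eq_fun do rewrite sumEFin; apply: cvg_EFin; first exact: nearW.
rewrite -[X in _ --> X](subr0 (- ln x)).
rewrite [X in X @ _ --> _](_ : _ = fun M => - ln x - rem M x); last first.
  by apply/funext => M; rewrite /rem subKr.
apply: cvgB; first exact: cvg_cst.
apply: (@squeeze_cvgr _ _ _ _ (fun=> 0) (fun M => (1 - x) ^+ M.+1 / x)).
- by apply: nearW => M; exact: ln_remainder_bound.
- exact: cvg_cst.
- rewrite -[X in _ --> X](mul0r x^-1); apply: cvgM; last exact: cvg_cst.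
  have : (fun n => (1 - x) ^+ n) @ \oo --> (0 : R).
    by apply: cvg_expr; rewrite ger0_norm ?subr_ge0 // ltrBlDr ltrDl.
  by rewrite -cvg_shiftS.
Qed.

Lemma entropy_series (x : R) : 0 <= x -> x <= 1 ->
  (\sum_(0 <= m <oo) (m.+1%:R^-1 * (x * (1 - x) ^+ m.+1))%:E = (- (x * ln x))%:E)%E.
Proof.
rewrite le_eqVlt => /orP[/eqP <- _|x0 x1].
  by rewrite mul0r oppr0 eseries0 // => i _ _; rewrite mul0r mulr0.
rewrite -mulrN EFinM -ln_series // -nneseriesZl; last first.
  by move=> m _; rewrite lee_fin divr_ge0 ?exprn_ge0 // subr_ge0.
by apply: eq_eseriesr => m _; rewrite -EFinM; congr (_%:E); ring.
Qed.
End log_series.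

Section digamma_series.
Variable R : realType.
Implicit Types b c : R.

(** The mean of [- ln B], expanded in powers of [1 - B], for [B] with law
Beta(c - b, b), that is, [psi c - psi (c - b)] with [psi] the digamma function. *)
Definition log_moment b c : \bar R :=
  (\sum_(0 <= m <oo) (m.+1%:R^-1 * (rising b m.+1 / rising c m.+1))%:E)%E.

(** The partial sums telescope to [(1 - (b)_M / (c)_M) / (c - b)]. *)
Lemma rising_telescope b c : 0 < b -> b < c ->
  (\sum_(0 <= m <oo) (rising b m / rising c m.+1)%:E = ((c - b)^-1)%:E)%E.
Proof.
move=> b0 bc; have c0 : 0 < c by exact: lt_trans bc.
have cb : 0 < c - b by rewrite subr_gt0.
have cb' : c - b != 0 by rewrite gt_eqF.
have S M : \sum_(0 <= m < M) rising b m / rising c m.+1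
    = (c - b)^-1 - (c - b)^-1 * (rising b M / rising c M).
  elim: M => [|M IH]; first by rewrite big_geq // !rising0 divr1 mulr1 subrr.
  have r0 : rising c M != 0 by rewrite gt_eqF // rising_gt0.
  have cM : c + M%:R != 0 by rewrite gt_eqF // ltr_wpDr.
  by rewrite big_nat_recr //= IH !risingS; field; rewrite cb' r0 cM.
apply/cvg_lim => //.
under eq_fun do rewrite sumEFin S; apply: cvg_EFin; first exact: nearW.
rewrite [X in _ --> X](_ : _ = (c - b)^-1 - (c - b)^-1 * 0); last first.
  by rewrite mulr0 subr0.
apply: cvgB; first exact: cvg_cst.
apply: cvgM; first exact: cvg_cst.
rewrite [X in X @ _ --> _](_ : _ = fun M => \prod_(i < M) (1 - (c - b) / (c + i%:R * 1))).
  by apply: prod_cvg0 => //; rewrite lerBlDr lerDl ltW.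
apply/funext => M; rewrite /rising -prodf_div; apply: eq_bigr => i _.
have ci : c + i%:R != 0 by rewrite gt_eqF // ltr_wpDr.
by rewrite mulr1; field.
Qed.

Let term_ge0 b c m : 0 < b -> b < c -> 0 <= rising b m / rising c m.
Proof.
move=> b0 bc; rewrite divr_ge0 // ltW // rising_gt0 //; exact: lt_trans bc.
Qed.

(** The terms are dominated by those of the telescoping series, up to the factor
[b + 1]. *)
Lemma log_moment_fin b c : 0 < b -> b < c -> log_moment b c \is a fin_num.
Proof.
move=> b0 bc; have c0 : 0 < c by exact: lt_trans bc.
rewrite ge0_fin_numE; last first.
  by apply: nneseries_ge0 => m _ _; rewrite lee_fin mulr_ge0 ?term_ge0.
apply: (@le_lt_trans _ _ ((b + 1)%:E * (c - b)^-1%:E)%E); last by rewrite -EFinM ltry.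
rewrite -rising_telescope // -nneseriesZl; last first.
  by move=> m _; rewrite lee_fin divr_ge0 // ltW // rising_gt0.
apply: lee_nneseries => m _; first by rewrite lee_fin mulr_ge0 // term_ge0.
rewrite -EFinM lee_fin !risingS.
have r0 : 0 <= rising b m / (rising c m * (c + m%:R)).
  by rewrite divr_ge0 ?mulr_ge0 ?addr_ge0 // ltW // rising_gt0.
rewrite [leLHS](_ : _ = (b + m%:R) / m.+1%:R * (rising b m / (rising c m * (c + m%:R)))); last first.
  by ring.
rewrite ler_wpM2r // ler_pdivrMr ?ltr0n // -natr1.
have := mulr_ge0 (ltW b0) (ler0n R m); lra.
Qed.

(** The functional equation [psi (x + 1) = psi x + 1 / x], here from the termwise
difference being the telescoping series. *)
Lemma log_moment_step b c : 0 < b -> b + 1 < c ->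
  log_moment (b + 1) c = (log_moment b c + ((c - (b + 1))^-1)%:E)%E.
Proof.
move=> b0 bc.
have b1 : 0 < b + 1 by rewrite addr_gt0.
have bc' : b < c by rewrite (lt_trans _ bc) // ltrDl.
have c0 : 0 < c by exact: lt_trans bc'.
rewrite -rising_telescope // /log_moment -nneseriesD; last 2 first.
- by move=> m _ _; rewrite lee_fin mulr_ge0 ?term_ge0.
- by move=> m _ _; rewrite lee_fin divr_ge0 // ltW // rising_gt0.
apply: eq_eseriesr => m _; rewrite -EFinD; congr (_%:E).
have M0 : m.+1%:R != 0 :> R by rewrite pnatr_eq0.
have r0 : rising c m.+1 != 0 by rewrite gt_eqF // rising_gt0.
rewrite risingS (risingSl b) -natr1 in M0 *.
by field; rewrite M0 r0.
Qed.
End digamma_series.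

(** * Posterior means of power sums *)

Lemma beta_moment_split (R : realFieldType) (a b : R) r m : 0 < a + b ->
  beta_moment a b r m = beta_moment a b r m.+1 + beta_moment a b r.+1 m.
Proof.
move=> ab; rewrite /beta_moment addnS addSn !risingS natrD.
have r0 : rising (a + b) (r + m) != 0 by rewrite gt_eqF // rising_gt0.
have d0 : a + b + (r%:R + m%:R) != 0 by rewrite gt_eqF // ltr_wpDr // addr_ge0.
by field; rewrite r0 d0.
Qed.

Section power_moments.
Variable R : realType.
Implicit Type s : sdown R.

(** These sums interpolate between power sums ([m = 0]) and the entropy, which is a
series of the sums with [r = 0]. *)
Definition power_moment s r m : \bar R :=
  (\sum_(0 <= i <oo) (s i ^+ r.+1 * (1 - s i) ^+ m)%:E)%E.

Lemma sdown_le1 s i : s i <= 1.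
Proof. exact: subprob_le1 (sdown_subprob s) i. Qed.

Lemma power_moment_term_ge0 s r m i : (0 <= (s i ^+ r * (1 - s i) ^+ m)%:E)%E.
Proof.
by rewrite lee_fin mulr_ge0 ?exprn_ge0 ?sdown_ge0 // subr_ge0 sdown_le1.
Qed.

Lemma power_moment_ge0 s r m : (0 <= power_moment s r m)%E.
Proof. by apply: nneseries_ge0 => i _ _; exact: power_moment_term_ge0. Qed.

Lemma power_moment0 s r : power_moment s r 0 = (psum s r.+1)%:E.
Proof.
rewrite -psumE //; last exact: sdown_subprob.
by apply: eq_eseriesr => i _; rewrite expr0 mulr1.
Qed.

Lemma power_moment_split s r m :
  power_moment s r m = (power_moment s r m.+1 + power_moment s r.+1 m)%E.
Proof.
rewrite /power_moment -nneseriesD; last 2 first.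
- by move=> i _ _; exact: power_moment_term_ge0.
- by move=> i _ _; exact: power_moment_term_ge0.
apply: eq_eseriesr => i _; rewrite -EFinD; congr (_%:E).
by rewrite !exprS; ring.
Qed.

Lemma measurable_power_moment r m : measurable_fun setT (fun s => power_moment s r m).
Proof.
apply: ge0_emeasurable_sum => [i s _ _|i _]; first exact: power_moment_term_ge0.
apply/measurable_EFinP; apply: measurable_funM; apply: measurable_funX.
  exact: measurable_sdown.
by apply: measurable_funB => //; exact: measurable_sdown.
Qed.

(** All terms have the same sign, so the expansion of each [- s(i) ln s(i)] may be
summed over [i] first. *)
Lemma shannon_power_moments s :
  shannon s = (\sum_(0 <= m <oo) m.+1%:R^-1%:E * power_moment s 0 m.+1)%E.
Proof.
have xlnx i : s i * ln (s i) <= 0.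
  by rewrite mulr_ge0_le0 ?sdown_ge0 // ln_le0 // sdown_le1.
have ge i m : (0 <= (m.+1%:R^-1 * (s i * (1 - s i) ^+ m.+1))%:E)%E.
  by rewrite lee_fin !mulr_ge0 ?exprn_ge0 ?sdown_ge0 // subr_ge0 sdown_le1.
transitivity (\sum_(0 <= i <oo) (- (s i * ln (s i)))%:E)%E.
  rewrite /shannon -limeN; last by apply: is_cvg_npeseries => i _ _; rewrite lee_fin.
  congr (limn _); apply/funext => n /=.
  by rewrite !sumEFin -EFinN sumrN.
under eq_eseriesr => i _ do rewrite -entropy_series ?sdown_ge0 ?sdown_le1 //.
rewrite nneseries_interchange; last by move=> i m; exact: ge.
apply: eq_eseriesr => m _; rewrite -nneseriesZl; last first.
  by move=> i _; exact: power_moment_term_ge0.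
by apply: eq_eseriesr => i _; rewrite expr1 -EFinM.
Qed.

Lemma shannon_ge0 s : (0 <= shannon s)%E.
Proof.
rewrite shannon_power_moments; apply: nneseries_ge0 => m _ _.
by rewrite mule_ge0 ?power_moment_ge0.
Qed.

Lemma measurable_shannon : measurable_fun setT (@shannon R).
Proof.
rewrite (_ : @shannon R = fun s => (\sum_(0 <= m <oo) m.+1%:R^-1%:E * power_moment s 0 m.+1)%E).
  apply: ge0_emeasurable_sum => [m s _ _|m _].
    by rewrite mule_ge0 ?power_moment_ge0.
  by apply: measurable_funeM; exact: measurable_power_moment.
by apply/funext => s; exact: shannon_power_moments.
Qed.

Lemma measurable_psum_sdown r : measurable_fun setT (fun s => psum s r).
Proof. by apply: measurable_psum => [j|s j]; [exact: measurable_sdown|exact: sdown_ge0]. Qed.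

Lemma giniE kappa s : gini kappa s = (1 - psum s kappa.+1)%:E.
Proof. by rewrite /gini psumE //; exact: sdown_subprob. Qed.

Lemma gini_ge0 kappa s : (0 <= gini kappa s)%E.
Proof.
by rewrite giniE lee_fin subr_ge0 psum_le1 //; exact: sdown_subprob.
Qed.

Lemma measurable_gini kappa : measurable_fun setT (@gini R kappa).
Proof.
rewrite (_ : gini kappa = fun s : sdown R => (1 - psum s kappa.+1)%:E).
  apply/measurable_EFinP; apply: measurable_funB => //; exact: measurable_psum_sdown.
by apply/funext => s; exact: giniE.
Qed.

End power_moments.

Section posterior.
Variables (R : realType) (alpha theta : R) (P : probability (sdown R) R).
Hypotheses (a0 : 0 <= alpha) (a1 : alpha < 1) (ht : - alpha < theta).
Hypothesis PD : is_PDP alpha theta P.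

(** The posterior mean of [power_moment s r m], which is the mean of [V^r (1 - V)^m]
for the frequency [V] of the species of the next individual.  That species is an
old one of size [x] with probability [(x - alpha) / (theta + n)], and [V] then has
law Beta(x + 1 - alpha, theta + n + alpha - x); if it is new, [V] has law
Beta(1 - alpha, theta + n + alpha). *)
Definition posterior_power (q : seq nat) (r m : nat) : R :=
  (\sum_(x <- q) (x%:R - alpha) *
      beta_moment (x%:R + 1 - alpha) (theta + (sumn q)%:R + alpha - x%:R) r m
   + (theta + (size q)%:R * alpha) *
      beta_moment (1 - alpha) (theta + (sumn q)%:R + alpha) r m)
  / (theta + (sumn q)%:R).

Let dsum_ge0' q (s : sdown R) : all (ltn 0%N) q -> 0 <= dsum (psum s) q.
Proof. by move=> q0; rewrite dsum_ge0 //; exact: sdown_subprob. Qed.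

Let mdsum q : measurable_fun setT (fun s : sdown R => (dsum (psum s) q)%:E).
Proof. by apply/measurable_EFinP; exact: measurable_dsum_sdown. Qed.

Variable q : seq nat.
Hypotheses (q0 : all (ltn 0%N) q) (qN : q != [::]).

Lemma sum_theta_gt0 : 0 < theta + (sumn q)%:R.
Proof.
have n1 : 1 <= (sumn q)%:R :> R.
  by rewrite ler1n (leq_trans _ (sumn_ge_size q0)) // lt0n size_eq0.
by move: a1 ht n1; lra.
Qed.

Lemma posterior_power0 r :
  posterior_power q r 0
  = (\sum_(x <- q) rising (x%:R - alpha) r.+1
     + (theta + (size q)%:R * alpha) * rising (1 - alpha) r)
    / rising (theta + (sumn q)%:R) r.+1.
Proof.
have n0 := sum_theta_gt0.
have bmE (x y : R) : x + y = theta + (sumn q)%:R + 1 ->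
    beta_moment x y r 0 = rising x r / rising (theta + (sumn q)%:R + 1) r.
  by move=> xy; rewrite /beta_moment xy addn0 rising0 mulr1.
rewrite /posterior_power (bmE (1 - alpha)); last by ring.
rewrite (eq_bigr (fun x : nat => rising (x%:R - alpha) r.+1 /
    rising (theta + (sumn q)%:R + 1) r)); last first.
  by move=> x _; rewrite bmE; [rewrite risingSl mulrA addrAC|ring].
rewrite -mulr_suml risingSl.
have n1 : rising (theta + (sumn q)%:R + 1) r != 0.
  by rewrite gt_eqF // rising_gt0 // addr_gt0.
have n0' : theta + (sumn q)%:R != 0 by rewrite gt_eqF.
by field; rewrite n0' n1.
Qed.

(** The product of a power sum and a distinct-index sum is a sum of distinct-index
sums. *)
Lemma integral_psum_dsum r :
  (\int[P]_s ((psum s r.+1)%:E * (dsum (psum s) q)%:E)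
   = (pitman_moment alpha theta q * posterior_power q r 0)%:E)%E.
Proof.
have E s : ((psum s r.+1)%:E * (dsum (psum s) q)%:E
    = (dsum (psum s) (r.+1 :: q))%:E + \sum_(q' <- bumps r.+1 q) (dsum (psum s) q')%:E)%E.
  by rewrite -EFinM sumEFin -EFinD dsum_cons subrK.
under eq_integral do rewrite E.
have rq0 : all (ltn 0%N) (r.+1 :: q) by [].
rewrite ge0_integralD //.
- rewrite ge0_integral_sum_seq.
  + rewrite (PDP_dsum a0 a1 ht PD rq0).
    rewrite (eq_big_seq (fun q' => (pitman_moment alpha theta q')%:E)); last first.
      by move=> q' hq'; rewrite (PDP_dsum a0 a1 ht PD (bumps_gt0 q0 hq')).
    rewrite sumEFin -EFinD (pitman_moment_bumps a0 a1 ht) // -mulrA; congr ((_ * _)%:E).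
    by rewrite posterior_power0.
  + by move=> q' _; exact: mdsum.
  + by move=> q' s hq'; rewrite lee_fin dsum_ge0' // (bumps_gt0 q0 hq').
- by move=> s _; rewrite lee_fin dsum_ge0'.
- by move=> s _; rewrite big_seq; apply: sume_ge0 => q' hq';
    rewrite lee_fin dsum_ge0' // (bumps_gt0 q0 hq').
- by apply: emeasurable_sum => q'; exact: mdsum.
Qed.

Let power_dsum_ge0 (s : sdown R) r m : (0 <= power_moment s r m * (dsum (psum s) q)%:E)%E.
Proof. by rewrite mule_ge0 ?power_moment_ge0 // lee_fin dsum_ge0'. Qed.

Let mpower_dsum r m :
  measurable_fun setT (fun s : sdown R => (power_moment s r m * (dsum (psum s) q)%:E)%E).
Proof. by apply: emeasurable_funM => //; exact: measurable_power_moment. Qed.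

(** Both sides obey the Pascal rule [(r, m) = (r, m + 1) + (r + 1, m)], which leaves
[m = 0]. *)
Lemma integral_power_moment r m :
  (\int[P]_s (power_moment s r m * (dsum (psum s) q)%:E)
   = (pitman_moment alpha theta q * posterior_power q r m)%:E)%E.
Proof.
elim: m r => [|m IH] r.
  by under eq_integral do rewrite power_moment0; exact: integral_psum_dsum.
have n0 := sum_theta_gt0.
have ps : posterior_power q r m = posterior_power q r m.+1 + posterior_power q r.+1 m.
  rewrite /posterior_power -mulrDl; congr (_ / _).
  rewrite addrACA -mulrDr -big_split /=; congr (_ + _ * _).
    apply: eq_bigr => x _; rewrite -mulrDr -beta_moment_split //.
    by rewrite [ltRHS](_ : _ = theta + (sumn q)%:R + 1); [rewrite addr_gt0|ring].
  rewrite -beta_moment_split //.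
  by rewrite [ltRHS](_ : _ = theta + (sumn q)%:R + 1); [rewrite addr_gt0|ring].
have := IH r; under eq_integral => s _.
  rewrite power_moment_split ge0_muleDl ?power_moment_ge0 //; over.
rewrite ge0_integralD // IH ps mulrDr EFinD.
set u := (\int[P]_s _)%E => h.
have : u \is a fin_num.
  have u0 : (0 <= u)%E by apply: integral_ge0 => s _; exact: power_dsum_ge0.
  rewrite ge0_fin_numE //.
  apply: (@le_lt_trans _ _ (u + (pitman_moment alpha theta q * posterior_power q r.+1 m)%:E)%E).
    rewrite -IH leeDl //; apply: integral_ge0 => s _; exact: power_dsum_ge0.
  by rewrite h -EFinD ltry.
move=> fu; move: h; rewrite -(fineK fu) -!EFinD => h; congr (_%:E).
by have := EFin_inj h; lra.
Qed.

Lemma posterior_power_ge0 r m : 0 <= posterior_power q r m.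
Proof.
have pm0 : 0 < pitman_moment alpha theta q by exact: pitman_moment_gt0.
rewrite -(pmulr_rge0 _ pm0) -lee_fin -integral_power_moment.
by apply: integral_ge0 => s _; exact: power_dsum_ge0.
Qed.

Lemma integral_shannon :
  (\int[P]_s (shannon s * (dsum (psum s) q)%:E)
   = (pitman_moment alpha theta q)%:E *
     \sum_(0 <= m <oo) (m.+1%:R^-1 * posterior_power q 0 m.+1)%:E)%E.
Proof.
transitivity (\int[P]_s \sum_(0 <= m <oo)
    (m.+1%:R^-1%:E * (power_moment s 0 m.+1 * (dsum (psum s) q)%:E)))%E.
  apply: eq_integral => s _; rewrite shannon_power_moments muleC -nneseriesZl; last first.
    by move=> m _; rewrite mule_ge0 ?power_moment_ge0.
  by apply: eq_eseriesr => m _; rewrite muleCA; congr (_ * _)%E; rewrite muleC.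
rewrite integral_nneseries //; last 2 first.
- by move=> m; apply: measurable_funeM.
- by move=> m s _; rewrite mule_ge0.
rewrite -nneseriesZl; last first.
  by move=> m _; rewrite lee_fin mulr_ge0 // posterior_power_ge0.
apply: eq_eseriesr => m _.
rewrite ge0_integralZl_EFin // integral_power_moment -!EFinM; congr (_%:E).
by rewrite mulrCA.
Qed.

Lemma integral_gini kappa :
  (\int[P]_s (gini kappa s * (dsum (psum s) q)%:E)
   = (pitman_moment alpha theta q * (1 - posterior_power q kappa 0))%:E)%E.
Proof.
have E (s : sdown R) : ((dsum (psum s) q)%:E = gini kappa s * (dsum (psum s) q)%:E
    + (psum s kappa.+1)%:E * (dsum (psum s) q)%:E)%E.
  by rewrite giniE -!EFinM -EFinD; congr (_%:E); ring.
have g0 (s : sdown R) : (0 <= gini kappa s * (dsum (psum s) q)%:E)%E.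
  rewrite giniE -EFinM lee_fin mulr_ge0 ?dsum_ge0' // subr_ge0 psum_le1 //.
  exact: sdown_subprob.
have p0 (s : sdown R) : (0 <= (psum s kappa.+1)%:E * (dsum (psum s) q)%:E)%E.
  rewrite -EFinM lee_fin mulr_ge0 ?dsum_ge0' // psum_ge0 //.
  exact: sdown_subprob.
have mg : measurable_fun setT (fun s : sdown R => gini kappa s * (dsum (psum s) q)%:E)%E.
  apply: emeasurable_funM => //; exact: measurable_gini.
have mp : measurable_fun setT (fun s : sdown R => (psum s kappa.+1)%:E * (dsum (psum s) q)%:E)%E.
  by apply: emeasurable_funM => //; apply/measurable_EFinP; exact: measurable_psum_sdown.
have := PDP_dsum a0 a1 ht PD q0; under eq_integral do rewrite E.
rewrite ge0_integralD // integral_psum_dsum.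
set u := (\int[P]_s _)%E => h.
have fu : u \is a fin_num.
  have u0 : (0 <= u)%E by apply: integral_ge0.
  rewrite ge0_fin_numE //.
  apply: (@le_lt_trans _ _ (u + (pitman_moment alpha theta q * posterior_power q kappa 0)%:E)%E).
    by rewrite -integral_psum_dsum leeDl //; apply: integral_ge0.
  by rewrite h ltry.
move: h; rewrite -(fineK fu) -!EFinD => h; congr (_%:E).
by have := EFin_inj h; lra.
Qed.

End posterior.

(** * Posterior means given an abundance vector *)

Section posterior_values.
Variables (R : realType) (alpha theta : R) (P : probability (sdown R) R).
Hypotheses (a0 : 0 <= alpha) (a1 : alpha < 1) (ht : - alpha < theta).
Hypothesis PD : is_PDP alpha theta P.
Variable E : exch_partition P.

Lemma measurable_abundance_event p : measurable (@abundance_event _ _ E p).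
Proof.
apply: (@discrete_measurable_rel_abundance _ _
  (fun w => paint_same (@ep_left _ _ E) (ep_X E) (ep_S E w) w) (sumn p) _ [set p]).
move=> l m.
apply: (@measurable_paint_same R _ _ _ _ (ep_X E) (ep_leftP E) _ _ (fun w => ep_S E w) id) => //.
Qed.

(** The combinatorial factor [partition_count p] cancels in the quotient. *)
Lemma posterior_meanE p (G : sdown R -> \bar R) (g : R) :
  all (ltn 0%N) p -> measurable_fun setT G -> (forall s, 0 <= G s)%E ->
  (\int[P]_s (G s * (dsum (psum s) (rev p))%:E)
   = (pitman_moment alpha theta (rev p) * g)%:E)%E ->
  posterior_mean E p G = g.
Proof.
move=> p0 mG G0 HG.
have rp0 : all (ltn 0%N) (rev p) by rewrite all_rev.
set N : R := (partition_count p)%:R.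
have N0 : 0 < N by rewrite ltr0n partition_count_gt0.
have pm0 : 0 < pitman_moment alpha theta (rev p) by exact: pitman_moment_gt0.
have md : measurable_fun setT (fun s : sdown R => (dsum (psum s) (rev p))%:E).
  by apply/measurable_EFinP; exact: measurable_dsum_sdown.
have d0 (s : sdown R) : (0 <= (dsum (psum s) (rev p))%:E)%E.
  by rewrite lee_fin dsum_ge0 //; exact: sdown_subprob.
have key (F : sdown R -> \bar R) (f : R) : measurable_fun setT F -> (forall s, 0 <= F s)%E ->
    (\int[P]_s (F s * (dsum (psum s) (rev p))%:E) = f%:E)%E ->
    (\int[ep_Pr E]_(w in @abundance_event _ _ E p) F (ep_S E w) = (N * f)%:E)%E.
  move=> mF F0 HF; rewrite integral_abundance_event // EFinM -HF.
  rewrite -ge0_integralZl_EFin ?(ltW N0) //.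
  - by apply: eq_integral => s _; rewrite EFinM muleCA.
  - by move=> s _; rewrite mule_ge0.
  - exact: emeasurable_funM.
have P1 : ep_Pr E (@abundance_event _ _ E p) = (N * pitman_moment alpha theta (rev p))%:E.
  rewrite -(@key (fun=> 1%E)) //; last first.
    under eq_integral do rewrite mul1e.
    by rewrite (PDP_dsum a0 a1 ht PD rp0).
  by rewrite (@integral_cst _ _ _ _ _ _ 1%E) ?mul1e //; exact: measurable_abundance_event.
rewrite /posterior_mean (key _ _ mG G0 HG) P1 /=.
by field; rewrite !gt_eqF.
Qed.

Definition shifted_harmonic (x : nat) : R := \sum_(i < x) (i.+1%:R - alpha)^-1.

Lemma nneseries_lincomb (s : seq nat) (u : nat -> R) (t : nat -> nat -> R) :
  (forall x, x \in s -> 0 <= u x) -> (forall x m, x \in s -> 0 <= t x m) ->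
  (\sum_(0 <= m <oo) (\sum_(x <- s) u x * t x m)%:E
   = \sum_(x <- s) (u x)%:E * \sum_(0 <= m <oo) (t x m)%:E)%E.
Proof.
elim: s => [|y s IH] u0 t0.
  by rewrite big_nil eseries0 // => m _ _; rewrite big_nil.
have us x : x \in s -> 0 <= u x by move=> xs; apply: u0; rewrite in_cons xs orbT.
have ts x m : x \in s -> 0 <= t x m by move=> xs; apply: t0; rewrite in_cons xs orbT.
have y0 : 0 <= u y by apply: u0; rewrite mem_head.
have ty m : 0 <= t y m by apply: t0; rewrite mem_head.
rewrite big_cons -IH // -nneseriesZl; last by move=> m _; rewrite lee_fin.
rewrite -nneseriesD; last 2 first.
- by move=> m _ _; rewrite -EFinM lee_fin mulr_ge0.
- move=> m _ _; rewrite lee_fin big_seq; apply: sumr_ge0 => x xs.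
  by rewrite mulr_ge0 ?us ?ts.
by apply: eq_eseriesr => m _; rewrite big_cons EFinD EFinM.
Qed.

Lemma mem_le_sumn (q : seq nat) x : x \in q -> (x <= sumn q)%N.
Proof.
elim: q => //= y q IH; rewrite in_cons => /orP[/eqP ->|/IH]; lia.
Qed.

Section value.
Variable q : seq nat.
Hypotheses (q0 : all (ltn 0%N) q) (qN : q != [::]).

Let n0 : 0 < theta + (sumn q)%:R. Proof. exact: (sum_theta_gt0 a1 ht q0 qN). Qed.

Let lm (x : nat) : \bar R :=
  log_moment (theta + (sumn q)%:R + alpha - x%:R) (theta + (sumn q)%:R + 1).

Let b0 (x : nat) : (x <= sumn q)%N -> 0 < theta + (sumn q)%:R + alpha - x%:R.
Proof. by rewrite -(ler_nat R) => xn; move: ht xn; lra. Qed.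

Let lm_fin (x : nat) : (x <= sumn q)%N -> lm x \is a fin_num.
Proof.
move=> xn; apply: log_moment_fin; first exact: b0.
by have := ler0n R x; move: a1; lra.
Qed.

Let lm_step (x : nat) : (x <= sumn q)%N ->
  fine (lm x) = fine (lm 0%N) - shifted_harmonic x.
Proof.
elim: x => [_|x IH xn]; first by rewrite /shifted_harmonic big_ord0 subr0.
have E1 : theta + (sumn q)%:R + alpha - x%:R = theta + (sumn q)%:R + alpha - x.+1%:R + 1.
  by rewrite -natr1; ring.
have := IH (ltnW xn); rewrite {1}/lm E1 log_moment_step; last 2 first.
- exact: b0.
- by rewrite -natr1; have := ler0n R x; move: a1; lra.
rewrite fineD ?lm_fin // -/(lm x.+1) /=.
rewrite (_ : theta + (sumn q)%:R + 1 - (theta + (sumn q)%:R + alpha - x.+1%:R + 1)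
  = x.+1%:R - alpha); last by ring.
rewrite /shifted_harmonic big_ord_recr /= => h.
by rewrite -[LHS](addrK (x.+1%:R - alpha)^-1) h; ring.
Qed.

(** Collecting the terms of equal species size gives the mean of [log_moment] under
the predictive probabilities; each value is reduced to that at size 0 by
[log_moment_step].  The constant depends on [q] through [sumn q] only. *)
Lemma posterior_entropyE :
  (\sum_(0 <= m <oo) (m.+1%:R^-1 * posterior_power alpha theta q 0 m.+1)%:E
   = (fine (lm 0%N) -
      (\sum_(x <- q) (x%:R - alpha) * shifted_harmonic x) / (theta + (sumn q)%:R))%:E)%E.
Proof.
set c := theta + (sumn q)%:R + 1.
pose t (x : nat) m := m.+1%:R^-1 * (rising (theta + (sumn q)%:R + alpha - x%:R) m.+1 / rising c m.+1).
have t0 x m : (x <= sumn q)%N -> 0 <= t x m.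
  move=> xn; rewrite mulr_ge0 // divr_ge0 // ltW // rising_gt0 ?b0 //.
  by rewrite addr_gt0.
have bm (y : R) (x : nat) m : y + (theta + (sumn q)%:R + alpha - x%:R) = c ->
    beta_moment y (theta + (sumn q)%:R + alpha - x%:R) 0 m.+1
    = rising (theta + (sumn q)%:R + alpha - x%:R) m.+1 / rising c m.+1.
  by move=> yE; rewrite /beta_moment yE rising0 mul1r add0n.
pose u (x : nat) := (x%:R - alpha) / (theta + (sumn q)%:R).
pose u0 := (theta + (size q)%:R * alpha) / (theta + (sumn q)%:R).
have u_ge0 x : x \in q -> 0 <= u x.
  move=> xq; rewrite divr_ge0 ?(ltW n0) // subr_ge0.
  have : (1 : R) <= x%:R by rewrite ler1n; exact: (allP q0 _ xq).
  by move: a1; lra.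
have u0_ge0 : 0 <= u0.
  rewrite divr_ge0 ?(ltW n0) //.
  have h : alpha <= (size q)%:R * alpha by rewrite ler_peMl // ler1n; case: (q) qN.
  by move: ht h; lra.
transitivity (\sum_(0 <= m <oo) (\sum_(x <- q) u x * t x m)%:E
    + \sum_(0 <= m <oo) (u0 * t 0%N m)%:E)%E.
  rewrite -nneseriesD; last 2 first.
  - move=> m _ _; rewrite lee_fin big_seq; apply: sumr_ge0 => x xq.
    by rewrite mulr_ge0 ?u_ge0 ?t0 // mem_le_sumn.
  - by move=> m _ _; rewrite lee_fin mulr_ge0 // t0.
  apply: eq_eseriesr => m _; rewrite -EFinD; congr (_%:E).
  rewrite /posterior_power.
  have -> : beta_moment (1 - alpha) (theta + (sumn q)%:R + alpha) 0 m.+1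
     = rising (theta + (sumn q)%:R + alpha - 0%:R) m.+1 / rising c m.+1.
    by rewrite -(@bm (1 - alpha)) ?subr0 // /c; ring.
  rewrite (eq_bigr (fun x : nat => (x%:R - alpha) *
     (rising (theta + (sumn q)%:R + alpha - x%:R) m.+1 / rising c m.+1))); last first.
    by move=> x _; rewrite bm // /c; ring.
  rewrite [in RHS](eq_bigr (fun x : nat => (m.+1%:R^-1 / (theta + (sumn q)%:R)) *
     ((x%:R - alpha) *
     (rising (theta + (sumn q)%:R + alpha - x%:R) m.+1 / rising c m.+1)))); last first.
    by move=> x _; rewrite /u /t; ring.
  rewrite -mulr_sumr /u0 /t; ring.
rewrite nneseries_lincomb; last 2 first.
- exact: u_ge0.
- by move=> x m xq; rewrite t0 // mem_le_sumn.
under [X in (_ + X)%E]eq_eseriesr => m _ do rewrite EFinM.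
rewrite nneseriesZl; last by move=> m _; rewrite lee_fin t0.
have lmE x : (x <= sumn q)%N -> (\sum_(0 <= m <oo) (t x m)%:E)%E = (fine (lm x))%:E.
  by move=> xn; rewrite fineK ?lm_fin.
rewrite lmE // (eq_big_seq (fun x => (u x * (fine (lm 0%N) - shifted_harmonic x))%:E)); last first.
  by move=> x xq; rewrite lmE ?mem_le_sumn // lm_step ?mem_le_sumn.
rewrite sumEFin -EFinM -EFinD; congr (_%:E).
(* The predictive probabilities of the old species and of a new one add up to 1. *)
have S : \sum_(x <- q) u x + u0 = 1.
  rewrite /u -mulr_suml /u0 -mulrDl.
  have -> : \sum_(x <- q) (x%:R - alpha) = (sumn q)%:R - (size q)%:R * alpha :> R.
    elim: (q) => [|x s IH]; first by rewrite big_nil /=; ring.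
    by rewrite big_cons IH /= natrD -[(size s).+1%:R]natr1; ring.
  by rewrite [X in X / _](_ : _ = theta + (sumn q)%:R); [rewrite divff // gt_eqF|ring].
rewrite (eq_bigr (fun x : nat => u x * fine (lm 0%N)
    - (x%:R - alpha) * shifted_harmonic x / (theta + (sumn q)%:R))); last first.
  by move=> x _; rewrite mulrBr /u; congr (_ - _); ring.
rewrite sumrB.
have -> : \sum_(x <- q) u x * fine (lm 0%N) = (\sum_(x <- q) u x) * fine (lm 0%N).
  by rewrite mulr_suml.
rewrite -[X in _ - X + _]mulr_suml addrAC -mulrDl S; ring.
Qed.
End value.
End posterior_values.

(** * Additive functionals of the abundance vector *)

Section additive.
Variable R : realType.

Lemma sum_incr_nth (phi : nat -> R) p j : (j < size p)%N ->
  \sum_(x <- incr_nth p j) phi x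
  = \sum_(x <- p) phi x + (phi (nth 0%N p j).+1 - phi (nth 0%N p j)).
Proof.
elim: p j => [//|x p IH] [|j] /= jp; rewrite !big_cons /=; first by ring.
by rewrite IH //; ring.
Qed.

(** A new species contributes [phi 1 = 0]; otherwise one term changes from [phi x] to
[phi (x + 1)]. *)
Lemma additive_new_species (phi : nat -> R) p0 p1 :
  all (ltn 0%N) p0 -> successors p0 p1 ->
  phi 1%N = 0 -> (forall x, (0 < x)%N -> phi x.+1 != phi x) ->
  \sum_(x <- p1) phi x = \sum_(x <- p0) phi x <-> p1 = rcons p0 1%N.
Proof.
move=> p0_gt0 sp phi1 phiS; split=> [|->]; last first.
  by rewrite -cats1 big_cat /= big_seq1 phi1 addr0.
case: sp => [[j jp ->]|//]; rewrite sum_incr_nth //.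
move=> h; have /eqP[] := phiS _ (allP p0_gt0 _ (mem_nth 0%N jp)).
by apply/eqP; rewrite -subr_eq0; apply/eqP/(addrI (\sum_(x <- p0) phi x)); rewrite h addr0.
Qed.

Lemma natr_sumn p : (sumn p)%:R = \sum_(x <- p) x%:R :> R.
Proof. by rewrite sumnE natr_sum. Qed.

Lemma sumn_ones n : sumn (ones n) = n.
Proof. by rewrite /ones sumn_nseq mul1n. Qed.

Lemma sum_ones (phi : nat -> R) n : \sum_(x <- ones n) phi x = n%:R * phi 1%N.
Proof. by rewrite /ones big_nseq iter_addr_0 mulr_natl. Qed.

(** Here [phi x = x^(kappa + 1) - x]: the value 1 of each of the [n] singletons is
spread over the species as [sum_j pi j = n]. *)
Lemma ell_giniE kappa p : (0 < sumn p)%N ->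
  ell_gini R kappa p = \sum_(x <- p) (x%:R ^+ kappa.+1 - x%:R).
Proof.
move=> p0; have n0 : (sumn p)%:R != 0 :> R by rewrite pnatr_eq0 -lt0n.
rewrite /ell_gini /plug_gini sumn_ones sum_ones sumrB -natr_sumn.
have -> : \sum_(x <- p) (x%:R / (sumn p)%:R) ^+ kappa.+1
   = (\sum_(x <- p) x%:R ^+ kappa.+1) / (sumn p)%:R ^+ kappa.+1 :> R.
  by rewrite mulr_suml; apply: eq_bigr => x _; rewrite expr_div_n.
rewrite expr_div_n expr1n.
have nk : (sumn p)%:R ^+ kappa.+1 != 0 :> R by rewrite expf_neq0.
by field; exact: nk.
Qed.

Lemma ell_shannonE p : all (ltn 0%N) p -> (0 < sumn p)%N ->
  ell_shannon R p = \sum_(x <- p) x%:R * ln x%:R.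
Proof.
move=> p_gt0 p0; have n0 : 0 < (sumn p)%:R :> R by rewrite ltr0n.
have n0' : (sumn p)%:R != 0 :> R by rewrite gt_eqF.
rewrite /ell_shannon /plug_shannon sumn_ones sum_ones.
have -> : \sum_(x <- p) x%:R / (sumn p)%:R * ln (x%:R / (sumn p)%:R)
   = (\sum_(x <- p) x%:R * ln x%:R) / (sumn p)%:R - ln (sumn p)%:R :> R.
  rewrite (eq_big_seq (fun x : nat => x%:R * ln x%:R / (sumn p)%:R
      - x%:R * (ln (sumn p)%:R / (sumn p)%:R))).
    by rewrite sumrB -!mulr_suml -natr_sumn; field.
  move=> x xp; have x0 : 0 < x%:R :> R by rewrite ltr0n; exact: (allP p_gt0 _ xp).
  by rewrite ln_div ?posrE //; ring.
by rewrite mul1r lnV ?posrE //; field.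
Qed.
End additive.

Section steps.
Variable R : realType.

Lemma gini_step kappa x : (0 < kappa)%N -> (0 < x)%N ->
  (x.+1%:R ^+ kappa.+1 - x.+1%:R : R) != x%:R ^+ kappa.+1 - x%:R.
Proof.
move=> k0 x0; rewrite gt_eqF //.
have x1 : 1 <= x%:R :> R by rewrite ler1n.
rewrite !(exprS _ kappa).
have E (y : R) : y * y ^+ kappa - y = y * (y ^+ kappa - 1) by rewrite mulrBr mulr1.
rewrite !E ltr_pM ?ltr_nat ?subr_ge0 ?exprn_ege1 //.
by rewrite ltrD2r ltrXn2r ?ltr_nat //; rewrite -lt0n.
Qed.

Lemma shannon_step x : (0 < x)%N ->
  (x.+1%:R * ln x.+1%:R : R) != x%:R * ln x%:R.
Proof.
move=> x0; rewrite gt_eqF //.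
have l0 : 0 <= ln x%:R :> R by rewrite ln_ge0 // ler1n.
have l1 : ln x%:R < ln x.+1%:R :> R by rewrite ltr_ln ?posrE ?ltr0n // ltr_nat.
by rewrite ltr_pM // ltr_nat.
Qed.

Variable alpha : R.
Hypotheses (a0 : 0 <= alpha) (a1 : alpha < 1).

Lemma bayes_shannon_step (x : nat) : (0 < x)%N ->
  (x.+1%:R - alpha) * shifted_harmonic alpha x.+1 - x.+1%:R
  != (x%:R - alpha) * shifted_harmonic alpha x - x%:R.
Proof.
move=> x0.
have xa : x.+1%:R - alpha != 0.
  by rewrite subr_eq0 gt_eqF // (lt_le_trans a1) // ler1n.
have h0 : 0 < shifted_harmonic alpha x.
  rewrite /shifted_harmonic; case: x x0 {xa} => // x _; rewrite big_ord_recr /=.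
  have pos (i : nat) : 0 < (i.+1%:R - alpha)^-1.
    by rewrite invr_gt0 subr_gt0 (lt_le_trans a1) // ler1n.
  by rewrite ltr_wpDl ?pos // sumr_ge0 // => i _; rewrite ltW.
rewrite -subr_eq0 (_ : _ - _ = shifted_harmonic alpha x) ?gt_eqF //.
rewrite {1}/shifted_harmonic big_ord_recr /= -/(shifted_harmonic alpha x).
by move: xa; rewrite -natr1 => xa; field.
Qed.

(** Discrete analogue of the power rule; it makes the increments of the Bayesian
[phi] differences of rising factorials. *)
Lemma rising_diff (y : R) k :
  rising (y + 1) k.+1 - rising y k.+1 = k.+1%:R * rising (y + 1) k.
Proof. by rewrite risingS (risingSl y) -natr1; ring. Qed.

Lemma rising_lt (y z : R) k : 0 < y -> y < z -> (0 < k)%N -> rising y k < rising z k.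
Proof.
move=> y0 yz; elim: k => // -[|k] IH _; first by rewrite !rising1.
rewrite risingS [ltRHS]risingS ltr_pM // ?ltrD2r ?IH //.
  by rewrite ltW // rising_gt0.
by rewrite addr_ge0 // ltW.
Qed.

Lemma bayes_gini_step kappa (x : nat) : (0 < kappa)%N -> (0 < x)%N ->
  rising (x.+1%:R - alpha) kappa.+1 + alpha * rising (1 - alpha) kappa
    - x.+1%:R * (rising (1 - alpha) kappa.+1 + alpha * rising (1 - alpha) kappa)
  != rising (x%:R - alpha) kappa.+1 + alpha * rising (1 - alpha) kappa
    - x%:R * (rising (1 - alpha) kappa.+1 + alpha * rising (1 - alpha) kappa).
Proof.
move=> k0 x0; rewrite -subr_eq0.
have D := rising_diff (x%:R - alpha) kappa.
rewrite (_ : _ - _ = kappa.+1%:R * (rising (x%:R - alpha + 1) kappa - rising (1 - alpha) kappa)).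
  rewrite mulf_neq0 ?pnatr_eq0 // subr_eq0 gt_eqF // rising_lt //.
  - by rewrite subr_gt0.
  - by rewrite addrAC ltrD2r ltrDr ltr0n.
rewrite mulrBr -D (_ : x.+1%:R - alpha = x%:R - alpha + 1); last by rewrite -natr1; ring.
by rewrite [rising (1 - alpha) kappa.+1]risingS -!natr1; ring.
Qed.
End steps.

Section bayes.
Variables (R : realType) (alpha theta : R) (P : probability (sdown R) R).
Hypotheses (a0 : 0 <= alpha) (a1 : alpha < 1) (ht : - alpha < theta).
Hypothesis PD : is_PDP alpha theta P.
Variable E : exch_partition P.

Let rev_hyp p : all (ltn 0%N) p -> (0 < sumn p)%N ->
  all (ltn 0%N) (rev p) /\ rev p != [::].
Proof.
move=> p0 n0; rewrite all_rev; split=> //.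
by rewrite -size_eq0 size_rev size_eq0; apply: contraTneq n0 => ->.
Qed.

Let big_revE (phi : nat -> R) p : \sum_(x <- rev p) phi x = \sum_(x <- p) phi x.
Proof. by apply: perm_big; rewrite perm_rev. Qed.

Let all_ones n : all (ltn 0%N) (ones n).
Proof. by rewrite /ones all_nseq orbT. Qed.

Lemma posterior_mean_gini kappa p : all (ltn 0%N) p -> (0 < sumn p)%N ->
  posterior_mean E p (gini kappa) = 1 -
  (\sum_(x <- p) (rising (x%:R - alpha) kappa.+1 + alpha * rising (1 - alpha) kappa)
    + theta * rising (1 - alpha) kappa) / rising (theta + (sumn p)%:R) kappa.+1.
Proof.
move=> p0 n0; have [rp0 rpN] := rev_hyp p0 n0.
rewrite (posterior_meanE a0 a1 ht PD E p0 (@measurable_gini _ _) (@gini_ge0 _ _)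
  (integral_gini a0 a1 ht PD rp0 rpN kappa)).
rewrite (posterior_power0 a1 ht rp0 rpN) sumn_rev size_rev big_revE.
congr (_ - _ / _); rewrite big_split /= big_const_seq count_predT iter_addr_0 -mulr_natl.
by ring.
Qed.

(** Only differences of posterior means at equal sample sizes matter below, so the
term that depends on the sample size alone is left abstract. *)
Lemma posterior_mean_shannon : exists e : nat -> R, forall p,
  all (ltn 0%N) p -> (0 < sumn p)%N ->
  posterior_mean E p (@shannon R) = e (sumn p) -
  (\sum_(x <- p) (x%:R - alpha) * shifted_harmonic alpha x) / (theta + (sumn p)%:R).
Proof.
exists (fun n => fine (log_moment (theta + n%:R + alpha - 0%:R) (theta + n%:R + 1))) => p p0 n0.
have [rp0 rpN] := rev_hyp p0 n0.
have I := integral_shannon a0 a1 ht PD rp0 rpN.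
rewrite (posterior_entropyE a0 a1 ht rp0 rpN) -EFinM in I.
rewrite (posterior_meanE a0 a1 ht PD E p0 (@measurable_shannon _) (@shannon_ge0 _) I).
by rewrite sumn_rev big_revE.
Qed.

Let theta_n (p : seq nat) : (0 < sumn p)%N -> 0 < theta + (sumn p)%:R.
Proof.
by rewrite -(ler1n R) => n1; move: a1 ht n1; lra.
Qed.

Lemma bayes_ell_giniE kappa p : all (ltn 0%N) p -> (0 < sumn p)%N ->
  bayes_ell_gini E theta kappa p = \sum_(x <- p)
    (rising (x%:R - alpha) kappa.+1 + alpha * rising (1 - alpha) kappa
     - x%:R * (rising (1 - alpha) kappa.+1 + alpha * rising (1 - alpha) kappa)).
Proof.
move=> p0 n0; rewrite /bayes_ell_gini.
rewrite (posterior_mean_gini kappa p0 n0) posterior_mean_gini ?sumn_ones ?all_ones //.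
rewrite big_mkord -/(rising (theta + (sumn p)%:R) kappa.+1) sum_ones [RHS]sumrB.
rewrite -mulr_suml -natr_sumn.
have r0 : rising (theta + (sumn p)%:R) kappa.+1 != 0.
  by rewrite gt_eqF // rising_gt0 // theta_n.
by field.
Qed.

Lemma bayes_ell_shannonE p : all (ltn 0%N) p -> (0 < sumn p)%N ->
  bayes_ell_shannon E theta p
  = \sum_(x <- p) ((x%:R - alpha) * shifted_harmonic alpha x - x%:R).
Proof.
move=> p0 n0; rewrite /bayes_ell_shannon; have [e He] := posterior_mean_shannon.
rewrite (He p) // He ?sumn_ones ?all_ones // sum_ones [RHS]sumrB -natr_sumn.
have n0' : theta + (sumn p)%:R != 0 by rewrite gt_eqF // theta_n.
have h1 : (1 - alpha) * shifted_harmonic alpha 1 = 1.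
  by rewrite /shifted_harmonic big_ord1 divff // subr_eq0 gt_eqF.
by rewrite h1; field.
Qed.
End bayes.

Unset Implicit Arguments.

Theorem corollary1 (R : realType) (kappa n : nat) (pi0 pi1 : seq nat)
  (hkappa : (1 <= kappa)%N) (hn : (2 <= n)%N)
  (hpi0 : abundance_vectors n.-1 pi0) (hpi1 : successors pi0 pi1) :
  [<-> ell_gini R kappa pi1 = ell_gini R kappa pi0;
       ell_shannon R pi1 = ell_shannon R pi0;
       pi1 = rcons pi0 1%N] /\
  (forall (alpha theta : R) (P : probability (sdown R) R),
     0 <= alpha < 1 -> - alpha < theta -> is_PDP alpha theta P ->
     forall E : exch_partition P,
     [<-> pi1 = rcons pi0 1%N;
          bayes_ell_gini E theta kappa pi1 = bayes_ell_gini E theta kappa pi0;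
          bayes_ell_shannon E theta pi1 = bayes_ell_shannon E theta pi0] /\
     [<-> ell_gini R kappa pi1 = ell_gini R kappa pi0;
          ell_shannon R pi1 = ell_shannon R pi0;
          pi1 = rcons pi0 1%N;
          bayes_ell_gini E theta kappa pi1 = bayes_ell_gini E theta kappa pi0;
          bayes_ell_shannon E theta pi1 = bayes_ell_shannon E theta pi0]).
Proof.
have [p0 s0] := hpi0.
have n0 : (0 < sumn pi0)%N by rewrite s0; case: (n) hn => [|[]].
have p1 : all (ltn 0%N) pi1.
  case: hpi1 => [[j jp ->]|->]; last by rewrite all_rcons p0.
  apply/allP => x /(nthP 0%N)[i]; rewrite size_incr_nth jp => ip <-.
  by rewrite nth_incr_nth; apply: ltn_addl; exact: (allP p0 _ (mem_nth 0%N ip)).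
have n1 : (0 < sumn pi1)%N.
  apply: leq_trans (sumn_ge_size p1).
  by case: hpi1 => [[j jp ->]|->]; rewrite ?size_incr_nth ?size_rcons ?jp // (leq_ltn_trans _ jp).
have G : ell_gini R kappa pi1 = ell_gini R kappa pi0 <-> pi1 = rcons pi0 1%N.
  rewrite !ell_giniE //; apply: (additive_new_species p0 hpi1) => [|x x0].
    by rewrite expr1n subrr.
  exact: gini_step.
have H : ell_shannon R pi1 = ell_shannon R pi0 <-> pi1 = rcons pi0 1%N.
  rewrite !ell_shannonE //; apply: (additive_new_species p0 hpi1) => [|x x0].
    by rewrite ln1 mulr0.
  exact: shannon_step.
split; first by tfae; tauto.
move=> alpha theta P /andP[a0 a1] ht PD E.
have BG : bayes_ell_gini E theta kappa pi1 = bayes_ell_gini E theta kappa pi0 <-> pi1 = rcons pi0 1%N.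
  rewrite !(bayes_ell_giniE a0 a1 ht PD) //.
  apply: (additive_new_species p0 hpi1) => [|x x0]; first by rewrite mul1r subrr.
  exact: bayes_gini_step.
have BH : bayes_ell_shannon E theta pi1 = bayes_ell_shannon E theta pi0 <-> pi1 = rcons pi0 1%N.
  rewrite !(bayes_ell_shannonE a0 a1 ht PD) //.
  apply: (additive_new_species p0 hpi1) => [|x x0]; last exact: bayes_shannon_step.
  by rewrite /shifted_harmonic big_ord1 divff ?subrr // subr_eq0 gt_eqF.
by split; tfae; tauto.
Qed.
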